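(* Let $\{Y(t)\}_{t\ge0}$ be a Lévy process whose Laplace exponent is $\psi(\eta)=\sum_{k=1}^{\infty}d_k\eta^k$. Let $m$ be the smallest index $k$ with $d_k\ne0$ and let $\xi=d_m$, i.e. $\xi$ and $m$ are the first non-zero coefficient and the power of the corresponding term in the expansion of $\psi$. Let $\{S_{\alpha,\theta}(t)\}_{t\ge0}$ be the tempered incomplete gamma (TInG) subordinator with parameters $\alpha$ and $\theta>0$, independent of $\{Y(t)\}_{t\ge0}$, and put $Q_{\alpha,\theta}(t):=Y(S_{\alpha,\theta}(t))$. Then, for $p\in(0,1)$, the fractional moment of order $p$ of $\{Q_{\alpha,\theta}(t)\}_{t\ge0}$ is finite for $p<\alpha$, and its asymptotic behaviour is given by $$\mathbb{E}[Q_{\alpha,\theta}(t)]^p\sim\frac{\left(\alpha\theta^{\alpha-1}e^{-\theta}\xi t\right)^{\frac{p}{m}}\Gamma\left(1-\frac{p}{m}\right)}{\Gamma(1-p)}\qquad\text{as } t\to\infty.$$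
   Context: The Laplace exponent $\psi$ of a Lévy process $\{Y(t)\}_{t\ge0}$ is defined by $\mathbb{E}[e^{-\eta Y(t)}]=e^{-t\psi(\eta)}$, $\eta>0$. The lower incomplete gamma function is $\gamma(\alpha;\eta)=\int_0^\eta e^{-y}y^{\alpha-1}\,dy$. The tempered incomplete gamma (TInG) subordinator $\{S_{\alpha,\theta}(t)\}_{t\ge0}$, $0<\alpha\le1$, $\theta>0$, is the non-decreasing Lévy process with $\mathbb{E}[e^{-\eta S_{\alpha,\theta}(t)}]=\exp\left(-t\alpha\left(\gamma(\alpha;\eta+\theta)-\gamma(\alpha;\theta)\right)\right)$, $\eta>0$. The notation $\mathbb{E}[Q]^p$ means $\mathbb{E}[Q^p]$, the $p$-th order moment, and $g\sim h$ means that the ratio $g/h$ tends to $1$ in the indicated limit. *)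

(* Defs.v *)
From HB Require Import structures.
From mathcomp Require Import all_boot all_order all_algebra.
From mathcomp Require Import complex.
From mathcomp Require Import all_classical all_reals all_analysis.

Set Implicit Arguments.
Unset Strict Implicit.
Unset Printing Implicit Defensive.
Import Order.TTheory GRing.Theory Num.Theory numFieldNormedType.Exports.

Local Open Scope classical_set_scope.
Local Open Scope ring_scope.
Local Open Scope complex_scope.

Definition lower_gamma (R : realType) (alpha eta : R) : R :=
  \int[lebesgue_measure]_(y in `[0, eta]) (expR (- y) * y `^ (alpha - 1)).

Definition Gamma (R : realType) (s : R) : R :=
  \int[lebesgue_measure]_(y in `]0, +oo[) (expR (- y) * y `^ (s - 1)).

(* A process (X t), t >= 0, is a function X : R -> T -> R of which only the
   values at times t >= 0 are ever constrained. *)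

(* As every A i may be the full set, the product rule over the whole family
   gives it over all subfamilies. *)
Definition independent_rvs d (T : measurableType d) (R : realType)
    (P : probability T R) (n : nat) (X : 'I_n -> T -> R) : Prop :=
  forall A : 'I_n -> set R, (forall i, measurable (A i)) ->
    P (\bigcap_(i in [set: 'I_n]) (X i @^-1` A i)) =
    (\prod_(i < n) P (X i @^-1` A i))%E.

Definition process_sigma d (T : measurableType d) (R : realType)
    (X : R -> T -> R) : set_system T :=
  <<s [set E | exists (t : R) (A : set R),
         [/\ 0 <= t, measurable A & E = X t @^-1` A]] >>.

Definition independent_processes d (T : measurableType d) (R : realType)
    (P : probability T R) (X Y : R -> T -> R) : Prop :=
  forall A B, process_sigma X A -> process_sigma Y B ->
    P (A `&` B) = (P A * P B)%E.

Definition cadlag (R : realType) (f : R -> R) : Prop :=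
  (forall t : R, 0 <= t -> f s @[s --> t^'+] --> f t) /\
  (forall t : R, 0 < t -> exists l : R, f s @[s --> t^'-] --> l).

Record is_levy d (T : measurableType d) (R : realType) (P : probability T R)
    (X : R -> T -> R) : Prop := IsLevy {
  levy_measurable : forall t : R, 0 <= t -> measurable_fun [set: T] (X t) ;
  levy_start : {ae P, forall w, X 0 w = 0} ;
  levy_indep_increments : forall (n : nat) (t : nat -> R),
    0 <= t 0%N -> (forall i, (i < n)%N -> t i < t i.+1) ->
    independent_rvs P (fun (i : 'I_n) w => X (t i.+1) w - X (t i) w) ;
  levy_stationary_increments : forall s h : R, 0 <= s -> 0 <= h ->
    forall A : set R, measurable A ->
      P ((fun w => X (s + h) w - X s w) @^-1` A) = P (X h @^-1` A) ;
  levy_stoch_continuous : forall t : R, 0 <= t -> forall eps : R, 0 < eps ->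
    P [set w | eps < `|X s w - X t w| ]
      @[s --> within [set s | 0 <= s] (nbhs t)] --> 0%E ;
  levy_cadlag : {ae P, forall w, cadlag (fun t => X t w)}
}.

Definition laplace_exponent d (T : measurableType d) (R : realType)
    (P : probability T R) (X : R -> T -> R) (psi : R -> R) : Prop :=
  forall t eta : R, 0 <= t -> 0 < eta ->
    ('E_P[fun w => expR (- (eta * X t w))] = (expR (- (t * psi eta)))%:E)%E.

Record is_TInG d (T : measurableType d) (R : realType) (P : probability T R)
    (alpha theta : R) (S : R -> T -> R) : Prop := IsTInG {
  ting_levy : is_levy P S ;
  ting_nondecreasing : {ae P, forall w, forall s t : R, 0 <= s -> s <= t ->
    S s w <= S t w} ;
  ting_laplace : laplace_exponent P S (fun eta =>
    alpha * (lower_gamma alpha (eta + theta) - lower_gamma alpha theta))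
}.

Definition subordinate (T : Type) (R : realType) (Y S : R -> T -> R) (t : R) :
  T -> R := fun w => Y (S t w) w.

(* A Levy process may take negative values, and so may the first non-zero
   coefficient of its exponent (e.g. - eta^2 / 2 for Brownian motion).  Real
   powers of negative numbers are therefore read as principal values,
   x^p = |x|^p e^(i pi p) for x < 0; for x >= 0 this is the real power x `^ p.
   (The library's x `^ p is the junk value 1 for x < 0.) *)
Definition ppow (R : realType) (x p : R) : R[i] :=
  if 0 <= x then (x `^ p)%:C
  else (`|x| `^ p)%:C * (cos (pi * p) +i* sin (pi * p)).

Definition cexpectation d (T : measurableType d) (R : realType)
    (P : probability T R) (Z : T -> R[i]) : R[i] :=
  fine ('E_P[fun w => complex.Re (Z w)])%E +i*
  fine ('E_P[fun w => complex.Im (Z w)])%E.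

Definition fractional_moment d (T : measurableType d) (R : realType)
    (P : probability T R) (X : T -> R) (p : R) : R[i] :=
  cexpectation P (fun w => ppow (X w) p).

(* |x^p| = |x|^p also for principal values, so this is E|X^p| < oo. *)
Definition finite_moment d (T : measurableType d) (R : realType)
    (P : probability T R) (X : T -> R) (p : R) : Prop :=
  ('E_P[fun w => (`|X w| `^ p)%R] < +oo)%E.

(* Main.v *)
(* As h -> 0, Fatou's lemma applied to ((1 - e^(- h Y_t)) / h)^2 gives Y_t a second
   moment, with E Y_t = t d_1 and E (Y_t - t d_1)^2 = - 2 t d_2; hence d_1 = d_2 = 0
   forces Y = 0, and m is 1 or 2.  In the same way E S_t = c t, for
   c = alpha theta^(alpha - 1) e^(- theta), and E (S_t - c t)^2 = O(t).
   If m = 1, then Q_t / (c |xi| t) tends to the sign of xi in L^2, and so do its powers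
   of order p.
   If m = 2, replacing the random time S_t by c t changes the characteristic function
   of Q_t / sqrt t by o(1), so that the central limit theorem for Y gives it the
   limit exp(c d_2 u^2).  The fractional moments follow by dominated convergence from
     cos(pi p / 2) Gamma(1 - p) / p |y|^p = int_0^oo (1 - cos(u y)) u^(- 1 - p) du
   and the analogous sine integral for sgn(y) |y|^p. *)

Require Import Defs.
From HB Require Import structures.
From mathcomp Require Import all_boot all_order all_algebra.
From mathcomp Require Import complex.
From mathcomp Require Import all_classical all_reals all_analysis.
From mathcomp Require Import measurable_realfun ring lra.

Set Implicit Arguments.
Unset Strict Implicit.
Unset Printing Implicit Defensive.
Import Order.TTheory GRing.Theory Num.Theory numFieldNormedType.Exports.

Local Open Scope classical_set_scope.
Local Open Scope ring_scope.
Local Open Scope complex_scope.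

(** Only the one-sided Laplace transform is given, so what is needed of characteristic functions is
    extracted from the first two moments and from independent increments, used at integer times. The
    law of Y(S_t) is never computed. The sole tool is a transfer inequality, which carries a bound E
    f(Y_s) <= a + b (s - r)^2 + e s, valid at all fixed times s, over to the random time. It is used
    with f a square, and with f = 1 + g and 1 - g, g a sine or cosine, whose nonnegativity suits
    Fatou's lemma. Estimates of increments are therefore brought to this form, Young's inequality
    replacing square roots. The two Fourier integrals come from the Gamma integral by turning the
    ray of integration from angle 0 to pi / 2; a linear differential equation in the angle replaces
    complex analysis. For m = 2 the coefficient d_2 is negative and the limit law symmetric. As (1 +
    e^(i pi p)) / 2 = cos(pi p / 2) e^(i pi p / 2), the phase of the moment is that of the principal
    power of xi, and the cosine cancels the one in the Fourier formula. *)

Section dominated_convergence_real.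
Context {d} {T : measurableType d} {R : realType}.
Variables (mu : {measure set T -> \bar R}) (D : set T) (mD : measurable D).
Variables (f_ : nat -> T -> R) (f g : T -> R).
Hypothesis mf_ : forall n, measurable_fun D (f_ n).
Hypothesis f_f : forall x, D x -> f_ n x @[n --> \oo] --> f x.
Hypothesis ig : mu.-integrable D (EFin \o g).
Hypothesis f_g : forall n x, D x -> `|f_ n x| <= g x.

Lemma Rintegral_dominated_cvg : mu.-integrable D (EFin \o f) /\
  \int[mu]_(x in D) f_ n x @[n --> \oo] --> \int[mu]_(x in D) f x.
Proof.
have mf : measurable_fun D f by apply: measurable_fun_cvg mf_ f_f.
have [] := @dominated_convergence _ _ _ mu D mD (fun n x => (f_ n x)%:E) (EFin \o f) (EFin \o g).
- by move=> n; apply/measurable_EFinP.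
- by apply/measurable_EFinP.
- by apply: aeW => x Dx; apply: cvg_EFin; [exact: nearW|exact: f_f].
- exact: ig.
- by apply: aeW => x n Dx; rewrite lee_fin f_g.
move=> if_ _ cv; split => //; apply: fine_cvg; rewrite /= in cv.
by rewrite fineK ?(integrable_fin_num mD if_).
Qed.

End dominated_convergence_real.

(** * Power and trigonometric integrals *)

Section power_integrals.
Context {R : realType}.
Notation mu := (@lebesgue_measure R).

Lemma is_derive_continuous (f : R -> R) (x df : R) :
  is_derive x 1 f df -> {for x, continuous f}.
Proof. by case=> fx _; exact/differentiable_continuous/derivable1_diffP. Qed.

Lemma is_derive_derive1 (f : R -> R) (x df : R) : is_derive x 1 f df -> f^`()%classic x = df.
Proof. by case=> _ <-; rewrite derive1E. Qed.

Lemma continuous_powR_gt0 (a x : R) : 0 < x -> {for x, continuous (@powR R ^~ a)}.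
Proof.
by move=> x0; exact: is_derive_continuous (is_derive1_powR a x0).
Qed.

Lemma cvg_powRN_pinfty (q : R) : 0 < q -> (x `^ (- q)) @[x --> +oo] --> (0 : R).
Proof.
move=> q0; apply/cvgrPdist_le => e e0; near=> x.
have x0 : 0 < x by near: x; exact: nbhs_pinfty_gt.
rewrite sub0r normrN ger0_norm ?powR_ge0// powRN invf_ple ?posrE ?powR_gt0//.
have -> : e^-1 = (e^-1 `^ q^-1) `^ q.
  by rewrite -powRrM mulVf ?gt_eqF// powRr1 ?invr_ge0 ?ltW.
apply: ge0_ler_powR; rewrite ?nnegrE ?powR_ge0 ?(ltW q0) ?(ltW x0)//.
Unshelve. all: by end_near. Qed.

Lemma integral_powR_y (q y : R) : 0 < q -> 0 < y ->
  (\int[mu]_(u in `[y, +oo[) (u `^ (- 1 - q))%:E = (y `^ (- q) / q)%:E)%E.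
Proof.
move=> q0 y0.
have dF (x : R) : 0 < x -> is_derive x 1 (fun u : R => - q^-1 * u `^ (- q)) (x `^ (- 1 - q)).
  move=> x0; have := is_derive1_powR (- q) x0.
  move=> H; apply: is_derive_eq.
  by rewrite [X in _ = x `^ X]addrC -[LHS]/(_ * _); field; rewrite gt_eqF.
rewrite (@ge0_continuous_FTC2y _ _ (fun u => - q^-1 * u `^ (- q)) _ 0).
- by rewrite sub0e -EFinN mulNr opprK mulrC.
- by move=> x _; exact: powR_ge0.
- apply: continuous_in_subspaceT => x; rewrite inE/= in_itv/= andbT => yx.
  by apply: continuous_powR_gt0; exact: lt_le_trans yx.
- rewrite -[X in _ --> X](mulr0 (- q^-1)).
  by apply: cvgMr; exact: cvg_powRN_pinfty.
- by move=> x yx; case: (dF x (lt_trans y0 yx)).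
- apply: cvg_at_right_filter; exact: is_derive_continuous (dF y y0).
- by move=> x; rewrite in_itv/= andbT => yx; exact: is_derive_derive1 (dF x (lt_trans y0 yx)).
Qed.

Lemma bigcup_itv_invS : \bigcup_n `[n.+2%:R^-1%R, 1%R : R]%classic = `]0, 1]%classic.
Proof.
apply/seteqP; split => x /=.
  move=> [n _] /=; rewrite !in_itv/= => /andP[nx ->]; rewrite andbT.
  by apply: lt_le_trans nx; rewrite invr_gt0.
rewrite in_itv/= => /andP[x0 x1].
exists (Num.truncn x^-1) => //=; rewrite in_itv/= x1 andbT.
rewrite invf_ple ?posrE// ltW//.
apply: (lt_le_trans (truncnS_gt _)); first by rewrite ler_nat.
Qed.

(** The integrand is singular at 0 when p > 0, so the fundamental theorem is applied on [1/(n+2), 1]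
    and monotone convergence passes to the union ]0, 1]. The shift n+2 keeps the left end strictly
    below 1. *)
Lemma integral_powR_01 (p : R) : p < 1 ->
  (\int[mu]_(u in `]0%R, 1%R]) (u `^ (- p))%:E <= ((1 - p)^-1)%:E)%E.
Proof.
move=> p1.
rewrite -bigcup_itv_invS.
have H : (\int[mu]_(x in `[n.+2%:R^-1%R, 1%R : R]) (x `^ (- p))%:E)%E @[n --> \oo] -->
   (\int[mu]_(x in \bigcup_n `[n.+2%:R^-1%R, 1%R : R]%classic) (x `^ (- p))%:E)%E.
  apply: ge0_nondecreasing_set_cvg_integral => //.
  - move=> n m nm; rewrite subsetEset; apply: subset_itvr.
    by rewrite bnd_simp lef_pV2 ?posrE// ler_nat.
  - by move=> i; apply/measurable_EFinP; apply: measurable_funTS; exact: measurable_powR.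
  - by move=> i x _; rewrite lee_fin powR_ge0.
rewrite -(cvg_lim _ H)//; apply: lime_le; first by apply/cvg_ex; eexists; exact: H.
apply: nearW => n.
have n0 : 0 < n.+2%:R^-1 :> R by rewrite invr_gt0.
have dF (x : R) : 0 < x -> is_derive x 1 (fun u : R => (1 - p)^-1 * u `^ (1 - p)) (x `^ (- p)).
  move=> x0; have := is_derive1_powR (1 - p) x0.
  move=> K; apply: is_derive_eq.
  rewrite -[LHS]/(_ * _) mulrA mulVf ?mul1r; last by rewrite gt_eqF// subr_gt0.
  by congr (_ `^ _); lra.
have c x : x \in `[n.+2%:R^-1%R, 1%R : R] -> 0 < x.
  by rewrite in_itv/= => /andP[+ _]; exact: lt_le_trans.
rewrite (@continuous_FTC2 _ _ (fun u => (1 - p)^-1 * u `^ (1 - p))).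
- rewrite powR1 mulr1 -EFinB lee_fin lerBlDr lerDl mulr_ge0 ?powR_ge0// invr_ge0 subr_ge0 ltW//.
- by rewrite invf_lt1// ltr1n.
- apply: continuous_in_subspaceT => x; rewrite inE/= => /c x0.
  exact: continuous_powR_gt0.
- split.
  + by move=> x /subset_itv_oo_cc /c x0; case: (dF x x0).
  + apply: cvg_at_right_filter; exact: is_derive_continuous (dF _ n0).
  + apply: cvg_at_left_filter; exact: is_derive_continuous (dF _ ltr01).
- by move=> x /subset_itv_oo_cc /c x0; exact: is_derive_derive1 (dF x x0).
Qed.

(** The common dominating function of the integrals against u^(-1-p): it behaves like u^(-p) at 0,
    integrable since p < 1, and like u^(-1-p) at infinity, integrable since p > 0. *)
Lemma integrable_min_powR (p : R) : 0 < p -> p < 1 ->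
  mu.-integrable `]0, +oo[ (fun u => (Num.min 1 u * u `^ (- 1 - p))%:E).
Proof.
move=> p0 p1; apply/integrableP; split.
  apply/measurable_EFinP; apply: measurable_funTS; apply: measurable_funM.
    exact: measurable_minr.
  exact: measurable_powR.
rewrite (@itv_bndbnd_setU _ _ _ (BRight 1))// ?bnd_simp//.
rewrite ge0_integral_setU//=; last 2 first.
  apply/measurable_EFinP.
  apply: measurableT_comp => //; apply: measurable_funTS; apply: measurable_funM.
    exact: measurable_minr.
  exact: measurable_powR.
  apply/disj_setPS => y [/=]; rewrite 2!in_itv/= => /andP[_ yx] /andP[].
  by rewrite ltNge yx.
have mP q : measurable_fun setT (fun u : R => (u `^ q)%:E).
  by apply/measurable_EFinP; exact: measurable_powR.
have mM : measurable_fun setT (fun u : R => (`|Num.min 1 u * u `^ (- 1 - p)|)%:E).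
  apply/measurable_EFinP; apply: measurableT_comp => //; apply: measurable_funM.
    exact: measurable_minr.
  exact: measurable_powR.
rewrite lte_add_pinfty//.
- apply: le_lt_trans (ltry (1 - p)^-1); apply: le_trans (integral_powR_01 p1).
  apply: ge0_le_integral => //; try exact: (measurable_funTS (mP _)); try exact: (measurable_funTS mM).
  + move=> x /=; rewrite in_itv/= => /andP[x0 x1]; rewrite lee_fin.
    rewrite ger0_norm ?mulr_ge0 ?powR_ge0 ?le_min ?ler01 ?(ltW x0)//.
    rewrite (min_idPr x1) powRD ?(gt_eqF x0) ?implybT// powR_inv1 ?(ltW x0)// mulrA.
    by rewrite mulfV ?gt_eqF// mul1r.
- have := ltry ((1 : R) `^ (- p) / p); rewrite -(integral_powR_y p0 ltr01); apply: le_lt_trans.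
  rewrite -integral_itv_obnd_cbnd; last first.
    by apply: measurable_funTS.
  apply: ge0_le_integral => //; try exact: (measurable_funTS (mP _)); try exact: (measurable_funTS mM).
  + move=> x /=; rewrite in_itv/= andbT => x1; rewrite lee_fin.
    rewrite ger0_norm ?mulr_ge0 ?powR_ge0 ?le_min ?ler01 ?(ltW (lt_trans ltr01 x1))//.
    by rewrite (min_idPl (ltW x1)) mul1r.
Qed.

Lemma integral_expRN (c : R) : 0 < c ->
  (\int[mu]_(y in `]0%R, c[) (expR (- y))%:E = (1 - expR (- c))%:E)%E.
Proof.
move=> c0.
have dF (x : R) : is_derive x 1 (fun u : R => - expR (- u)) (expR (- x)).
  by apply: is_derive_eq; rewrite -[LHS]/(- (_ * _)) mulrN1 opprK.
have cF (x : R) : {for x, continuous (fun u : R => expR (- u))}.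
  apply: is_derive_continuous.
have mF : measurable_fun setT (fun u : R => (expR (- u))).
  by apply: measurableT_comp.
rewrite -(@integral_itv_bndoo _ _ _ _ true false); last by apply/measurable_EFinP; exact: measurable_funTS.
rewrite (@continuous_FTC2 _ _ (fun u => - expR (- u)))//.
- by rewrite oppr0 expR0 -EFinB opprK addrC.
- by apply: continuous_in_subspaceT => x _; exact: cF.
- split.
  + by move=> x _; case: (dF x).
  + by apply: cvg_at_right_filter; exact: is_derive_continuous (dF _).
  + by apply: cvg_at_left_filter; exact: is_derive_continuous (dF _).
- by move=> x _; exact: is_derive_derive1 (dF x).
Qed.

(** Tonelli's theorem on the region 0 < y < a u^b: integrating e^(-y) over y gives 1 - e^(-a u^b),
    and integrating u^(-1-p) over u > (y/a)^(1/b) gives a multiple of y^(-p/b). This replaces a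
    change of variables followed by an integration by parts. *)
Lemma integral_one_sub_expR (a b p : R) : 0 < a -> 0 < b -> 0 < p ->
  (\int[mu]_(u in `]0%R, +oo[) ((1 - expR (- (a * u `^ b))) * u `^ (- 1 - p))%:E =
   (a `^ (p / b) / p)%:E * \int[mu]_(y in `]0%R, +oo[) (expR (- y) * y `^ (- (p / b)))%:E)%E.
Proof.
move=> a0 b0 p0.
pose E : set (R * R) := [set z | [/\ 0 < z.1, 0 < z.2 & z.2 < a * z.1 `^ b]].
have mfst : measurable_fun [set: (R * R)%type] (fun z : R * R => z.1) by exact: measurable_fst.
have msnd : measurable_fun [set: (R * R)%type] (fun z : R * R => z.2) by exact: measurable_snd.
have mdif : measurable_fun [set: (R * R)%type] (fun z : R * R => a * z.1 `^ b - z.2).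
  apply: measurable_funB => //; apply: measurable_funM => //.
  by apply: (measurableT_comp (measurable_powR b)).
have mE : measurable E.
  have -> : E = ([set: R * R] `&` (fun z : R * R => z.1) @^-1` `]0, +oo[) `&`
     ([set: R * R] `&` (fun z : R * R => z.2) @^-1` `]0, +oo[) `&`
     ([set: R * R] `&` (fun z : R * R => a * z.1 `^ b - z.2) @^-1` `]0, +oo[).
    apply/seteqP; split => -[u y]/=; rewrite !in_itv/= !andbT subr_gt0.
      by move=> [].
    by move=> [[[_ ?] [_ ?]] [_ ?]].
  apply: measurableI; first apply: measurableI.
  - exact: mfst.
  - exact: msnd.
  - exact: mdif.
pose f (z : R * R) := (\1_E z * (expR (- z.2) * z.1 `^ (- 1 - p)))%:E.
have mf : measurable_fun setT f.
  apply/measurable_EFinP; apply: measurable_funM.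
    exact: measurable_indic.
  apply: measurable_funM.
    by apply: measurableT_comp => //; apply: measurableT_comp.
  by apply: (measurableT_comp (measurable_powR _)).
have f0 z : (0 <= f z)%E.
  by rewrite lee_fin !mulr_ge0// ?expR_ge0 ?powR_ge0.
have mX : measurable_fun setT (fun u : R => (expR (- u))).
  by apply: measurableT_comp.
have f1 u : (\int[mu]_y f (u, y) = ((fun u => ((1 - expR (- (a * u `^ b))) * u `^ (- 1 - p))%:E) \_ `]0%R, +oo[) u)%E.
  rewrite patchE; case: ifPn => [|u0]; last first.
    rewrite integral0_eq// => y _; rewrite /f indicE memNset ?mul0r// => -[/= u0' _ _].
    by move: u0; rewrite notin_setE/= in_itv/= u0'.
  rewrite inE/= in_itv/= andbT => u0.
  have c0 : 0 < a * u `^ b by rewrite mulr_gt0// powR_gt0.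
  rewrite EFinM -(integral_expRN c0) muleC -ge0_integralZl//; last 2 first.
    by apply/measurable_EFinP; exact: measurable_funTS.
    by rewrite lee_fin powR_ge0.
  rewrite [RHS]integral_mkcond; apply: eq_integral => y _.
  rewrite patchE /f indicE; case: ifPn.
    rewrite inE/= in_itv/= => /andP[y0 yc].
    by rewrite mem_set ?mul1r -?EFinM 1?mulrC.
  rewrite notin_setE/= in_itv/= => /negP yc.
  by rewrite memNset ?mul0r// => -[/= _ y0 y1]; move: yc; rewrite y0 y1.
have f2 y : (\int[mu]_u f (u, y) = ((fun y => (a `^ (p / b) / p)%:E * (expR (- y) * y `^ (- (p / b)))%:E) \_ `]0%R, +oo[) y)%E.
  rewrite patchE; case: ifPn => [|u0]; last first.
    rewrite integral0_eq// => u _; rewrite /f indicE memNset ?mul0r// => -[/= _ u0' _].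
    by move: u0; rewrite notin_setE/= in_itv/= u0'.
  rewrite inE/= in_itv/= andbT => y0.
  (* The section of [E] at height y is the half-line u > r, where a r^b = y. *)
  pose r := (y / a) `^ b^-1.
  have ya : 0 < y / a by rewrite divr_gt0.
  have r0 : 0 < r by rewrite powR_gt0.
  have rE (u : R) : 0 < u -> (r < u) = (y < a * u `^ b).
    move=> u0; rewrite mulrC -ltr_pdivrMr//.
    have -> : y / a = r `^ b by rewrite -powRrM mulVf ?gt_eqF// powRr1// ltW.
    apply/idP/idP => [|h].
      by apply: gt0_ltr_powR => //; rewrite nnegrE ltW.
    rewrite ltNge; apply/negP => ur; move: h; rewrite ltNge => /negP; apply.
    by apply: ge0_ler_powR; rewrite ?nnegrE// ltW.
  transitivity ((expR (- y))%:E * \int[mu]_(u in `]r, +oo[) (u `^ (- 1 - p))%:E)%E.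
    rewrite -ge0_integralZl//; last 2 first.
      by apply/measurable_EFinP; apply: measurable_funTS; exact: measurable_powR.
      by move=> u _; rewrite lee_fin powR_ge0.
    rewrite [RHS]integral_mkcond; apply: eq_integral => u _.
    rewrite patchE /f indicE; case: ifPn.
      rewrite inE/= in_itv/= andbT => ru; have u0 := lt_trans r0 ru.
      by rewrite mem_set ?mul1r -?EFinM//; split => //=; rewrite -rE.
    rewrite notin_setE/= in_itv/= andbT => /negP ru.
    by rewrite memNset ?mul0r// => -[/= u0 _]; rewrite -rE// (negPf ru).
  rewrite integral_itv_obnd_cbnd; last first.
    by apply/measurable_EFinP; apply: measurable_funTS; exact: measurable_powR.
  rewrite integral_powR_y// -!EFinM; congr EFin.
  have -> : r `^ (- p) = a `^ (p / b) * y `^ (- (p / b)).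
    rewrite -powRrM (_ : b^-1 * - p = - (p / b)); last by rewrite mulrN mulrC.
    rewrite powRM ?invr_ge0 ?(ltW a0) ?(ltW y0)// [LHS]mulrC; congr (_ * _).
    by rewrite -powR_inv1 ?(ltW a0)// -powRrM mulN1r opprK.
  by field; rewrite gt_eqF.
transitivity (\int[mu]_u \int[mu]_y f (u, y))%E.
  by rewrite integral_mkcond; apply: eq_integral => u _; rewrite f1.
rewrite (_ : \int[mu]_u \int[mu]_y f (u, y) = \int[mu]_y \int[mu]_u f (u, y))%E; last first.
  exact: (@fubini_tonelli _ _ _ _ _ mu mu f mf f0).
under eq_integral do rewrite f2.
rewrite -integral_mkcond ge0_integralZl//.
- apply/measurable_EFinP; apply: measurable_funTS; apply: measurable_funM => //.
- by move=> u _; rewrite lee_fin mulr_ge0 ?powR_ge0 ?expR_ge0.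
- by rewrite lee_fin divr_ge0 ?powR_ge0 ?ltW.
Qed.

Lemma Rintegral_one_sub_expR (a b p : R) : 0 < a -> 0 < b -> 0 < p ->
  \int[mu]_(u in `]0%R, +oo[) ((1 - expR (- (a * u `^ b))) * u `^ (- 1 - p)) =
  a `^ (p / b) * Gamma (1 - p / b) / p.
Proof.
move=> a0 b0 p0; rewrite /Rintegral integral_one_sub_expR// /Gamma /Rintegral.
rewrite (_ : 1 - p / b - 1 = - (p / b)); last by lra.
set I := (\int[_]_(_ in _) _)%E.
have : (0 <= I)%E by apply: integral_ge0 => u _; rewrite lee_fin mulr_ge0 ?expR_ge0 ?powR_ge0.
(* If the Gamma integral is infinite, [fine] makes both sides 0. *)
case: I => [r _|_|//]; rewrite /=; first by rewrite mulrAC.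
by rewrite gt0_muley ?lte_fin ?divr_gt0 ?powR_gt0//= mulr0 mul0r.
Qed.

(** The truncations of g to [1/(n+2), n+2] are dominated by |g|, so the limits of H along these two
    sequences of endpoints suffice. *)
Lemma integral_derive_oy (H g : R -> R) (l0 l1 : R) :
  (forall x : R, 0 < x -> is_derive x 1 H (g x)) ->
  (forall x : R, 0 < x -> {for x, continuous g}) ->
  mu.-integrable `]0, +oo[ (EFin \o g) ->
  H (n.+2%:R^-1) @[n --> \oo] --> l0 -> H (n.+2%:R) @[n --> \oo] --> l1 ->
  \int[mu]_(x in `]0%R, +oo[) g x = l1 - l0.
Proof.
move=> dH cg ig H0 H1.
have /measurable_EFinP mg := measurable_int _ ig.
pose F n := `[n.+2%:R^-1, n.+2%:R : R]%classic.
pose f_ n x := (g \_ (F n)) x.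
have FD n : F n `<=` `]0, +oo[%classic.
  move=> x; rewrite /F/= !in_itv/= andbT => /andP[+ _].
  by apply: lt_le_trans; rewrite invr_gt0.
have E n : \int[mu]_(x in `]0%R, +oo[) f_ n x = H n.+2%:R - H n.+2%:R^-1.
  transitivity (\int[mu]_(x in F n) (g x)).
    rewrite /f_ Rintegral_mkcond [RHS]Rintegral_mkcond; apply: eq_Rintegral => x _.
    rewrite !patchE; case: ifPn => [xD|xD].
      by case: ifPn.
    by rewrite ifF//; apply: contraNF xD; rewrite !inE; exact: FD.
  rewrite /Rintegral (@continuous_FTC2 _ _ H)//.
  - by rewrite (@lt_trans _ _ 1)// ?ltr1n// invf_lt1 ?ltr1n.
  - apply: continuous_in_subspaceT => x; rewrite inE/= => /FD.
    by rewrite /= in_itv/= andbT => x0; exact: cg.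
  - have n0 : 0 < n.+2%:R :> R by [].
    have n1 : 0 < n.+2%:R^-1 :> R by rewrite invr_gt0.
    split.
    + by move=> x /subset_itv_oo_cc /FD; rewrite /= in_itv/= andbT => x0; case: (dH x x0).
    + by apply: cvg_at_right_filter; exact: is_derive_continuous (dH _ n1).
    + by apply: cvg_at_left_filter; exact: is_derive_continuous (dH _ n0).
  - by move=> x /subset_itv_oo_cc /FD; rewrite /= in_itv/= andbT => x0; exact: is_derive_derive1 (dH x x0).
have [] := @Rintegral_dominated_cvg _ _ _ mu `]0%R, +oo[%classic _ f_ g (Num.norm \o g).
- by [].
- move=> n; apply/measurable_restrict => //; first exact: measurable_itv.
  by apply: measurable_funS mg => //; exact: subIsetl.
- move=> x; rewrite /= in_itv/= andbT => x0.
  apply: cvg_near_cst; near=> n.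
  rewrite /f_/= patchE ifT// inE /F/= in_itv/=; apply/andP; split.
    rewrite invf_ple ?posrE//; apply: (@le_trans _ _ (Num.truncn x^-1).+1%:R).
      exact/ltW/truncnS_gt.
    rewrite ler_nat ltnS; apply: leq_trans (leqnSn _).
    by near: n; exact: nbhs_infty_ge.
  apply: (@le_trans _ _ (Num.truncn x).+1%:R).
    exact/ltW/truncnS_gt.
  rewrite ler_nat ltnS; apply: leq_trans (leqnSn _).
  by near: n; exact: nbhs_infty_ge.
- exact: integrable_abse ig.
- by move=> n x _; rewrite /f_ patchE; case: ifPn => _ //=; rewrite normr0.
- move=> _; under [X in X @ _ --> _]eq_fun do rewrite E.
  by move/cvg_unique; apply => //; exact: cvgB.
Unshelve. all: by end_near. Qed.

End power_integrals.

(** * Lipschitz and Taylor bounds for sine and cosine *)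

Section elementary_inequalities.
Context {R : realType}.
Implicit Types (f df : R -> R) (x y : R).

(** The form |c - y| <= |x - y| covers both orders of x and y and can be iterated: a bound on the
    derivative by a power of the distance to y gains one power for the function. *)
Lemma MVT_from f df y x : (forall x : R, is_derive x 1 f (df x)) ->
  exists2 c, `|c - y| <= `|x - y| & f x - f y = df c * (x - y).
Proof.
move=> dF; have cf a b : {within `[a, b], continuous f}.
  by apply: continuous_subspaceT => z; exact: is_derive_continuous (dF z).
have [yx|xy] := leP y x.
  have [c] := MVT_segment yx (fun z _ => dF z) (cf _ _).
  rewrite in_itv/= => /andP[yc cx] e; exists c => //.
  by rewrite !ger0_norm ?subr_ge0// lerB.
have [c] := MVT_segment (ltW xy) (fun z _ => dF z) (cf _ _).
rewrite in_itv/= => /andP[xc cy] e; exists c.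
  by rewrite !ler0_norm ?subr_le0 ?(ltW xy)// lerN2 lerB.
by rewrite -opprB e -mulrN opprB.
Qed.

Lemma ler_norm_subcos x y : `|cos x - cos y| <= `|x - y|.
Proof.
have [c _ ->] := MVT_from y x (@is_derive_cos R).
by rewrite normrM normrN ler_piMl// sin_max.
Qed.

Lemma ler_norm_subsin x y : `|sin x - sin y| <= `|x - y|.
Proof.
have [c _ ->] := MVT_from y x (@is_derive_sin R).
by rewrite normrM ler_piMl// cos_max.
Qed.

Lemma ler_norm_sin x : `|sin x| <= `|x|.
Proof. by have := ler_norm_subsin x 0; rewrite sin0 !subr0. Qed.

Lemma ler_norm_sinB x : `|sin x - x| <= x ^+ 2.
Proof.
have dF (z : R) : is_derive z 1 (fun x : R => sin x - x) (cos z - 1).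
  by apply: is_derive_eq.
have [c] := MVT_from 0 x dF; rewrite sin0 !subr0 => cx ->.
rewrite normrM -(real_normK (num_real x)) expr2 ler_wpM2r//.
rewrite -(@cos0 R); apply: le_trans (ler_norm_subcos _ _) _.
by rewrite subr0.
Qed.

Lemma one_sub_cos_le x : 1 - cos x <= x ^+ 2 / 2.
Proof.
have -> : 1 - cos x = 2 * sin (x / 2) ^+ 2.
  have {1}-> : x = (x / 2) *+ 2 by rewrite -mulr_natr; field.
  by rewrite cos_mulr2n cos2sin2; ring.
have : sin (x / 2) ^+ 2 <= (x / 2) ^+ 2.
  by rewrite -ler_sqrt ?sqr_ge0// !sqrtr_sqr ler_norm_sin.
by rewrite exprMn; lra.
Qed.

Lemma one_sub_cos_le_norm x : 1 - cos x <= `|x|.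
Proof.
have := ler_norm_subcos 0 x; rewrite cos0 sub0r normrN.
exact: le_trans (ler_norm _).
Qed.

End elementary_inequalities.

(** * The Gamma integral along rotated rays *)

Section rotation.
Context {R : realType}.
Notation mu := (@lebesgue_measure R).
Variables (p y : R).
Hypotheses (p0 : 0 < p) (p1 : p < 1) (y0 : 0 < y).

(* Real and imaginary parts of [(1 - e^(- u y z)) u^(- 1 - p)] at the point
   [z = c + i s]. *)
Definition rot_re (c s u : R) : R :=
  (1 - expR (- (u * y * c)) * cos (u * y * s)) * u `^ (- 1 - p).
Definition rot_im (c s u : R) : R :=
  expR (- (u * y * c)) * sin (u * y * s) * u `^ (- 1 - p).

Let C := 2 * (1 + y).
Let w (u : R) : R := Num.min 1 u * u `^ (- 1 - p).

(** The two bounds serve for u >= 1 and u < 1 respectively; C = 2 (1 + y) exceeds both 2 and 2 y. *)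
Let le_min1 (a : R) u : 0 < u -> a <= 2 -> a <= 2 * (u * y) ->
  a <= C * Num.min 1 u.
Proof.
move=> u0 a2 aA; have uy : 0 < u * y by rewrite mulr_gt0.
rewrite /C; case: (leP 1 u) => u1; first by nra.
by nra.
Qed.

Lemma rot_re_bound (c s u : R) : 0 <= c <= 1 -> `|s| <= 1 -> 0 < u ->
  `|rot_re c s u| <= C * w u.
Proof.
move=> /andP[c0 c1] s1 u0.
have uy : 0 < u * y by rewrite mulr_gt0.
rewrite /rot_re /w mulrA normrM (ger0_norm (powR_ge0 _ _)).
rewrite ler_wpM2r ?powR_ge0//.
set e := expR _; set k := cos _.
have e0 : 0 < e by exact: expR_gt0.
have e1 : e <= 1 by rewrite -expR0 ler_expR oppr_le0 mulr_ge0// ltW.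
have k1 : k <= 1 by exact: cos_le1.
have k2 : -1 <= k by exact: cos_geN1.
have e2 : 1 - u * y * c <= e by exact: expR_ge1Dx.
have k3 : 1 - k <= u * y.
  apply: le_trans (one_sub_cos_le_norm _) _.
  by rewrite normrM (gtr0_norm uy) ler_piMr// ltW.
rewrite ger0_norm; last by rewrite subr_ge0; nra.
apply: le_min1 => //; first by nra.
have : u * y * c <= u * y by rewrite ler_piMr// ltW.
nra.
Qed.

Lemma rot_im_bound (c s u : R) : 0 <= c <= 1 -> `|s| <= 1 -> 0 < u ->
  `|rot_im c s u| <= C * w u.
Proof.
move=> /andP[c0 c1] s1 u0.
have uy : 0 < u * y by rewrite mulr_gt0.
rewrite /rot_im /w mulrA normrM (ger0_norm (powR_ge0 _ _)).
rewrite ler_wpM2r ?powR_ge0// normrM gtr0_norm ?expR_gt0//.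
set e := expR _; set k := `|sin _|.
have e0 : 0 < e by exact: expR_gt0.
have e1 : e <= 1 by rewrite -expR0 ler_expR oppr_le0 mulr_ge0// ltW.
have k0 : 0 <= k by exact: normr_ge0.
have k1 : k <= 1 by exact: sin_max.
have k3 : k <= u * y.
  apply: le_trans (ler_norm_sin _) _.
  by rewrite normrM (gtr0_norm uy) ler_piMr// ltW.
have ek : e * k <= k by rewrite ler_piMl.
by apply: le_min1 => //; lra.
Qed.

Lemma measurable_rot_re c s : measurable_fun setT (rot_re c s).
Proof.
apply: measurable_funM; last exact: measurable_powR.
apply: measurable_funB => //; apply: continuous_measurable_fun => u.
apply: (@is_derive_continuous R (fun u => expR (- (u * y * c)) * cos (u * y * s))).
Qed.

Lemma measurable_rot_im c s : measurable_fun setT (rot_im c s).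
Proof.
apply: measurable_funM; last exact: measurable_powR.
apply: continuous_measurable_fun => u.
apply: (@is_derive_continuous R (fun u => expR (- (u * y * c)) * sin (u * y * s))).
Qed.

Let integrable_w : mu.-integrable `]0, +oo[ (fun u => (C * w u)%:E).
Proof.
by apply: (@integrableZl _ _ R mu `]0%R, +oo[%classic _ C _ (integrable_min_powR p0 p1)).
Qed.

Lemma integrable_rot_re c s : 0 <= c <= 1 -> `|s| <= 1 ->
  mu.-integrable `]0, +oo[ (EFin \o rot_re c s).
Proof.
move=> c01 s1; apply: le_integrable integrable_w => //.
  by apply/measurable_EFinP; apply: measurable_funTS; exact: measurable_rot_re.
move=> u /=; rewrite in_itv/= andbT => u0; rewrite lee_fin.
by apply: le_trans (rot_re_bound c01 s1 u0) _; exact: ler_norm.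
Qed.

Lemma integrable_rot_im c s : 0 <= c <= 1 -> `|s| <= 1 ->
  mu.-integrable `]0, +oo[ (EFin \o rot_im c s).
Proof.
move=> c01 s1; apply: le_integrable integrable_w => //.
  by apply/measurable_EFinP; apply: measurable_funTS; exact: measurable_rot_im.
move=> u /=; rewrite in_itv/= andbT => u0; rewrite lee_fin.
by apply: le_trans (rot_im_bound c01 s1 u0) _; exact: ler_norm.
Qed.

(** [d_re] and [d_im] are the real and imaginary parts of i u y z e^(- u y z) u^(-1-p) at z = e^(i
    phi), the derivative in phi of the integrand; the [- phi] inside the angle is the contribution
    of the factor z. *)
Let d_re (phi u : R) : R :=
  u * y * expR (- (u * y * cos phi)) * sin (u * y * sin phi - phi) * u `^ (- 1 - p).
Let d_im (phi u : R) : R :=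
  u * y * expR (- (u * y * cos phi)) * cos (u * y * sin phi - phi) * u `^ (- 1 - p).

Let is_derive_rot_re (phi u : R) :
  is_derive phi 1 (fun phi => rot_re (cos phi) (sin phi) u) (d_re phi u).
Proof.
rewrite /rot_re; apply: is_derive_eq.
by rewrite /d_re /GRing.scale/= sinB; ring.
Qed.

Let is_derive_rot_im (phi u : R) :
  is_derive phi 1 (fun phi => rot_im (cos phi) (sin phi) u) (d_im phi u).
Proof.
rewrite /rot_im; apply: is_derive_eq.
by rewrite /d_im /GRing.scale/= cosB; ring.
Qed.

Let powR_pred (u : R) : 0 < u -> u `^ (- p) = u * u `^ (- 1 - p).
Proof.
move=> u0; rewrite powRD ?(gt_eqF u0) ?implybT// powR_inv1 ?(ltW u0)// mulrA.
by rewrite mulfV ?gt_eqF// mul1r.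
Qed.

Let is_derive_powRN (u : R) : 0 < u ->
  is_derive u 1 (fun u : R => u `^ (- p)) (- p * u `^ (- 1 - p)).
Proof. by move=> u0; rewrite [- 1 - p]addrC; exact: is_derive1_powR. Qed.

(** The factor 1 - e^(- u y z) depends on u and z only through u z, so its derivative in phi is i u
    times its derivative in u. Hence the product with u^(-p) has a derivative in u that combines
    [d_re] and [rot_im], and integrating it expresses the angular derivative by the integral
    itself. *)
Let is_derive_prim_im (phi u : R) : 0 < u ->
  is_derive u 1 (fun u : R => expR (- (u * y * cos phi)) * sin (u * y * sin phi) * u `^ (- p))
    (-1 * d_re phi u - p * rot_im (cos phi) (sin phi) u).
Proof.
move=> u0; have D := is_derive_powRN u0; apply: is_derive_eq.
by rewrite /rot_im /d_re /GRing.scale/= sinB powR_pred//; ring.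
Qed.

Let is_derive_prim_re (phi u : R) : 0 < u ->
  is_derive u 1 (fun u : R => (1 - expR (- (u * y * cos phi)) * cos (u * y * sin phi)) * u `^ (- p))
    (d_im phi u - p * rot_re (cos phi) (sin phi) u).
Proof.
move=> u0; have D := is_derive_powRN u0; apply: is_derive_eq.
by rewrite /rot_re /d_im /GRing.scale/= cosB powR_pred//; ring.
Qed.

Let continuous_d (phi u : R) : 0 < u ->
  {for u, continuous (d_re phi)} * {for u, continuous (d_im phi)}.
Proof.
move=> u0; have D := is_derive1_powR (- 1 - p) u0.
by split; rewrite /d_re /d_im; apply: is_derive_continuous.
Qed.

Let continuous_rot (c s u : R) : 0 < u ->
  {for u, continuous (rot_re c s)} * {for u, continuous (rot_im c s)}.
Proof.
move=> u0; have D := is_derive1_powR (- 1 - p) u0.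
by split; rewrite /rot_re /rot_im; apply: is_derive_continuous.
Qed.

(** The extra factor u y is absorbed by the exponential, x e^(- k x) <= 1/k, which requires the
    cosine to stay away from 0. The angle is therefore differentiated only below pi / 2, and the end
    point is reached by continuity. *)
Let d_bound (k phi u : R) : 0 < k -> k <= cos phi -> 0 < u ->
  `|d_re phi u| <= (y + k^-1) * w u /\ `|d_im phi u| <= (y + k^-1) * w u.
Proof.
move=> k0 kphi u0; have uy : 0 < u * y by rewrite mulr_gt0.
have E : `|u * y * expR (- (u * y * cos phi))| <= (y + k^-1) * Num.min 1 u.
  rewrite gtr0_norm ?mulr_gt0 ?expR_gt0//.
  have ki : 0 < k^-1 by rewrite invr_gt0.
  case: (leP 1 u) => u1.
    rewrite mulr1; apply: (@le_trans _ _ k^-1); last by rewrite lerDr ltW.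
    have -> : expR (- (u * y * cos phi)) = (expR (u * y * cos phi))^-1 by rewrite expRN.
    rewrite ler_pdivrMr ?expR_gt0// [leRHS]mulrC ler_pdivlMr//.
    have := expR_ge1Dx (u * y * cos phi); nra.
  have : expR (- (u * y * cos phi)) <= 1.
    by rewrite -expR0 ler_expR oppr_le0 mulr_ge0 ?(ltW uy)// (le_trans (ltW k0)).
  have := expR_gt0 (- (u * y * cos phi)); nra.
have w0 : 0 <= u `^ (- 1 - p) by exact: powR_ge0.
by rewrite /d_re /d_im /w mulrA !normrM (ger0_norm w0); split; rewrite ler_wpM2r//;
  rewrite -[leRHS]mulr1 -!normrM normrM ler_pM//; [exact: sin_max|exact: cos_max].
Qed.

Let measurable_d (phi : R) : measurable_fun setT (d_re phi) /\ measurable_fun setT (d_im phi).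
Proof.
by split; (apply: measurable_funM; last exact: measurable_powR);
  apply: continuous_measurable_fun => u; apply: is_derive_continuous.
Qed.

Let integrable_d (phi : R) : 0 < cos phi ->
  mu.-integrable `]0, +oo[ (EFin \o d_re phi) /\ mu.-integrable `]0, +oo[ (EFin \o d_im phi).
Proof.
move=> c0; have [m1 m2] := measurable_d phi.
have I : mu.-integrable `]0, +oo[ (fun u => ((y + (cos phi)^-1) * w u)%:E).
  by apply: (@integrableZl _ _ R mu `]0%R, +oo[%classic _ _ _ (integrable_min_powR p0 p1)).
split; (apply: le_integrable I => //; first by apply/measurable_EFinP; exact: measurable_funTS);
  move=> u /=; rewrite in_itv/= andbT => u0; rewrite lee_fin;
  have [b1 b2] := d_bound c0 (lexx _) u0.
- by apply: le_trans b1 _; exact: ler_norm.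
- by apply: le_trans b2 _; exact: ler_norm.
Qed.

Let cvg_invn_powR (q : R) : 0 < q -> (n.+2%:R `^ (- q)) @[n --> \oo] --> (0 : R).
Proof.
move=> q0.
apply: (@cvg_comp _ _ _ (fun n : nat => n.+2%:R : R) (fun x : R => x `^ (- q)) _ (+oo : set_system R)).
  apply/cvgryPge => A; near=> n.
  apply: (@le_trans _ _ (Num.truncn A).+1%:R); first exact/ltW/truncnS_gt.
  rewrite ler_nat ltnS; apply: leq_trans (leqnSn _).
  by near: n; exact: nbhs_infty_ge.
exact: cvg_powRN_pinfty.
Unshelve. all: by end_near. Qed.

(** The boundary terms vanish at both ends: near 0 the bound is u^(1-p) with p < 1, at infinity it
    is u^(-p) with p > 0. *)
Let cvg_prim (h : R -> R) : (forall u : R, 0 < u -> `|h u| <= C * Num.min 1 u) ->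
  h (n.+2%:R^-1) * n.+2%:R^-1 `^ (- p) @[n --> \oo] --> (0 : R) /\
  h n.+2%:R * n.+2%:R `^ (- p) @[n --> \oo] --> (0 : R).
Proof.
have C0 : 0 <= C by rewrite mulr_ge0// addr_ge0// ltW.
move=> hb; split; apply/norm_cvg0P.
  apply: (@squeeze_cvgr _ _ _ _ (fun=> 0) (fun n => C * n.+2%:R `^ (- (1 - p)))).
  - near=> n; rewrite normr_ge0/= normrM (ger0_norm (powR_ge0 _ _)).
    have n0 : 0 < n.+2%:R^-1 :> R by rewrite invr_gt0.
    apply: le_trans (ler_wpM2r (powR_ge0 _ _) (hb _ n0)) _.
    rewrite -mulrA ler_wpM2l// -powR_inv1// -powRrM mulN1r opprK.
    apply: (@le_trans _ _ (n.+2%:R `^ (-1) * n.+2%:R `^ p)).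
      by rewrite ler_wpM2r ?powR_ge0// ge_min lexx orbT.
    rewrite -powRD ?pnatr_eq0 ?implybT//.
    by rewrite le_eqVlt; apply/orP; left; apply/eqP; congr (_ `^ _); lra.
  - exact: cvg_cst.
  - rewrite -[X in _ --> X](mulr0 C); apply: cvgMr; apply: cvg_invn_powR.
    by rewrite subr_gt0.
apply: (@squeeze_cvgr _ _ _ _ (fun=> 0) (fun n => C * n.+2%:R `^ (- p))).
- near=> n; rewrite normr_ge0/= normrM (ger0_norm (powR_ge0 _ _)) ler_wpM2r ?powR_ge0//.
  have n0 : 0 < n.+2%:R :> R by [].
  apply: le_trans (hb _ n0) _.
  by rewrite ler_piMr// ge_min lexx.
- exact: cvg_cst.
- by rewrite -[X in _ --> X](mulr0 C); apply: cvgMr; exact: cvg_invn_powR.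
Unshelve. all: by end_near. Qed.

Let F_re (phi : R) := \int[mu]_(u in `]0%R, +oo[) rot_re (cos phi) (sin phi) u.
Let F_im (phi : R) := \int[mu]_(u in `]0%R, +oo[) rot_im (cos phi) (sin phi) u.

Let cs01 (phi : R) : 0 <= cos phi -> (0 <= cos phi <= 1) /\ `|sin phi| <= 1.
Proof. by move=> c0; rewrite c0 cos_le1 sin_max. Qed.

(* Integration by parts, both boundary terms vanishing. *)
Let int_d_re (phi : R) : 0 < cos phi ->
  \int[mu]_(u in `]0%R, +oo[) d_re phi u = - p * F_im phi.
Proof.
move=> c0; have [c01 s1] := cs01 (ltW c0); have [Id _] := integrable_d c0.
have Ir := integrable_rot_im c01 s1.
have Ir' : mu.-integrable `]0, +oo[ (EFin \o (fun u => p * rot_im (cos phi) (sin phi) u)).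
  by apply: (@integrableZl _ _ R mu `]0%R, +oo[%classic _ p _ Ir).
have Idn : mu.-integrable `]0, +oo[ (EFin \o (fun u => -1 * d_re phi u)).
  by apply: (@integrableZl _ _ R mu `]0%R, +oo[%classic _ (-1) _ Id).
have hb u : 0 < u -> `|expR (- (u * y * cos phi)) * sin (u * y * sin phi)| <= C * Num.min 1 u.
  move=> u0; have := rot_im_bound c01 s1 u0; rewrite /rot_im /w mulrA normrM.
  rewrite (ger0_norm (powR_ge0 _ _)) ler_pM2r//; exact: powR_gt0.
have [H0 H1] := cvg_prim hb.
have := @integral_derive_oy R _ _ 0 0 (is_derive_prim_im phi) _ _ H0 H1.
rewrite subr0 RintegralB// !RintegralZl//.
move=> E; apply/eqP; rewrite -subr_eq0 -oppr_eq0; apply/eqP.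
rewrite mulNr opprK opprD -mulN1r; apply: E.
  move=> u u0; apply: cvgB; first by apply: cvgMr; exact: (continuous_d phi u0).1.
  by apply: cvgMr; exact: (continuous_rot _ _ u0).2.
by apply: (@integrableB _ _ R mu `]0%R, +oo[%classic _ _ _ Idn Ir').
Qed.

Let int_d_im (phi : R) : 0 < cos phi ->
  \int[mu]_(u in `]0%R, +oo[) d_im phi u = p * F_re phi.
Proof.
move=> c0; have [c01 s1] := cs01 (ltW c0); have [_ Id] := integrable_d c0.
have Ir := integrable_rot_re c01 s1.
have Ir' : mu.-integrable `]0, +oo[ (EFin \o (fun u => p * rot_re (cos phi) (sin phi) u)).
  by apply: (@integrableZl _ _ R mu `]0%R, +oo[%classic _ p _ Ir).
have hb u : 0 < u -> `|1 - expR (- (u * y * cos phi)) * cos (u * y * sin phi)| <= C * Num.min 1 u.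
  move=> u0; have := rot_re_bound c01 s1 u0; rewrite /rot_re /w mulrA normrM.
  rewrite (ger0_norm (powR_ge0 _ _)) ler_pM2r//; exact: powR_gt0.
have [H0 H1] := cvg_prim hb.
have := @integral_derive_oy R _ _ 0 0 (is_derive_prim_re phi) _ _ H0 H1.
rewrite subr0 RintegralB// RintegralZl//.
move=> E; apply/eqP; rewrite -subr_eq0; apply/eqP; apply: E.
  move=> u u0; apply: cvgB; first exact: (continuous_d phi u0).2.
  by apply: cvgMr; exact: (continuous_rot _ _ u0).1.
by apply: (@integrableB _ _ R mu `]0%R, +oo[%classic _ _ _ Id Ir').
Qed.

Let is_derive_F (phi : R) : 0 < phi < pi / 2 ->
  is_derive phi 1 F_re (- p * F_im phi) /\ is_derive phi 1 F_im (p * F_re phi).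
Proof.
move=> /andP[f0 f1].
(* The midpoint of phi and pi / 2: on ]0, v[ the cosine is at least cos v > 0, which gives one
   dominating function for the whole neighbourhood of phi. *)
pose v := (phi + pi / 2) / 2.
have pi0 := @pi_gt0 R.
have fv : phi < v by rewrite /v; lra.
have v0 : 0 < v by rewrite /v; lra.
have v1 : v < pi / 2 by rewrite /v; lra.
have k0 : 0 < cos v by apply: cos_gt0_pihalf; apply/andP; split; lra.
have kphi x : `]0, v[%classic x -> cos v <= cos x.
  rewrite /= in_itv/= => /andP[x0 xv].
  by rewrite ltW// ltr_cos// ?in_itv/=; apply/andP; split; lra.
have Iphi : `]0, v[%classic phi by rewrite /= in_itv/= f0.
have c0 := lt_le_trans k0 (kphi _ Iphi).
have intG : mu.-integrable `]0, +oo[ (EFin \o (fun u => `|(y + (cos v)^-1) * w u|)).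
  apply: (@integrable_norm _ _ R mu).
  by apply: (@integrableZl _ _ R mu `]0%R, +oo[%classic _ _ _ (integrable_min_powR p0 p1)).
have G0 u : 0 <= `|(y + (cos v)^-1) * w u| by [].
split; apply: DeriveDef.
- apply: (@derivable_under_integral R _ _ mu _ `]0%R, +oo[%classic _ phi 0 v Iphi _ _ _ G0 intG) => //.
  + by move=> x Ix; have [c01 s1] := cs01 (le_trans (ltW k0) (kphi _ Ix)); exact: integrable_rot_re.
  + move=> x u Ix; rewrite /= in_itv/= andbT => u0.
    rewrite partial1of2E; have [_ ->] := is_derive_rot_re x u.
    by apply: le_trans (d_bound k0 (kphi _ Ix) u0).1 _; exact: ler_norm.
- rewrite -derive1E (@differentiation_under_integral R _ _ mu _ `]0%R, +oo[%classic _ phi 0 v Iphi _ _ _ G0 intG) => //.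
  + rewrite -int_d_re//; apply: eq_Rintegral => u _.
    by rewrite partial1of2E; have [_ ->] := is_derive_rot_re phi u.
  + by move=> x Ix; have [c01 s1] := cs01 (le_trans (ltW k0) (kphi _ Ix)); exact: integrable_rot_re.
  + move=> x u Ix; rewrite /= in_itv/= andbT => u0.
    rewrite partial1of2E; have [_ ->] := is_derive_rot_re x u.
    by apply: le_trans (d_bound k0 (kphi _ Ix) u0).1 _; exact: ler_norm.
- apply: (@derivable_under_integral R _ _ mu _ `]0%R, +oo[%classic _ phi 0 v Iphi _ _ _ G0 intG) => //.
  + by move=> x Ix; have [c01 s1] := cs01 (le_trans (ltW k0) (kphi _ Ix)); exact: integrable_rot_im.
  + move=> x u Ix; rewrite /= in_itv/= andbT => u0.
    rewrite partial1of2E; have [_ ->] := is_derive_rot_im x u.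
    by apply: le_trans (d_bound k0 (kphi _ Ix) u0).2 _; exact: ler_norm.
- rewrite -derive1E (@differentiation_under_integral R _ _ mu _ `]0%R, +oo[%classic _ phi 0 v Iphi _ _ _ G0 intG) => //.
  + rewrite -int_d_im//; apply: eq_Rintegral => u _.
    by rewrite partial1of2E; have [_ ->] := is_derive_rot_im phi u.
  + by move=> x Ix; have [c01 s1] := cs01 (le_trans (ltW k0) (kphi _ Ix)); exact: integrable_rot_im.
  + move=> x u Ix; rewrite /= in_itv/= andbT => u0.
    rewrite partial1of2E; have [_ ->] := is_derive_rot_im x u.
    by apply: le_trans (d_bound k0 (kphi _ Ix) u0).2 _; exact: ler_norm.
Qed.

(** Continuity of the integrals up to 0 and pi / 2 is obtained on a larger open interval. Beyond pi
    / 2 the cosine is negative and the exponential would grow, so it is replaced by its positive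
    part, which is continuous and agrees with it on [0, pi / 2]. *)
Let continuous_rotp (u phi : R) :
  {for phi, continuous (fun phi : R => rot_re (Num.max (cos phi) 0) (sin phi) u)} *
  {for phi, continuous (fun phi : R => rot_im (Num.max (cos phi) 0) (sin phi) u)}.
Proof.
have c1 : Num.max (cos x) 0 @[x --> phi] --> Num.max (cos phi) 0.
  apply: continuous_max; last exact: cvg_cst.
  exact: continuous_cos.
have c2 : expR (- (u * y * Num.max (cos x) 0)) @[x --> phi] --> expR (- (u * y * Num.max (cos phi) 0)).
  apply: continuous_cvg; first exact: continuous_expR.
  by apply: cvgN; apply: cvgMr.
have c3 : u * y * sin x @[x --> phi] --> u * y * sin phi.
  by apply: cvgMr; exact: continuous_sin.
split; apply: cvgMl.
  apply: cvgB; first exact: cvg_cst.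
  by apply: cvgM c2 _; apply: continuous_cvg c3; exact: continuous_cos.
by apply: cvgM c2 _; apply: continuous_cvg c3; exact: continuous_sin.
Qed.

Let continuous_F : {within `[0, pi / 2], continuous F_re} /\ {within `[0, pi / 2], continuous F_im}.
Proof.
have cs (phi : R) : 0 <= Num.max (cos phi) 0 <= 1 /\ `|sin phi| <= 1.
  by rewrite le_max lexx orbT ge_max cos_le1 ler01 sin_max.
have I02 (x : R) : x \in `[0, pi / 2]%classic -> x \in `](-1)%R, pi[%classic.
  have := @pi_gt0 R; rewrite !inE/= !in_itv/= => ppi /andP[x0 x1]; apply/andP; split; lra.
have E (x : R) : x \in `[0, pi / 2]%classic -> Num.max (cos x) 0 = cos x.
  rewrite inE/= in_itv/= => /andP[x0 x1]; apply/max_idPl/cos_ge0_pihalf.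
  have := @pi_gt0 R => ppi; apply/andP; split; lra.
split.
- have EF : {in `[0, pi / 2]%classic, (fun phi : R => \int[mu]_(u in `]0%R, +oo[) rot_re (Num.max (cos phi) 0) (sin phi) u) =1 F_re}.
    by move=> x xI; rewrite /F_re E.
  apply: (subspace_eq_continuous EF).
  apply: continuous_in_subspaceT => x /I02; move: x.
  apply: (@continuity_under_integral R _ _ mu _ `]0%R, +oo[%classic _ (-1) pi _ _ (fun u => C * w u)) => //.
  + by move=> x _; have [c01 s1] := cs x; exact: integrable_rot_re.
  + by apply: aeW => u _ x _; exact: (continuous_rotp u x).1.
  + move=> x _; apply: aeW => u; rewrite /= in_itv/= andbT => u0.
    by have [c01 s1] := cs x; exact: rot_re_bound.
- have EF : {in `[0, pi / 2]%classic, (fun phi : R => \int[mu]_(u in `]0%R, +oo[) rot_im (Num.max (cos phi) 0) (sin phi) u) =1 F_im}.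
    by move=> x xI; rewrite /F_im E.
  apply: (subspace_eq_continuous EF).
  apply: continuous_in_subspaceT => x /I02; move: x.
  apply: (@continuity_under_integral R _ _ mu _ `]0%R, +oo[%classic _ (-1) pi _ _ (fun u => C * w u)) => //.
  + by move=> x _; have [c01 s1] := cs x; exact: integrable_rot_im.
  + by apply: aeW => u _ x _; exact: (continuous_rotp u x).2.
  + move=> x _; apply: aeW => u; rewrite /= in_itv/= andbT => u0.
    by have [c01 s1] := cs x; exact: rot_im_bound.
Qed.

(* [F_re + i F_im] solves [F' = i p F], hence is [e^(i p phi) F_re 0]. *)
Let F_pihalf : F_re (pi / 2) = cos (p * (pi / 2)) * F_re 0 /\
  F_im (pi / 2) = sin (p * (pi / 2)) * F_re 0.
Proof.
have pi0 := @pi_gt0 R; have [cre cim] := continuous_F.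
have F0 : F_im 0 = 0.
  rewrite /F_im /Rintegral integral0_eq// => u _.
  by rewrite /rot_im sin0 mulr0 sin0 mulr0 mul0r.
have cp : {within `[0, pi / 2], continuous (fun x : R => cos (p * x))}.
  by apply: continuous_subspaceT => x; apply: is_derive_continuous.
have sp : {within `[0, pi / 2], continuous (fun x : R => sin (p * x))}.
  by apply: continuous_subspaceT => x; apply: is_derive_continuous.
have h : 0 < pi / 2 :> R by lra.
(* [G1] and [G2] are the real and imaginary parts of e^(- i p x) F(x), whose derivative vanishes. *)
pose G1 (x : R) := cos (p * x) * F_re x + sin (p * x) * F_im x.
pose G2 (x : R) := cos (p * x) * F_im x - sin (p * x) * F_re x.
have E1 : G1 (pi / 2) = G1 0.
  have [x|x|c _] := @MVT R G1 (fun=> 0) _ _ h.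
  - rewrite in_itv/= => /is_derive_F[D1 D2].
    by apply: is_derive_eq; rewrite /GRing.scale/=; ring.
  - by apply: cvgD; apply: cvgM; [exact: cp|exact: cre|exact: sp|exact: cim].
  - by rewrite mul0r => /eqP; rewrite subr_eq0 => /eqP.
have E2 : G2 (pi / 2) = G2 0.
  have [x|x|c _] := @MVT R G2 (fun=> 0) _ _ h.
  - rewrite in_itv/= => /is_derive_F[D1 D2].
    by apply: is_derive_eq; rewrite /GRing.scale/=; ring.
  - by apply: cvgB; apply: cvgM; [exact: cp|exact: cim|exact: sp|exact: cre].
  - by rewrite mul0r => /eqP; rewrite subr_eq0 => /eqP.
move: E1 E2; rewrite /G1 /G2 mulr0 cos0 sin0 F0 !mul0r !mul1r !addr0 subr0 => <-.
have := cos2Dsin2 (p * (pi / 2)); set k := cos _; set s := sin _ => ks E2.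
set A := F_re _ in E2 *; set B := F_im _ in E2 *; split.
  transitivity ((k ^+ 2 + s ^+ 2) * A + s * (k * B - s * A)); last by ring.
  by rewrite ks E2; ring.
transitivity ((k ^+ 2 + s ^+ 2) * B - k * (k * B - s * A)); last by ring.
by rewrite ks E2; ring.
Qed.

Let F_re0 : F_re 0 = y `^ p * Gamma (1 - p) / p.
Proof.
have := @Rintegral_one_sub_expR R y 1 p y0 ltr01 p0; rewrite !divr1 => <-.
apply: eq_Rintegral => u; rewrite inE/= in_itv/= andbT => u0.
by rewrite /rot_re cos0 sin0 mulr0 cos0 !mulr1 powRr1 ?(ltW u0)// [y * u]mulrC.
Qed.

Lemma integral_one_sub_cos :
  \int[mu]_(u in `]0%R, +oo[) ((1 - cos (u * y)) * u `^ (- 1 - p)) =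
  cos (p * (pi / 2)) * (Gamma (1 - p) / p) * y `^ p.
Proof.
have [+ _] := F_pihalf; rewrite F_re0 => E.
rewrite -mulrA [_ / p * _]mulrC [_ `^ p * _]mulrA -E; apply: eq_Rintegral => u _.
by rewrite /rot_re cos_pihalf sin_pihalf mulr0 oppr0 expR0 mul1r mulr1.
Qed.

Lemma integral_sin :
  \int[mu]_(u in `]0%R, +oo[) (sin (u * y) * u `^ (- 1 - p)) =
  sin (p * (pi / 2)) * (Gamma (1 - p) / p) * y `^ p.
Proof.
have [_] := F_pihalf; rewrite F_re0 => E.
rewrite -mulrA [_ / p * _]mulrC [_ `^ p * _]mulrA -E; apply: eq_Rintegral => u _.
by rewrite /rot_im cos_pihalf sin_pihalf mulr0 oppr0 expR0 mul1r mulr1.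
Qed.

End rotation.

(** * Fourier representations of |y|^p and sgn(y) |y|^p *)

Section fourier_powers.
Context {R : realType}.
Notation mu := (@lebesgue_measure R).
Variable p : R.
Hypotheses (p0 : 0 < p) (p1 : p < 1).

(** [Gamma] takes [fine] of an integral, so positivity includes finiteness. Both are read off the
    integral of (1 - e^(-u)) u^(-1-p), which is dominated and which is at least (1 - e^(-1)) / p
    already on [1, +oo[. *)
Lemma Gamma_gt0 : 0 < Gamma (1 - p).
Proof.
have E := @Rintegral_one_sub_expR R 1 1 p ltr01 ltr01 p0.
rewrite !divr1 powR1 mul1r in E.
have -> : Gamma (1 - p) = p * (Gamma (1 - p) / p) by field; rewrite gt_eqF.
rewrite -E mulr_gt0//.
pose f (u : R) := (1 - expR (- (1 * u `^ 1))) * u `^ (- 1 - p).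
have I : mu.-integrable `]0%R, +oo[ (EFin \o f).
  have := @integrable_rot_re R p 1 p0 p1 ltr01 1 0.
  rewrite ler01 lexx normr0 => /(_ isT ler01).
  apply: eq_integrable => // u; rewrite inE/= in_itv/= andbT => u0.
  by rewrite /rot_re /f /= mulr0 cos0 !mulr1 mul1r powRr1// ltW.
have e1 : expR (-1) < 1 :> R by rewrite -[ltRHS]expR0 ltr_expR oppr_lt0.
have f0 (u : R) : `]0, +oo[%classic u -> (0 <= (f u)%:E)%E.
  rewrite /= in_itv/= andbT => u0; rewrite lee_fin mulr_ge0 ?powR_ge0// subr_ge0.
  by rewrite -[leRHS]expR0 ler_expR oppr_le0 mulr_ge0 ?powR_ge0.
apply: (@lt_le_trans _ _ ((1 - expR (-1)) * (1 `^ (- p) / p))).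
  by rewrite mulr_gt0 ?subr_gt0// divr_gt0 ?powR_gt0.
rewrite -lee_fin EFinM -integral_powR_y// fineK; last first.
  by apply: (integrable_fin_num _ I).
have e2 : (0 <= (1 - expR (-1) : R)%:E)%E by rewrite lee_fin subr_ge0 ltW.
rewrite -ge0_integralZl//; last 2 first.
- by apply/measurable_EFinP; apply: measurable_funTS; exact: measurable_powR.
- by move=> u _; rewrite lee_fin powR_ge0.
have S : (`[1%R, +oo[%classic : set R) `<=` `]0%R, +oo[%classic.
  by move=> u /=; rewrite !in_itv/= !andbT; exact: lt_le_trans.
have mf := measurable_int _ I.
apply: le_trans (@ge0_subset_integral _ _ _ mu `[1%R, +oo[%classic `]0%R, +oo[%classic _ _ (EFin \o f) mf f0 S) => //.
apply: ge0_le_integral => //.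
- by move=> u _; rewrite -EFinM lee_fin mulr_ge0 ?powR_ge0// subr_ge0 ltW.
- by apply: measurable_funeM; apply/measurable_EFinP; apply: measurable_funTS; exact: measurable_powR.
- exact: measurable_funS mf.
- move=> u /=; rewrite in_itv/= andbT => u1.
  rewrite -EFinM lee_fin ler_wpM2r ?powR_ge0// lerB// ler_expR mul1r lerN2.
  by rewrite powRr1// (le_trans ler01).
Qed.

Lemma integrable_sin (y : R) :
  mu.-integrable `]0%R, +oo[ (EFin \o (fun u => sin (u * y) * u `^ (- 1 - p))).
Proof.
have H (z : R) : 0 < z -> mu.-integrable `]0%R, +oo[ (EFin \o (fun u => sin (u * z) * u `^ (- 1 - p))).
  move=> z0; have := @integrable_rot_im R p z p0 p1 z0 0 1.
  rewrite ler01 lexx normr1 => /(_ isT (lexx _)); apply: eq_integrable => // u _.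
  by rewrite /rot_im /= mulr0 oppr0 expR0 mul1r mulr1.
have [y0|y0|<-] := ltgtP 0 y; first exact: H.
  have := @integrableZl _ _ R mu `]0%R, +oo[%classic (measurable_itv _) (-1) _ (H (- y) _).
  rewrite oppr_gt0 => /(_ y0); apply: eq_integrable => // u _ /=.
  by rewrite -EFinM mulrN sinN; congr EFin; ring.
apply: eq_integrable (integrable0 mu `]0%R, +oo[%classic) => // u _ /=.
by rewrite mulr0 sin0 mul0r.
Qed.

Lemma fourier_abs_powR (y : R) :
  \int[mu]_(u in `]0%R, +oo[) ((1 - cos (u * y)) * u `^ (- 1 - p)) =
  cos (p * (pi / 2)) * (Gamma (1 - p) / p) * `|y| `^ p.
Proof.
have [y0|y0|<-] := ltgtP 0 y; first by rewrite integral_one_sub_cos// gtr0_norm.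
  rewrite ltr0_norm// -integral_one_sub_cos ?oppr_gt0//; apply: eq_Rintegral => u _.
  by rewrite mulrN cosN.
rewrite normr0 powR0 ?gt_eqF// mulr0 /Rintegral integral0_eq// => u _.
by rewrite mulr0 cos0 subrr mul0r.
Qed.

Lemma fourier_sgr_powR (y : R) :
  \int[mu]_(u in `]0%R, +oo[) (sin (u * y) * u `^ (- 1 - p)) =
  sin (p * (pi / 2)) * (Gamma (1 - p) / p) * (Num.sg y * `|y| `^ p).
Proof.
have [y0|y0|<-] := ltgtP 0 y; first by rewrite integral_sin// gtr0_norm// gtr0_sg// mul1r.
  rewrite ltr0_norm// ltr0_sg// mulN1r mulrN -integral_sin ?oppr_gt0//.
  rewrite -[RHS]mulN1r -RintegralZl//; last exact: integrable_sin.
  by apply: eq_Rintegral => u _; rewrite mulrN sinN; ring.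
rewrite normr0 powR0 ?gt_eqF// !mulr0 /Rintegral integral0_eq// => u _.
by rewrite mulr0 sin0 mul0r.
Qed.

End fourier_powers.

(** * Moments from Laplace transforms *)

Section ae_eq_nonmeasurable.
Context {d} {T : measurableType d} {R : realType} (mu : {measure set T -> \bar R}).
Local Open Scope ereal_scope.
Import HBNNSimple.

(* Unlike in [ge0_ae_eq_integral], no measurability: the integral of an
   arbitrary nonnegative function is a supremum over simple minorants, which
   may be cut off on a null set. *)
Lemma ge0_ae_le_integral_sup (f g : T -> \bar R) :
  (forall x, 0 <= f x) -> (forall x, 0 <= g x) ->
  {ae mu, forall x, f x = g x} -> \int[mu]_x f x <= \int[mu]_x g x.
Proof.
move=> f0 g0 [N [mN N0 fgN]]; rewrite !ge0_integralTE//.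
apply: ge_ereal_sup => _ [h/= hf] <-.
have mNC := measurableC mN.
apply: le_ereal_sup_tmp; exists (sintegral mu (proj_nnsfun h mNC)).
  exists (proj_nnsfun h mNC) => // x /=; rewrite mindicE.
  have [xN|xN] := boolP (x \in ~` N); last by rewrite mulr0.
  rewrite mulr1; have <- : f x = g x; last exact: hf.
  by apply: contrapT => fgx; move: xN; rewrite inE/=; apply; exact: fgN.
rewrite -!integralT_nnsfun.
rewrite (@ge0_negligible_integral _ _ _ mu setT N)//; last 2 first.
- by apply/measurable_EFinP.
- by move=> x _; rewrite lee_fin.
rewrite [leRHS](@ge0_negligible_integral _ _ _ mu setT N)//; last 2 first.
- by apply/measurable_EFinP.
- by move=> x _; rewrite lee_fin.
apply: ge0_le_integral => //.
- exact: measurableD.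
- by move=> x _; rewrite lee_fin.
- by apply/measurable_EFinP; exact: measurable_funTS.
- by apply/measurable_EFinP; exact: measurable_funTS.
- move=> x [_ xN] /=; rewrite mindicE mem_set// mulr1//.
Qed.

Lemma ge0_ae_eq_integral_sup (f g : T -> \bar R) :
  (forall x, 0 <= f x) -> (forall x, 0 <= g x) ->
  {ae mu, forall x, f x = g x} -> \int[mu]_x f x = \int[mu]_x g x.
Proof.
move=> f0 g0 fg; apply/eqP; rewrite eq_le !ge0_ae_le_integral_sup//.
by apply: filterS fg => x ->.
Qed.

Lemma ae_eq_integral_sup (f g : T -> \bar R) :
  {ae mu, forall x, f x = g x} -> \int[mu]_x f x = \int[mu]_x g x.
Proof.
move=> fg; rewrite integralE [RHS]integralE; congr (_ - _);
  apply: ge0_ae_eq_integral_sup => //; by apply: filterS fg => x fgx; rewrite ?funeposE ?funenegE fgx.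
Qed.

End ae_eq_nonmeasurable.

Lemma ae_eq_expectation d (T : measurableType d) (R : realType)
  (P : probability T R) (X Y : T -> R) :
  {ae P, forall w, X w = Y w} -> ('E_P[X] = 'E_P[Y])%E.
Proof.
move=> XY; rewrite unlock; apply: ae_eq_integral_sup.
by apply: filterS XY => w ->.
Qed.

Section laplace_expansion.
Context {R : realType}.
Implicit Types x z : R.

(** Three applications of the mean value theorem, since each remainder is, up to sign, the
    derivative of the next. The constant comes from e^(-c) <= e for |c| <= 1. *)
Lemma expRN_taylor2 z : `|z| <= 1 ->
  `|expR (- z) - 1 + z - z ^+ 2 / 2| <= expR 1 * `|z| ^+ 3.
Proof.
have e0 : 0 <= expR 1 :> R by exact: expR_ge0.
have b0 x : `|x| <= 1 -> `|expR (- x) - 1| <= expR 1 * `|x|.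
  move=> x1; have D (y : R) : is_derive y 1 (fun y : R => expR (- y)) (- expR (- y)).
    by apply: is_derive_eq; rewrite /GRing.scale/=; ring.
  have [c] := MVT_from 0 x D; rewrite oppr0 expR0 !addr0 => cx ->.
  rewrite normrM ler_wpM2r// normrN gtr0_norm ?expR_gt0// ler_expR.
  by apply: le_trans (ler_norm _) _; rewrite normrN (le_trans cx).
have b1 x : `|x| <= 1 -> `|expR (- x) - 1 + x| <= expR 1 * `|x| ^+ 2.
  move=> x1; have D (y : R) : is_derive y 1 (fun y : R => expR (- y) - 1 + y) (- (expR (- y) - 1)).
    by apply: is_derive_eq; rewrite /GRing.scale/=; ring.
  have [c] := MVT_from 0 x D; rewrite oppr0 expR0 !addr0 subrr subr0 => cx ->.
  rewrite normrM expr2 mulrA ler_wpM2r// normrN.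
  by apply: le_trans (b0 _ (le_trans cx x1)) _; rewrite ler_wpM2l.
move=> z1; have D (y : R) : is_derive y 1 (fun y : R => expR (- y) - 1 + y - y ^+ 2 / 2) (- (expR (- y) - 1 + y)).
  apply: is_derive_eq; rewrite /GRing.scale/= -mulr_natr; by field.
have [c] := MVT_from 0 z D; rewrite oppr0 expR0 !addr0 subrr [0 ^+ 2]expr2 !mul0r !subr0 => cz ->.
rewrite normrM exprS mulrCA [leRHS]mulrC ler_wpM2r// normrN.
apply: le_trans (b1 _ (le_trans cz z1)) _.
by rewrite ler_wpM2l// lerXn2r ?nnegrE.
Qed.

(** The error K of the exponent is passed on with coefficient exactly 1 and kept apart from C h: the
    latter disappears as h -> 0, whereas K survives in the moment estimate and may be made small
    there. *)
Lemma laplace_expansion (z : R -> R) (a b K delta : R) :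
  0 <= K -> 0 < delta ->
  (forall h, 0 < h < delta -> `|z h - a * h - b * h ^+ 2| <= K * h ^+ 2) ->
  exists C delta', [/\ 0 <= C, 0 < delta' & forall h, 0 < h < delta' ->
    `|expR (- z h) - 1 + a * h - (a ^+ 2 / 2 - b) * h ^+ 2| <= (K + C * h) * h ^+ 2].
Proof.
move=> K0 d0 zh.
pose B := `|b| + K; pose A := `|a| + B.
have B0 : 0 <= B by rewrite addr_ge0.
have A0 : 0 <= A by rewrite addr_ge0.
have e0 : 0 <= expR 1 :> R by exact: expR_ge0.
exists (expR 1 * A ^+ 3 + B * A), (Num.min delta (Num.min 1 (1 + A)^-1)); split.
- by rewrite addr_ge0// mulr_ge0// exprn_ge0.
- by rewrite !lt_min d0 ltr01 invr_gt0; lra.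
move=> h; rewrite !lt_min => /and4P[h0 hd h1 hA].
have /zh hz : 0 < h < delta by rewrite h0.
have z1 : `|z h - a * h| <= B * h ^+ 2.
  have -> : z h - a * h = (z h - a * h - b * h ^+ 2) + b * h ^+ 2 by ring.
  apply: le_trans (ler_normD _ _) _; rewrite normrM [`|h ^+ 2|]ger0_norm ?sqr_ge0//.
  by rewrite /B mulrDl addrC lerD2l.
have h2 : 0 <= h ^+ 2 <= h by rewrite sqr_ge0 expr2; nra.
have z2 : `|z h| <= A * h.
  have -> : z h = (z h - a * h) + a * h by ring.
  apply: le_trans (ler_normD _ _) _; rewrite normrM (gtr0_norm h0) /A mulrDl addrC.
  by rewrite lerD2l (le_trans z1)// ler_wpM2l//; case/andP : h2.
have z3 : `|z h| <= 1.
  apply: le_trans z2 _; have A1 : 0 < 1 + A by lra.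
  have : h * (1 + A) < 1 by rewrite -ltr_pdivlMr// mul1r.
  nra.
have z4 : `|z h + a * h| <= 2 * A * h.
  apply: le_trans (ler_normD _ _) _; rewrite normrM (gtr0_norm h0).
  have : `|a| * h <= A * h by rewrite ler_wpM2r ?(ltW h0)// /A lerDl.
  lra.
(* The last summand is (z^2 - (a h)^2) / 2 in factored form, so that it is visibly of third
   order. *)
have -> : expR (- z h) - 1 + a * h - (a ^+ 2 / 2 - b) * h ^+ 2 =
  (expR (- z h) - 1 + z h - z h ^+ 2 / 2) - (z h - a * h - b * h ^+ 2)
  + (z h - a * h) * (z h + a * h) / 2 by field.
have T := expRN_taylor2 z3.
have T' : expR 1 * `|z h| ^+ 3 <= expR 1 * A ^+ 3 * h * h ^+ 2.
  have -> : expR 1 * A ^+ 3 * h * h ^+ 2 = expR 1 * (A * h) ^+ 3 by ring.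
  by rewrite ler_wpM2l// lerXn2r// nnegrE mulr_ge0// ltW.
have T2 : `|(z h - a * h) * (z h + a * h) / 2| <= B * A * h * h ^+ 2.
  rewrite !normrM [`|2^-1|]ger0_norm// ler_pdivrMr//.
  apply: le_trans (ler_pM (normr_ge0 _) (normr_ge0 _) z1 z4) _.
  by rewrite le_eqVlt; apply/orP; left; apply/eqP; ring.
apply: le_trans (ler_normD _ _) _.
apply: le_trans (lerD (ler_normB _ _) (lexx _)) _.
lra.
Qed.

End laplace_expansion.

Lemma fatou_cvg d (T : measurableType d) (R : realType)
    (mu : {measure set T -> \bar R}) (f_ : nat -> T -> R) (f : T -> R)
    (c : nat -> R) (l : R) :
  (forall n, measurable_fun setT (f_ n)) -> (forall n w, 0 <= f_ n w) ->
  (forall w, f_ n w @[n --> \oo] --> f w) ->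
  (forall n, (\int[mu]_w (f_ n w)%:E <= (c n)%:E)%E) -> c n @[n --> \oo] --> l ->
  (\int[mu]_w (f w)%:E <= l%:E)%E.
Proof.
move=> mf f0 ff fc cl.
have -> : (\int[mu]_w (f w)%:E = \int[mu]_w limn_einf (fun n => (f_ n w)%:E))%E.
  apply: eq_integral => w _; apply/esym.
  have ffE : (f_ n w)%:E @[n --> \oo] --> (f w)%:E by apply: cvg_EFin (ff w); exact: nearW.
  by have [-> _] := cvg_limn_einf_sup ffE.
apply: (@le_trans _ _ (limn_einf (fun n => \int[mu]_w (f_ n w)%:E)%E)).
  apply: (@fatou _ _ _ mu setT _ (fun n w => (f_ n w)%:E)) => //.
    by move=> n; apply/measurable_EFinP.
  by move=> n w _; rewrite lee_fin.
have cl' : (c n)%:E @[n --> \oo] --> l%:E by apply: cvg_EFin cl; exact: nearW.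
rewrite -[leRHS](cvg_limn_einf_sup cl').1 !limn_einf_lim; apply: lee_lim.
- exact: is_cvg_einfs.
- exact: is_cvg_einfs.
- apply: nearW => n; apply: le_ereal_inf_tmp => _ /= [m nm <-].
  by apply: ereal_inf_le; exists (\int[mu]_w (f_ m w)%:E)%E => //; exists m.
Qed.

Section probability_integrals.
Context {d} {T : measurableType d} {R : realType} (P : probability T R).
Implicit Types (X Y : T -> R).

Definition integrable_rv X := P.-integrable setT (EFin \o X).

Lemma integrable_rv_cst c : integrable_rv (fun=> c).
Proof. exact: (finite_measure_integrable_cst P c measurableT). Qed.

Lemma integrable_rvD X Y : integrable_rv X -> integrable_rv Y ->
  integrable_rv (fun w => X w + Y w).
Proof. by move=> iX iY; apply: (integrableD measurableT iX iY). Qed.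

Lemma integrable_rvB X Y : integrable_rv X -> integrable_rv Y ->
  integrable_rv (fun w => X w - Y w).
Proof. by move=> iX iY; apply: (integrableB measurableT iX iY). Qed.

Lemma integrable_rvZ c X : integrable_rv X -> integrable_rv (fun w => c * X w).
Proof. by move=> iX; apply: (integrableZl measurableT c iX). Qed.

Lemma le_integrable_rv X Y : measurable_fun setT X -> integrable_rv Y ->
  (forall w, `|X w| <= Y w) -> integrable_rv X.
Proof.
move=> mX iY XY; apply: le_integrable iY => //; first exact/measurable_EFinP.
by move=> w _ /=; rewrite lee_fin (le_trans (XY w))// ler_norm.
Qed.

Lemma integrable_rv_measurable X : integrable_rv X -> measurable_fun setT X.
Proof. by move=> /integrableP[/measurable_EFinP]. Qed.

Lemma Rintegral_rv_cst c : \int[P]_w c = c.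
Proof. by rewrite Rintegral_cst//= probability_setT mulr1. Qed.

Lemma EFin_Rintegral_rv X : integrable_rv X -> (\int[P]_w X w)%:E = (\int[P]_w (X w)%:E)%E.
Proof. by move=> iX; rewrite /Rintegral fineK// (integrable_fin_num measurableT iX). Qed.

Lemma ge0_integrable_rv X c : measurable_fun setT X -> (forall w, 0 <= X w) ->
  (\int[P]_w (X w)%:E <= c%:E)%E -> integrable_rv X.
Proof.
move=> mX X0 Xc; apply/integrableP; split; first exact/measurable_EFinP.
apply: le_lt_trans (ltry c); apply: le_trans Xc.
rewrite le_eqVlt; apply/orP; left; apply/eqP; apply: eq_integral => w _ /=.
by rewrite ger0_norm.
Qed.

Lemma expectation_integrable_rv X c : measurable_fun setT X -> (forall w, 0 <= X w) ->
  ('E_P[X] = c%:E)%E -> integrable_rv X /\ \int[P]_w X w = c.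
Proof.
move=> mX X0; rewrite unlock => E; split; last by rewrite /Rintegral E.
by apply: (ge0_integrable_rv mX X0); rewrite E.
Qed.

Lemma integrable_rv_sqr X : measurable_fun setT X ->
  integrable_rv (fun w => X w ^+ 2) -> integrable_rv X.
Proof.
move=> mX iX; apply: le_integrable_rv (integrable_rvD (integrable_rv_cst 1) iX) _ => //.
move=> w; rewrite -(real_normK (num_real (X w))).
by have := sqr_ge0 (`|X w| - 1); have := normr_ge0 (X w); nra.
Qed.

End probability_integrals.

Section laplace_moments.
Context {R : realType}.

Definition exp_quot (h x : R) : R := (1 - expR (- (h * x))) / h.

(** A dominating function uniform in h. For x >= 0 the quotient lies in [0, x]; for x < 0 its
    modulus is at most - x e^(-x) <= e^(-2x). The exponential moment at 4 is finite because the
    Laplace transform is. *)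
Lemma exp_quot_sqr_le (h x : R) : 0 < h <= 1 ->
  exp_quot h x ^+ 2 <= x ^+ 2 + expR (- (4 * x)).
Proof.
move=> /andP[h0 h1]; have e4 := expR_ge0 (- (4 * x)).
rewrite /exp_quot; set q := _ / h.
have q1 : q <= x.
  rewrite ler_pdivrMr//; have := expR_ge1Dx (- (h * x)); lra.
have [x0|x0] := leP 0 x.
  have q0 : 0 <= q.
    rewrite divr_ge0 ?(ltW h0)// subr_ge0 -[leRHS]expR0 ler_expR oppr_le0.
    by rewrite mulr_ge0// ltW.
  by rewrite ler_wpDr// lerXn2r// nnegrE.
apply: ler_wpDl; first exact: sqr_ge0.
have -> : expR (- (4 * x)) = expR (- (2 * x)) ^+ 2.
  by rewrite expr2 -expRD; congr expR; ring.
rewrite -sqrrN lerXn2r ?nnegrE ?expR_ge0//; first by lra.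
have -> : expR (- (2 * x)) = expR (- x) * expR (- x) by rewrite -expRD; congr expR; ring.
apply: (@le_trans _ _ (- x * expR (- x))); last first.
  by rewrite ler_wpM2r ?expR_ge0//; have := expR_ge1Dx (- x); lra.
have -> : - q = (expR (- (h * x)) - 1) / h by rewrite /q; ring.
rewrite ler_pdivrMr//.
apply: (@le_trans _ _ (- (h * x) * expR (- (h * x)))).
  have := expR_ge1Dx (h * x); have : expR (h * x) * expR (- (h * x)) = 1.
    by rewrite -expRD subrr expR0.
  have := expR_gt0 (- (h * x)); nra.
have : expR (- (h * x)) <= expR (- x) by rewrite ler_expR; nra.
have : 0 < - (h * x) by rewrite oppr_gt0 pmulr_rlt0.
nra.
Qed.

Lemma cvg_exp_quot (h : nat -> R) (x : R) : (forall n, 0 < h n) ->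
  h n @[n --> \oo] --> 0 -> exp_quot (h n) x @[n --> \oo] --> x.
Proof.
move=> h0 hc.
have hx : h n * x @[n --> \oo] --> 0 by rewrite -[X in _ --> X](mul0r x); apply: cvgMl.
apply: (@squeeze_cvgr _ _ _ _ (fun n => x - 2 * x ^+ 2 * h n) (fun=> x)).
- near=> n.
  have k : `|h n * x| <= 2^-1.
    by near: n; apply: (cvgr0_norm_le _ hx).
  move: k; rewrite ler_norml => /andP[k1 k2].
  have hn := h0 n; rewrite /exp_quot ler_pdivrMr// ler_pdivlMr//; apply/andP; split.
    have := expR_ge1Dx (h n * x); have : expR (h n * x) * expR (- (h n * x)) = 1.
      by rewrite -expRD subrr expR0.
    have : 0 < expR (- (h n * x)) by exact: expR_gt0.
    set y := h n * x in k1 k2 *; set e := expR (- y); set f := expR y => e0 ef fy.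
    have -> : (x - 2 * x ^+ 2 * h n) * h n = y - 2 * y ^+ 2 by rewrite /y; ring.
    have : (1 + y) * e <= 1 by apply: le_trans (ler_wpM2r (ltW e0) fy) _; rewrite ef.
    have : 0 <= y ^+ 2 by exact: sqr_ge0.
    have e2 : e <= 2 by nra.
    nra.
  by have := expR_ge1Dx (- (h n * x)); lra.
- rewrite -[X in _ --> X]subr0; apply: cvgB; first exact: cvg_cst.
  by rewrite -[X in _ --> X](mulr0 (2 * x ^+ 2)); apply: cvgMr.
- exact: cvg_cst.
Unshelve. all: by end_near. Qed.

(** The mean of the squared quotient is the second difference (1 - 2 M(h) + M(2h)) / h^2 of the
    Laplace transform M. The error at 2h contributes 4 K and twice the error at h contributes 2 K,
    whence 6 K. Once Fatou's lemma has produced the second moment, dominated convergence gives the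
    mean and the two-sided estimate. *)
Lemma laplace_moments d (T : measurableType d) (P : probability T R)
    (X : T -> R) (z : R -> R) (a b K delta : R) :
  measurable_fun setT X ->
  (forall h, 0 < h -> ('E_P[fun w => expR (- (h * X w))] = (expR (- z h))%:E)%E) ->
  0 <= K -> 0 < delta ->
  (forall h, 0 < h < delta -> `|z h - a * h - b * h ^+ 2| <= K * h ^+ 2) ->
  [/\ integrable_rv P (fun w => X w ^+ 2), \int[P]_w X w = a &
      `|\int[P]_w (X w ^+ 2) - (a ^+ 2 - 2 * b)| <= 6 * K].
Proof.
move=> mX EX K0 d0 zh.
have [C [e [C0 e0 ze]]] := laplace_expansion K0 d0 zh.
pose L := a ^+ 2 / 2 - b.
pose M h := expR (- z h).
have iM h : 0 < h -> integrable_rv P (fun w => expR (- (h * X w))) /\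
    \int[P]_w expR (- (h * X w)) = M h.
  move=> h0; apply: expectation_integrable_rv.
  - by apply: measurableT_comp => //; apply: measurableT_comp => //; exact: measurable_funM.
  - by move=> w; exact: expR_ge0.
  - exact: EX.
(* This keeps h and 2 h in the range of the expansion, and h <= 1 for the dominating function. *)
pose h0 := Num.min (e / 4) 1.
pose h n : R := h0 * n.+1%:R^-1.
have h00 : 0 < h0 by rewrite lt_min ltr01 andbT; lra.
have hp n : 0 < h n by rewrite mulr_gt0// invr_gt0.
have hh0 n : h n <= h0 by rewrite /h ler_piMr ?(ltW h00)// invf_le1// ler1n.
have h1 n : h n <= 1 by rewrite (le_trans (hh0 n))// ge_min lexx orbT.
have he n : h n < e.
  rewrite (le_lt_trans (hh0 n))// gt_min; apply/orP; left; lra.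
have h2e n : 2 * h n < e.
  have : h n <= e / 4 by rewrite (le_trans (hh0 n))// ge_min lexx.
  by lra.
have hc : h n @[n --> \oo] --> 0.
  by rewrite -[X in _ --> X](mulr0 h0); apply: cvgMr; exact: cvg_harmonic.
pose D n w := exp_quot (h n) (X w).
have mD n : measurable_fun setT (D n).
  apply: measurable_funM => //; apply: measurable_funB => //.
  by apply: measurableT_comp => //; apply: measurableT_comp => //; exact: measurable_funM.
have ID n : integrable_rv P (D n) /\ \int[P]_w D n w = (1 - M (h n)) / h n.
  have [i1 E1] := iM _ (hp n).
  have i2 := integrable_rvB (integrable_rv_cst P 1) i1.
  have -> : D n = (fun w => (h n)^-1 * (1 - expR (- (h n * X w)))).
    by apply/funext => w; rewrite /D /exp_quot mulrC.
  split; first exact: integrable_rvZ.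
  rewrite RintegralZl//; rewrite RintegralB//; last exact: integrable_rv_cst.
  by rewrite Rintegral_rv_cst E1 mulrC.
have h2p n : 0 < 2 * h n by rewrite mulr_gt0.
have ID2 n : integrable_rv P (fun w => D n w ^+ 2) /\
    \int[P]_w (D n w ^+ 2) = (1 - 2 * M (h n) + M (2 * h n)) / h n ^+ 2.
  have [i1 E1] := iM _ (hp n); have [i2 E2] := iM _ (h2p n).
  have i3 := integrable_rvB (integrable_rv_cst P 1) (integrable_rvZ 2 i1).
  have i4 := integrable_rvD i3 i2.
  have -> : (fun w => D n w ^+ 2) = (fun w => (h n ^+ 2)^-1 * (1 - 2 * expR (- (h n * X w)) + expR (- (2 * h n * X w)))).
    apply/funext => w; rewrite /D /exp_quot expr_div_n mulrC; congr (_ * _).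
    have -> : expR (- (2 * h n * X w)) = expR (- (h n * X w)) ^+ 2.
      by rewrite expr2 -expRD; congr expR; ring.
    by ring.
  split; first exact: integrable_rvZ.
  rewrite RintegralZl// RintegralD// RintegralB//; [|exact: integrable_rv_cst|exact: integrable_rvZ].
  by rewrite RintegralZl// Rintegral_rv_cst E1 E2 mulrC.
have D2b n : `|\int[P]_w (D n w ^+ 2) - (a ^+ 2 - 2 * b)| <= 6 * K + 10 * C * h n.
  have [_ ->] := ID2 n; have hn := hp n.
  have /ze r1 : 0 < h n < e by rewrite hn he.
  have /ze r2 : 0 < 2 * h n < e by rewrite h2e h2p.
  have -> : (1 - 2 * M (h n) + M (2 * h n)) / h n ^+ 2 - (a ^+ 2 - 2 * b) =
    ((M (2 * h n) - 1 + a * (2 * h n) - L * (2 * h n) ^+ 2)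
     - 2 * (M (h n) - 1 + a * h n - L * h n ^+ 2)) / h n ^+ 2.
    by rewrite /L; field; rewrite gt_eqF.
  rewrite normrM [`|_^-1|]gtr0_norm ?invr_gt0 ?exprn_gt0// ler_pdivrMr ?exprn_gt0//.
  apply: le_trans (ler_normB _ _) _; rewrite [`|2 * _|]normrM (@ger0_norm _ 2)//.
  have := lerD r2 (ler_wpM2l (ler0n R 2) r1); rewrite -/(M _) -/(M _) -/L.
  move/le_trans; apply.
  by rewrite le_eqVlt; apply/orP; left; apply/eqP; ring.
have DX w : D n w @[n --> \oo] --> X w by exact: cvg_exp_quot.
have D2X w : D n w ^+ 2 @[n --> \oo] --> X w ^+ 2.
  by rewrite expr2; under eq_fun do rewrite expr2; apply: cvgM; exact: DX.
have cc : 6 * K + 10 * C * h n @[n --> \oo] --> 6 * K.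
  rewrite -[X in _ --> X]addr0; apply: cvgD; first exact: cvg_cst.
  by rewrite -[X in _ --> X](mulr0 (10 * C)); apply: cvgMr.
have iX2 : integrable_rv P (fun w => X w ^+ 2).
  apply: (@ge0_integrable_rv _ _ _ _ _ ((a ^+ 2 - 2 * b) + 6 * K)).
  - exact: measurable_funX.
  - by move=> w; exact: sqr_ge0.
  apply: (@fatou_cvg _ _ _ P (fun n w => D n w ^+ 2) _ (fun n => (a ^+ 2 - 2 * b) + (6 * K + 10 * C * h n))) => //.
  - by move=> n; exact: measurable_funX.
  - by move=> n w; exact: sqr_ge0.
  - move=> n; rewrite -EFin_Rintegral_rv ?lee_fin; last exact: (ID2 n).1.
    have := D2b n; rewrite ler_norml => /andP[_]; lra.
  - by apply: cvgD => //; exact: cvg_cst.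
have ig : integrable_rv P (fun w => X w ^+ 2 + expR (- (4 * X w))).
  by apply: integrable_rvD => //; exact: (iM 4 _).1.
have Db n w : D n w ^+ 2 <= X w ^+ 2 + expR (- (4 * X w)).
  by apply: exp_quot_sqr_le; rewrite hp h1.
split => //.
- have [_ cD] : P.-integrable setT (EFin \o X) /\ \int[P]_w D n w @[n --> \oo] --> \int[P]_w X w.
    apply: (@Rintegral_dominated_cvg _ _ _ P setT measurableT D X (fun w => 1 + (X w ^+ 2 + expR (- (4 * X w))))) => //.
    + by apply: integrable_rvD => //; exact: integrable_rv_cst.
    + move=> n w _; apply: le_trans (lerD (lexx 1) (Db n w)).
      rewrite -(real_normK (num_real (D n w))).
      by have := sqr_ge0 (`|D n w| - 1); have := normr_ge0 (D n w); nra.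
  apply/esym; apply: (cvg_unique _ _ cD) => //.
  (* The expansion gives (1 - M(h)) / h = a + O(h), with constant |L| + K + C since h <= 1. *)
  apply: (@squeeze_cvgr _ _ _ _ (fun n => a - (`|L| + (K + C)) * h n) (fun n => a + (`|L| + (K + C)) * h n)).
  + near=> n; have [_ ->] := ID n; have hn := hp n.
    have /ze r1 : 0 < h n < e by rewrite hn he.
    have h21 : 0 <= h n ^+ 2 by exact: sqr_ge0.
    have Ch : C * h n <= C by rewrite ler_piMr// h1.
    have r2 : `|M (h n) - 1 + a * h n| <= (`|L| + (K + C)) * h n ^+ 2.
      have -> : M (h n) - 1 + a * h n = (M (h n) - 1 + a * h n - L * h n ^+ 2) + L * h n ^+ 2 by ring.
      apply: le_trans (ler_normD _ _) _.
      rewrite [`|L * _|]normrM (ger0_norm h21) [leRHS]mulrDl [leRHS]addrC lerD2r (le_trans r1)//.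
      by rewrite ler_wpM2r// lerD2l.
    rewrite ler_pdivrMr// ler_pdivlMr//.
    move: r2; rewrite ler_norml => /andP[r2 r3]; apply/andP; split; lra.
  + rewrite -[X in _ --> X]subr0; apply: cvgB; first exact: cvg_cst.
    by rewrite -[X in _ --> X](mulr0 (`|L| + (K + C))); apply: cvgMr.
  + rewrite -[X in _ --> X]addr0; apply: cvgD; first exact: cvg_cst.
    by rewrite -[X in _ --> X](mulr0 (`|L| + (K + C))); apply: cvgMr.
- have [_ cD] : P.-integrable setT (EFin \o (fun w => X w ^+ 2)) /\ \int[P]_w (D n w ^+ 2) @[n --> \oo] --> \int[P]_w (X w ^+ 2).
    apply: (@Rintegral_dominated_cvg _ _ _ P setT measurableT (fun n w => D n w ^+ 2) (fun w => X w ^+ 2) (fun w => (X w ^+ 2 + expR (- (4 * X w))))) => //.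
    + by move=> n; exact: measurable_funX.
    + by move=> n w _; rewrite ger0_norm ?sqr_ge0// Db.
  have cN : `|\int[P]_w (D n w ^+ 2) - (a ^+ 2 - 2 * b)| @[n --> \oo] --> `|\int[P]_w (X w ^+ 2) - (a ^+ 2 - 2 * b)|.
    by apply: cvg_norm; apply: cvgB => //; exact: cvg_cst.
  by apply: ler_cvg_to cN cc _; apply: nearW.
Unshelve. all: by end_near. Qed.

End laplace_moments.

(** * Independence as factorization of integrals *)

Section independence.
Context {d} {T : measurableType d} {R : realType} (P : probability T R).
Variables (X Z : T -> R).
Hypotheses (mX : measurable_fun setT X) (mZ : measurable_fun setT Z).
Hypothesis XZ : forall A B : set R, measurable A -> measurable B ->
  P (X @^-1` A `&` Z @^-1` B) = (P (X @^-1` A) * P (Z @^-1` B))%E.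

(** The joint law agrees with the product of the marginal laws on rectangles, hence everywhere;
    Tonelli's theorem then factors the integral. *)
Lemma ge0_integral_indepM (f g : R -> R) :
  measurable_fun setT f -> measurable_fun setT g ->
  (forall x, 0 <= f x) -> (forall x, 0 <= g x) ->
  (\int[P]_w (f (X w) * g (Z w))%:E =
   \int[P]_w (f (X w))%:E * \int[P]_w (g (Z w))%:E)%E.
Proof.
move=> mf mg f0 g0.
have mW : measurable_fun setT (fun w => (X w, Z w)) by apply: measurable_fun_pair.
pose X' : {RV P >-> R} := mfun_Sub (mem_set mX).
pose Z' : {RV P >-> R} := mfun_Sub (mem_set mZ).
pose W' : {RV P >-> (R * R)%type} := mfun_Sub (mem_set mW).
have E A : measurable A -> (distribution P X' \x distribution P Z')%E A = distribution P W' A.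
  apply: product_measure_unique => B C mB mC.
  by rewrite -XZ.
pose h (z : R * R) := (f z.1 * g z.2)%:E.
have mh : measurable_fun setT h.
  by apply/measurable_EFinP; apply: measurable_funM; apply: measurableT_comp.
have h0 z : (0 <= h z)%E by rewrite lee_fin mulr_ge0.
transitivity (\int[distribution P W']_z h z)%E.
  by rewrite ge0_integral_distribution.
rewrite (eq_measure_integral (distribution P X' \x distribution P Z')%E); last first.
  by move=> A mA _; exact: esym (E A mA).
rewrite fubini_tonelli1// /fubini_F /h /=.
under eq_integral => x _.
  rewrite (_ : (\int[_]_y _ = (f x)%:E * \int[distribution P Z']_y (g y)%:E)%E); last first.
    rewrite -ge0_integralZl ?lee_fin//.
    - exact/measurable_EFinP.
    - by move=> y _; rewrite lee_fin.
  over.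
rewrite ge0_integralZr//.
- by rewrite !ge0_integral_distribution//; do ?[exact/measurable_EFinP | by move=> y; rewrite lee_fin].
- exact/measurable_EFinP.
- by move=> x _; rewrite lee_fin.
- by apply: integral_ge0 => y _; rewrite lee_fin.
Qed.

(** Reduced to the nonnegative functions 1 + f and 1 + g, by expanding their product. *)
Lemma Rintegral_indepM (f g : R -> R) :
  measurable_fun setT f -> measurable_fun setT g ->
  (forall x, `|f x| <= 1) -> (forall x, `|g x| <= 1) ->
  \int[P]_w (f (X w) * g (Z w)) = \int[P]_w f (X w) * \int[P]_w g (Z w).
Proof.
move=> mf mg f1 g1.
have f0 x : 0 <= 1 + f x by have := f1 x; rewrite ler_norml => /andP[]; lra.
have g0 x : 0 <= 1 + g x by have := g1 x; rewrite ler_norml => /andP[]; lra.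
have mfX : measurable_fun setT (fun w => f (X w)) by exact: measurableT_comp.
have mgZ : measurable_fun setT (fun w => g (Z w)) by exact: measurableT_comp.
have ic := integrable_rv_cst P 1.
have iF : integrable_rv P (fun w => f (X w)) by apply: le_integrable_rv ic _.
have iG : integrable_rv P (fun w => g (Z w)) by apply: le_integrable_rv ic _.
have iFG : integrable_rv P (fun w => f (X w) * g (Z w)).
  apply: le_integrable_rv ic _; first exact: measurable_funM.
  by move=> w; rewrite normrM -[leRHS]mulr1 ler_pM.
have iF1 := integrable_rvD ic iF; have iG1 := integrable_rvD ic iG.
have := @ge0_integral_indepM (fun x => 1 + f x) (fun x => 1 + g x) _ _ f0 g0.
rewrite -!EFin_Rintegral_rv//; last first.
  have -> : (fun w => (1 + f (X w)) * (1 + g (Z w))) =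
     (fun w => (1 + f (X w)) + (g (Z w) + f (X w) * g (Z w))).
    by apply/funext => w; ring.
  by do 2 apply: integrable_rvD => //.
rewrite -EFinM => /(_ (measurable_funD _ _) (measurable_funD _ _)) H.
have {}H := EFin_inj (H _ _ _ _).
have : \int[P]_w ((1 + f (X w)) * (1 + g (Z w))) =
  \int[P]_w (1 + f (X w)) + (\int[P]_w (g (Z w)) + \int[P]_w (f (X w) * g (Z w))).
  rewrite -RintegralD// -RintegralD//; last exact: integrable_rvD.
  by apply: eq_Rintegral => w _; ring.
rewrite H//; rewrite !RintegralD// Rintegral_rv_cst.
lra.
Qed.

End independence.

(** * Moments of the two processes *)

Section power_series.
Context {R : realType}.
Variables (dd : nat -> R) (psi : R -> R).
Hypothesis psi_series : forall eta : R, 0 < eta ->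
  (\sum_(1 <= k < n) dd k * eta ^+ k) @[n --> \oo] --> psi eta.

(** Convergence at eta = 1 bounds the partial sums there, and a coefficient is a difference of two
    consecutive ones. *)
Lemma power_series_coef_bounded : exists2 B, 0 <= B & forall k, (1 <= k)%N -> `|dd k| <= B.
Proof.
have /cvg_seq_bounded[M [_ /= HM]] : cvgn (fun n => \sum_(1 <= k < n) dd k * 1 ^+ k).
  by apply/cvg_ex; eexists; exact: psi_series ltr01.
have {}HM n : `|\sum_(1 <= k < n) dd k * 1 ^+ k| <= `|M| + 1.
  by apply: HM => //; rewrite (le_lt_trans (ler_norm _))// ltrDl.
exists ((`|M| + 1) + (`|M| + 1)); first by rewrite !addr_ge0.
move=> k k1; have -> : dd k = \sum_(1 <= i < k.+1) dd i * 1 ^+ i - \sum_(1 <= i < k) dd i * 1 ^+ i.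
  by rewrite big_nat_recr//= expr1n mulr1 addrAC subrr add0r.
by apply: le_trans (ler_normB _ _) _; exact: lerD.
Qed.

Lemma power_series_remainder N : (1 <= N)%N -> exists2 B, 0 <= B &
  forall eta : R, 0 < eta < 2^-1 ->
    `|psi eta - \sum_(1 <= k < N) dd k * eta ^+ k| <= B * eta ^+ N.
Proof.
move=> N1; have [B B0 dB] := power_series_coef_bounded.
exists (B * 2); first by rewrite mulr_ge0.
move=> eta /andP[e0 e1].
(* The subtracted term makes the induction close, using eta <= 1/2. *)
have geo n : \sum_(N <= k < N + n) eta ^+ k <= 2 * eta ^+ N - 2 * eta ^+ (N + n).
  elim: n => [|n IH]; first by rewrite addn0 big_geq// subrr.
  rewrite addnS big_nat_recr ?leq_addr//= exprS.
  have : 0 <= eta ^+ (N + n) by rewrite exprn_ge0// ltW.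
  nra.
have part n : (N <= n)%N -> `|\sum_(1 <= k < n) dd k * eta ^+ k - \sum_(1 <= k < N) dd k * eta ^+ k| <= B * 2 * eta ^+ N.
  move=> Nn; rewrite (big_cat_nat N1 Nn)/= [X in X - _]addrC addrK.
  rewrite -(subnKC Nn); apply: le_trans (ler_norm_sum _ _ _) _.
  apply: (@le_trans _ _ (\sum_(N <= k < N + (n - N)) B * eta ^+ k)).
    rewrite big_nat_cond [leRHS]big_nat_cond; apply: ler_sum => k /andP[/andP[Nk _] _].
    rewrite normrM [`|eta ^+ k|]ger0_norm ?exprn_ge0 ?(ltW e0)// ler_wpM2r ?exprn_ge0 ?(ltW e0)//.
    by apply: dB; apply: leq_trans Nk.
  rewrite -mulr_sumr -mulrA ler_wpM2l//; apply: le_trans (geo _) _.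
  by rewrite gerBl mulr_ge0// exprn_ge0// ltW.
have c : `|\sum_(1 <= k < n) dd k * eta ^+ k - \sum_(1 <= k < N) dd k * eta ^+ k| @[n --> \oo] -->
  `|psi eta - \sum_(1 <= k < N) dd k * eta ^+ k|.
  by apply: cvg_norm; apply: cvgB; [exact: psi_series|exact: cvg_cst].
rewrite -(cvg_lim _ c)//; apply: limr_le; first by apply/cvg_ex; eexists; exact: c.
by near=> n; apply: part; near: n; exact: nbhs_infty_ge.
Unshelve. all: by end_near. Qed.

End power_series.

Lemma npos_ler_powR (R : realType) (q x y : R) : q <= 0 -> 0 < x -> x <= y ->
  y `^ q <= x `^ q.
Proof.
move=> q0 x0 xy; have y0 := lt_le_trans x0 xy.
rewrite -[q]opprK !(powRN _ (- q)) lef_pV2 ?posrE ?powR_gt0//.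
by apply: ge0_ler_powR; rewrite ?nnegrE ?oppr_ge0 ?(ltW x0) ?(ltW y0).
Qed.

(** * Local expansion of the exponent of the subordinator *)

Section tempered_incomplete_gamma.
Context {R : realType}.
Notation mu := (@lebesgue_measure R).
Variables (alpha theta : R).
Hypotheses (alpha_gt0 : 0 < alpha) (alpha_le1 : alpha <= 1) (theta_gt0 : 0 < theta).

Let f (y : R) : R := expR (- y) * y `^ (alpha - 1).

Let mf : measurable_fun setT f.
Proof.
apply: measurable_funM; last exact: measurable_powR.
by apply: measurableT_comp.
Qed.

Let f_ge0 y : 0 <= f y.
Proof. by rewrite mulr_ge0 ?expR_ge0 ?powR_ge0. Qed.

Lemma integrable_lower_gamma (A : R) : mu.-integrable `[0%R, A] (EFin \o f).
Proof.
pose g (y : R) : R := ((fun y => y `^ (- (1 - alpha))) \_ `]0, 1]) y.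
have ig0 : mu.-integrable `]0, 1] (EFin \o (fun y : R => y `^ (- (1 - alpha)))).
  apply/integrableP; split.
    by apply/measurable_EFinP; apply: measurable_funTS; exact: measurable_powR.
  have a1 : 1 - alpha < 1 by rewrite gtrBl.
  apply: le_lt_trans (ltry (1 - (1 - alpha))^-1); apply: le_trans (integral_powR_01 a1).
  rewrite le_eqVlt; apply/orP; left; apply/eqP; apply: eq_integral => y _ /=.
  by rewrite ger0_norm ?powR_ge0.
have ig : mu.-integrable setT (EFin \o g).
  have := (@integrable_mkcond _ _ R mu `]0%R, 1%R]%classic (EFin \o (fun y : R => y `^ (- (1 - alpha)))) (measurable_itv _)).1 ig0.
  by rewrite restrict_EFin.
have i1 : mu.-integrable `[0%R, A] (EFin \o (fun=> 1)).
  apply: measurable_bounded_integrable => //; last exact: bounded_cst.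
  suff : (lebesgue_measure (`[0%R, A]%classic : set R) < +oo)%E by [].
  by rewrite lebesgue_measure_itv; case: ifPn => // _; rewrite -EFinD ltry.
have i2 : mu.-integrable `[0%R, A] (EFin \o g) by apply: integrableS ig.
have i3 : mu.-integrable `[0%R, A] (EFin \o (fun y => 1 + g y)).
  by apply: (@integrableD _ _ _ mu _ (measurable_itv _) _ _ i1 i2).
apply: le_integrable i3 => //; first by apply/measurable_EFinP; exact: measurable_funTS.
move=> y /=; rewrite in_itv/= => /andP[y0 yA]; rewrite lee_fin.
have g0 z : 0 <= g z by rewrite /g patchE; case: ifPn => // _; exact: powR_ge0.
rewrite !ger0_norm ?addr_ge0//.
have e1 : expR (- y) <= 1 by rewrite -[leRHS]expR0 ler_expR oppr_le0.
have fle : f y <= y `^ (alpha - 1) by rewrite /f ler_piMl// powR_ge0.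
apply: le_trans fle _.
have [y1|y1] := leP y 1; last first.
  apply: (@le_trans _ _ 1); last by rewrite lerDl.
  by rewrite -[leRHS](powRr0 y); apply: ler_powR; [exact: ltW|rewrite subr_le0].
have [yp|yn] := ltP 0 y.
  rewrite /g patchE ifT; last by rewrite inE/= in_itv/= yp.
  by rewrite opprB lerDr.
(* At y = 0 the power evaluates to 0, or to 1 when alpha = 1; either way the constant 1
   dominates. *)
have -> : y = 0 by apply/eqP; rewrite eq_le yn.
apply: (@le_trans _ _ 1); last by rewrite lerDl.
have [->|a1] := eqVneq (alpha - 1) 0; first by rewrite powRr0.
by rewrite powR0.
Qed.

(** The increment is the integral of f over ]theta, theta + h], compared with h f(theta). The
    constant bounds |f'| on [theta, +oo[, where both powers in f' are non-increasing because their
    exponents are at most 0. *)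
Lemma lower_gamma_increment (h : R) : 0 < h ->
  `|lower_gamma alpha (h + theta) - lower_gamma alpha theta
    - theta `^ (alpha - 1) * expR (- theta) * h|
  <= (theta `^ (alpha - 1) + theta `^ (alpha - 2)) * h ^+ 2.
Proof.
move=> h0.
have -> : lower_gamma alpha (h + theta) - lower_gamma alpha theta =
    \int[mu]_(y in `]theta, h + theta]) f y.
  have := @Rintegral_itvB R f (BLeft 0) (BRight (h + theta)) theta (integrable_lower_gamma _).
  by apply; rewrite bnd_simp ?(ltW theta_gt0)// lerDr ltW.
have iF : mu.-integrable `]theta, h + theta] (EFin \o f).
  apply: integrableS (integrable_lower_gamma (h + theta)) => //.
  by apply: subset_itvr; rewrite bnd_simp ltW.
have mI : (lebesgue_measure (`]theta, (h + theta)%R]%classic : set R) = h%:E)%E.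
  by rewrite lebesgue_measure_itv/= lte_fin ltrDr h0 -EFinB addrK.
have iC c : mu.-integrable `]theta, h + theta] (EFin \o (fun=> c)).
  apply: measurable_bounded_integrable => //; last exact: bounded_cst.
  suff : (lebesgue_measure (`]theta, (h + theta)%R]%classic : set R) < +oo)%E by [].
  by rewrite mI ltry.
have Ic c : \int[mu]_(y in `]theta, h + theta]) c = c * h.
  by rewrite Rintegral_cst//; congr (_ * _); exact: (congr1 fine mI).
pose K := theta `^ (alpha - 1) + theta `^ (alpha - 2).
have K0 : 0 <= K by rewrite addr_ge0 ?powR_ge0.
have -> : theta `^ (alpha - 1) * expR (- theta) * h = \int[mu]_(y in `]theta, h + theta]) f theta.
  by rewrite Ic /f; ring.
rewrite -RintegralB//.
apply: le_trans (le_normr_Rintegral _ _) _ => //.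
  by apply: (@integrableB _ _ _ mu _ (measurable_itv _) _ _ iF (iC _)).
have -> : K * h ^+ 2 = \int[mu]_(y in `]theta, h + theta]) (K * h).
  by rewrite Ic expr2 mulrA.
apply: le_Rintegral => //.
  apply: (@integrable_norm _ _ R mu).
  by apply: (@integrableB _ _ _ mu _ (measurable_itv _) _ _ iF (iC _)).
move=> y; rewrite /= in_itv/= => /andP[ty yh].
pose df (x : R) := expR (- x) * ((alpha - 1) * x `^ (alpha - 2) - x `^ (alpha - 1)).
have D (x : R) : 0 < x -> is_derive x 1 f (df x).
  move=> x0; have := is_derive1_powR (alpha - 1) x0 => D; rewrite /f; apply: is_derive_eq.
  by rewrite /df /GRing.scale/= (_ : alpha - 1 - 1 = alpha - 2); [ring|lra].
have [c|c|c] := @MVT_segment R f df theta y (ltW ty).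
  by rewrite in_itv/= => /andP[tc _]; apply: D; exact: lt_trans tc.
  apply: continuous_in_subspaceT => x; rewrite inE/= in_itv/= => /andP[tx _].
  exact: is_derive_continuous (D x (lt_le_trans theta_gt0 tx)).
rewrite in_itv/= => /andP[tc cy] ->.
rewrite normrM ler_pM//; last by rewrite ger0_norm; lra.
rewrite /df normrM gtr0_norm ?expR_gt0//.
have c0 : 0 < c by exact: lt_le_trans tc.
apply: (@le_trans _ _ `|(alpha - 1) * c `^ (alpha - 2) - c `^ (alpha - 1)|).
  rewrite ler_piMl// -[leRHS]expR0 ler_expR oppr_le0; exact: ltW.
apply: le_trans (ler_normB _ _) _; rewrite /K addrC; apply: lerD.
  by rewrite ger0_norm ?powR_ge0// npos_ler_powR// subr_le0.
rewrite normrM (ger0_norm (powR_ge0 _ _)).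
apply: (@le_trans _ _ (c `^ (alpha - 2))).
  rewrite ler_piMl ?powR_ge0// ler0_norm ?subr_le0// opprB.
  by rewrite gerBl ltW.
by apply: npos_ler_powR => //; rewrite subr_le0 (le_trans alpha_le1)// ler1n.
Qed.

End tempered_incomplete_gamma.

(** It serves at two precisions: for Y the error K may be taken arbitrarily small, while for S a
    fixed K replaces the second-order coefficient. *)
Lemma levy_moments d (T : measurableType d) (R : realType) (P : probability T R)
    (X : R -> T -> R) (zeta : R -> R) (a b K delta t : R) :
  is_levy P X -> laplace_exponent P X zeta -> 0 <= K -> 0 < delta ->
  (forall h, 0 < h < delta -> `|zeta h - a * h - b * h ^+ 2| <= K * h ^+ 2) ->
  0 <= t ->
  [/\ integrable_rv P (fun w => X t w ^+ 2), \int[P]_w X t w = t * a &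
      `|\int[P]_w (X t w ^+ 2) - ((t * a) ^+ 2 - 2 * (t * b))| <= 6 * (t * K)].
Proof.
move=> LX EX K0 d0 zh t0.
apply: (@laplace_moments _ _ _ _ _ (fun h => t * zeta h) _ _ _ delta) => //.
- exact: levy_measurable LX _ t0.
- by move=> h h0; exact: EX.
- exact: mulr_ge0.
- move=> h hd; have -> : t * zeta h - t * a * h - t * b * h ^+ 2 = t * (zeta h - a * h - b * h ^+ 2) by ring.
  by rewrite normrM ger0_norm// -mulrA ler_wpM2l// zh.
Qed.

(** * Composition with an independent random time *)

Section subordination.
Context {d} {T : measurableType d} {R : realType} (P : probability T R).
Variables (Y : R -> T -> R) (sigma : T -> R).
Hypothesis mY : forall s : R, 0 <= s -> measurable_fun setT (Y s).
Hypothesis cadlagY : {ae P, forall w, cadlag (fun s => Y s w)}.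
Hypothesis msigma : measurable_fun setT sigma.
Hypothesis sigma_ge0 : forall w, 0 <= sigma w.
Hypothesis isigma2 : integrable_rv P (fun w => sigma w ^+ 2).
Hypothesis indep : forall (s : R) (A B : set R), 0 <= s -> measurable A -> measurable B ->
  P (Y s @^-1` A `&` sigma @^-1` B) = (P (Y s @^-1` A) * P (sigma @^-1` B))%E.

(* The time [sigma] rounded up to the grid of mesh [1 / (n + 1)]; the strict
   inequality [sigma < grid n] is what right-continuity of the paths needs. *)
Let cell n w := Num.truncn (n.+1%:R * sigma w).
Let node n k : R := k.+1%:R / n.+1%:R.
Let grid n w := node n (cell n w).

Let cellE n k w : (cell n w = k) <-> (k%:R / n.+1%:R <= sigma w < k.+1%:R / n.+1%:R).
Proof.
have n0 : 0 < n.+1%:R :> R by [].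
rewrite ler_pdivrMr// ltr_pdivlMr// mulrC /cell; split => [<-|].
  by apply: truncn_itv; rewrite mulr_ge0.
by move=> /truncn_def.
Qed.

Let node_ge0 n k : 0 <= node n k.
Proof. by rewrite divr_ge0. Qed.

Let grid_gt n w : sigma w < grid n w.
Proof. by have /(cellE n _ w) /andP[] := erefl (cell n w). Qed.

Let grid_le n w : grid n w <= sigma w + n.+1%:R^-1.
Proof.
have /(cellE n _ w) /andP[h _] := erefl (cell n w).
by rewrite /grid /node -natr1 mulrDl mul1r lerD2r.
Qed.

Let mcell n k : measurable [set w | cell n w = k].
Proof.
have -> : [set w | cell n w = k] = setT `&` sigma @^-1` `[k%:R / n.+1%:R, k.+1%:R / n.+1%:R[.
  apply/seteqP; split => w /=; rewrite in_itv/=; first by move/cellE.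
  by case=> _ /cellE.
exact: msigma.
Qed.

Let bigcup_cell n : \bigcup_k [set w | cell n w = k] = setT.
Proof. by apply/seteqP; split => // w _; exists (cell n w). Qed.

Let measurable_fun_cell n (F : nat -> T -> R) : (forall k, measurable_fun setT (F k)) ->
  measurable_fun setT (fun w => F (cell n w) w).
Proof.
move=> mF; rewrite -(bigcup_cell n); apply/measurable_fun_bigcup => // k.
apply: (@eq_measurable_fun _ _ _ _ _ (F k)); last exact: measurable_funTS.
by move=> w; rewrite inE/= => ->.
Qed.

Let mgrid n : measurable_fun setT (grid n).
Proof. by apply: (@measurable_fun_cell n (fun k w => node n k)). Qed.

Let mYgrid n : measurable_fun setT (fun w => Y (grid n w) w).
Proof. by apply: (@measurable_fun_cell n (fun k w => Y (node n k) w)) => k; exact: mY. Qed.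

(** On a cell the rounded time is a constant node, and the cell is an event of sigma, so by
    independence its contribution is the mean at that fixed time multiplied by the probability of
    the cell. Summation over the cells carries the fixed-time bound over to the random time. *)
Let le_grid n (f g : R -> R) : measurable_fun setT f -> measurable_fun setT g ->
  (forall y, 0 <= f y) -> (forall s : R, 0 <= s -> 0 <= g s) ->
  (forall s : R, 0 <= s -> (\int[P]_w (f (Y s w))%:E <= (g s)%:E)%E) ->
  (\int[P]_w (f (Y (grid n w) w))%:E <= \int[P]_w (g (grid n w))%:E)%E.
Proof.
move=> mf mg f0 g0 fg.
have tr : trivIset setT (fun k => [set w | cell n w = k]).
  by apply/trivIsetP => i j _ _ ij; apply/seteqP; split => // w /= [-> /eqP]; rewrite (negPf ij).
rewrite -(bigcup_cell n) !ge0_integral_bigcup//; last 4 first.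
- rewrite bigcup_cell; apply/measurable_EFinP; exact: (measurableT_comp mg (mgrid n)).
- by move=> w _; rewrite lee_fin; apply: g0; exact: node_ge0.
- rewrite bigcup_cell; apply/measurable_EFinP; exact: (measurableT_comp mf (mYgrid n)).
- by move=> w _; rewrite lee_fin.
apply: lee_nneseries => [k _ _|k _]; first by apply: integral_ge0 => w _; rewrite lee_fin.
pose B := `[k%:R / n.+1%:R, k.+1%:R / n.+1%:R[%classic : set R.
have EB : [set w | cell n w = k] = sigma @^-1` B.
  by apply/seteqP; split => w /=; rewrite /B/= in_itv/= => /cellE.
have mfk : measurable_fun setT (fun w => f (Y (node n k) w)) by apply: measurableT_comp => //; exact: mY.
apply: (@le_trans _ _ ((g (node n k))%:E * P [set w | cell n w = k])%E); last first.
  rewrite -integral_cst// le_eqVlt; apply/orP; left; apply/eqP.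
  by apply: eq_integral => w; rewrite inE/= /grid => ->.
have -> : (\int[P]_(w in [set w | cell n w = k]) (f (Y (grid n w) w))%:E =
   \int[P]_w (f (Y (node n k) w) * \1_B (sigma w))%:E)%E.
  rewrite integral_mkcond; apply: eq_integral => w _; rewrite patchE indicE.
  case: ifPn => [|wk].
    rewrite inE/= => wk; rewrite /grid wk mem_set ?mulr1//.
    by move: wk; rewrite -[cell n w = k]/([set w | cell n w = k] w) EB.
  rewrite memNset ?mulr0// => Bw; move: wk; rewrite notin_setE/=; apply.
  by rewrite -[cell n w = k]/([set w | cell n w = k] w) EB.
rewrite (@ge0_integral_indepM _ _ _ P (Y (node n k)) sigma (mY (node_ge0 _ _)) msigma _ f (\1_B))//; last 2 first.
- by move=> A C mA mC; exact: indep.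
- by apply: measurable_indic; exact: measurable_itv.
have -> : (\int[P]_w (\1_B (sigma w))%:E = P [set w | cell n w = k])%E.
  by rewrite EB -[X in _ = P X]setIT -(integral_indic P measurableT)//; rewrite -EB.
by apply: lee_pmul => //; [apply: integral_ge0 => w _; rewrite lee_fin|exact: fg].
Qed.

Let ler_grid_sub n w (r : R) : (grid n w - r) ^+ 2 <= 4 * sigma w ^+ 2 + 4 + 2 * r ^+ 2.
Proof.
have n1 : n.+1%:R^-1 <= 1 :> R by rewrite invf_le1// ler1n.
have g1 : grid n w <= sigma w + 1 by apply: le_trans (grid_le n w) _; rewrite lerD2l.
have := sigma_ge0 w; have := grid_gt n w; move: g1.
move: (grid n w) (sigma w) => x y xy yx y0.
have x2 : x ^+ 2 <= (y + 1) ^+ 2 by rewrite lerXn2r// nnegrE; lra.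
have := sqr_ge0 (x + r); have := sqr_ge0 (y - 1); nra.
Qed.

Let cvg_grid w : grid n w @[n --> \oo] --> sigma w.
Proof.
apply: (@squeeze_cvgr _ _ _ _ (fun=> sigma w) (fun n => sigma w + n.+1%:R^-1)).
- by near=> n; rewrite (ltW (grid_gt n w)) grid_le.
- exact: cvg_cst.
- by rewrite -[X in _ --> X]addr0; apply: cvgD; [exact: cvg_cst|exact: cvg_harmonic].
Unshelve. all: by end_near. Qed.

(* Only almost all paths are cadlag and [P] need not be complete, so that
   [w |-> Y (sigma w) w] is merely almost everywhere equal to a measurable
   function. *)
Lemma subordinate_version : exists Q : T -> R,
  [/\ measurable_fun setT Q, {ae P, forall w, Y (sigma w) w = Q w} &
    forall (f : R -> R) (a b r e : R), continuous f -> (forall y, 0 <= f y) ->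
      0 <= a -> 0 <= b -> 0 <= e ->
      (forall s : R, 0 <= s ->
        (\int[P]_w (f (Y s w))%:E <= (a + b * (s - r) ^+ 2 + e * s)%:E)%E) ->
      (\int[P]_w (f (Q w))%:E <=
        (a + b * \int[P]_w ((sigma w - r) ^+ 2) + e * \int[P]_w sigma w)%:E)%E].
Proof.
have [N [mN N0 cN]] := cadlagY.
have mNC := measurableC mN.
have cNC w : ~ N w -> cadlag (fun s => Y s w).
  by move=> Nw; apply: contrapT => h; apply: Nw; exact: cN.
(* With the cut-off on the null set, [Q_] converges to [Q] at every point, and measurability passes
   to the limit. *)
pose Q w := Y (sigma w) w * \1_(~` N) w.
pose Q_ n w := Y (grid n w) w * \1_(~` N) w.
have mI : measurable_fun setT (\1_(~` N) : T -> R) by exact: measurable_indic.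
have mQ_ n : measurable_fun setT (Q_ n) by apply: measurable_funM.
have QQ w : Q_ n w @[n --> \oo] --> Q w.
  rewrite /Q /Q_ indicE; have [wN|wN] := boolP (w \in ~` N); last first.
    rewrite mulr0; under eq_fun do rewrite mulr0; exact: cvg_cst.
  rewrite mulr1; under eq_fun do rewrite mulr1.
  have [rc _] : cadlag (fun s => Y s w) by apply: cNC; move: wN; rewrite inE.
  by have /cvg_at_rightP := rc _ (sigma_ge0 w); apply.
have mQ : measurable_fun setT Q by apply: (measurable_fun_cvg mQ_) => w _; exact: QQ.
exists Q; split => //.
  exists N; split => // w /= wQ; apply: contrapT => wN; apply: wQ.
  by rewrite /Q indicE mem_set// mulr1.
move=> f a b r e cf f0 a0 b0 e0 fg.
have mf : measurable_fun setT f by exact: continuous_measurable_fun.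
pose g (s : R) := a + b * (s - r) ^+ 2 + e * s.
have mg : measurable_fun setT g.
  by apply: continuous_measurable_fun => s; apply: is_derive_continuous.
have is1 := integrable_rv_sqr msigma isigma2.
have isr : integrable_rv P (fun w => (sigma w - r) ^+ 2).
  have -> : (fun w => (sigma w - r) ^+ 2) = (fun w => sigma w ^+ 2 + ((- (2 * r)) * sigma w + r ^+ 2)).
    by apply/funext => w; ring.
  apply: integrable_rvD => //; apply: integrable_rvD; last exact: integrable_rv_cst.
  exact: integrable_rvZ.
pose G w := a + b * (4 * sigma w ^+ 2 + 4 + 2 * r ^+ 2) + e * (sigma w + 1).
have iG : integrable_rv P G.
  apply: integrable_rvD; last by apply: integrable_rvZ; apply: integrable_rvD => //; exact: integrable_rv_cst.
  apply: integrable_rvD; first exact: integrable_rv_cst.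
  apply: integrable_rvZ; apply: integrable_rvD; last exact: integrable_rv_cst.
  by apply: integrable_rvD; [exact: integrable_rvZ|exact: integrable_rv_cst].
have g0 s : 0 <= s -> 0 <= g s.
  by move=> s0; rewrite /g !addr_ge0// mulr_ge0// sqr_ge0.
have gG n w : `|g (grid n w)| <= G w.
  rewrite ger0_norm ?g0 ?node_ge0// /g /G; apply: lerD.
    by rewrite lerD2l ler_wpM2l// ler_grid_sub.
  rewrite ler_wpM2l//; apply: le_trans (grid_le n w) _.
  by rewrite lerD2l invf_le1// ler1n.
have [_ cg] : P.-integrable setT (EFin \o (fun w => g (sigma w))) /\
    \int[P]_w g (grid n w) @[n --> \oo] --> \int[P]_w g (sigma w).
  apply: (@Rintegral_dominated_cvg _ _ _ P setT measurableT (fun n w => g (grid n w)) (fun w => g (sigma w)) G) => //.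
  - by move=> n; exact: measurableT_comp.
  - move=> w _; apply: continuous_cvg; last exact: cvg_grid.
    by apply: is_derive_continuous.
have <- : \int[P]_w g (sigma w) = a + b * \int[P]_w ((sigma w - r) ^+ 2) + e * \int[P]_w sigma w.
  rewrite /g !RintegralD//; last 4 first.
  - exact: integrable_rv_cst.
  - exact: integrable_rvZ.
  - by apply: integrable_rvD; [exact: integrable_rv_cst|exact: integrable_rvZ].
  - exact: integrable_rvZ.
  by rewrite Rintegral_rv_cst !RintegralZl.
apply: (@fatou_cvg _ _ _ P (fun n w => f (Q_ n w)) _ (fun n => \int[P]_w g (grid n w))) => //.
- by move=> n; exact: measurableT_comp.
- by move=> w; apply: continuous_cvg; [exact: cf|exact: QQ].
- move=> n; rewrite (@ge0_ae_eq_integral_sup _ _ _ P _ (fun w => (f (Y (grid n w) w))%:E)).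
  + rewrite EFin_Rintegral_rv; first exact: le_grid.
    by apply: le_integrable_rv iG _ => //; exact: measurableT_comp.
  + by move=> w; rewrite lee_fin.
  + by move=> w; rewrite lee_fin.
  + exists N; split => // w /= wQ; apply: contrapT => wN; apply: wQ.
    by rewrite /Q_ indicE mem_set// mulr1.
Qed.

End subordination.

Section taylor_bounds.
Context {R : realType}.

Lemma ler_norm_one_sub_cosB (x : R) : `|1 - cos x - x ^+ 2 / 2| <= `|x| ^+ 3.
Proof.
have D (z : R) : is_derive z 1 (fun x : R => 1 - cos x - x ^+ 2 / 2) (sin z - z).
  by apply: is_derive_eq; rewrite /GRing.scale/= -mulr_natr; field.
have [c] := MVT_from 0 x D; rewrite cos0 subrr [0 ^+ 2]expr2 !mul0r !subr0 => cx ->.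
rewrite normrM exprSr ler_wpM2r//; apply: le_trans (ler_norm_sinB _) _.
by rewrite -(real_normK (num_real c)) lerXn2r ?nnegrE.
Qed.

Lemma ler_norm_sinB3 (x : R) : `|sin x - x| <= `|x| ^+ 3.
Proof.
have D (z : R) : is_derive z 1 (fun x : R => sin x - x) (cos z - 1).
  by apply: is_derive_eq.
have [c] := MVT_from 0 x D; rewrite sin0 !subr0 => cx ->.
rewrite normrM exprSr ler_wpM2r// distrC ger0_norm ?subr_ge0 ?cos_le1//.
apply: le_trans (one_sub_cos_le _) _; rewrite ler_pdivrMr//.
apply: (@le_trans _ _ (`|x| ^+ 2)).
  by rewrite -(real_normK (num_real c)) lerXn2r ?nnegrE.
by rewrite ler_peMr ?sqr_ge0// ler1n.
Qed.

End taylor_bounds.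

(** * Characteristic functions of a centred process *)

Section levy_process.
Context {d} {T : measurableType d} {R : realType} (P : probability T R).
Variables (Y : R -> T -> R) (psi : R -> R) (dd : nat -> R).
Hypothesis Y_levy : is_levy P Y.
Hypothesis Y_laplace : laplace_exponent P Y psi.
Hypothesis psi_series : forall eta : R, 0 < eta ->
  (\sum_(1 <= k < n) dd k * eta ^+ k) @[n --> \oo] --> psi eta.

Let mY (t : R) : 0 <= t -> measurable_fun setT (Y t).
Proof. exact: levy_measurable Y_levy t. Qed.

(** The cubic remainder B h^3 is below K h^2 for h small, for any K > 0; letting K tend to 0 turns
    the moment estimate into an equality. *)
Lemma levy_series_moments (t : R) : 0 <= t ->
  [/\ integrable_rv P (fun w => Y t w ^+ 2), \int[P]_w Y t w = t * dd 1%N &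
      \int[P]_w (Y t w ^+ 2) = (t * dd 1%N) ^+ 2 - 2 * (t * dd 2%N)].
Proof.
move=> t0; have [B B0 HB] := power_series_remainder psi_series (isT : (1 <= 3)%N).
have H K : 0 < K -> [/\ integrable_rv P (fun w => Y t w ^+ 2), \int[P]_w Y t w = t * dd 1%N &
      `|\int[P]_w (Y t w ^+ 2) - ((t * dd 1%N) ^+ 2 - 2 * (t * dd 2%N))| <= 6 * (t * K)].
  move=> K0; apply: (@levy_moments _ _ _ _ _ _ _ _ _ (Num.min 2^-1 (K / (1 + B)))) Y_levy Y_laplace _ _ _ t0.
  - exact: ltW.
  - by rewrite lt_min invr_gt0 ltr0n/= divr_gt0// ltr_wpDr.
  - move=> h; rewrite lt_min => /and3P[h0 h1 h2].
    have /HB : 0 < h < 2^-1 by rewrite h0.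
    rewrite big_nat_recr//= big_nat1 expr1 opprD addrA => /le_trans; apply.
    rewrite exprS mulrA ler_wpM2r ?sqr_ge0//.
    move: h2; rewrite ltr_pdivlMr; last by rewrite ltr_wpDr.
    nra.
have [i1 E1 _] := H 1 ltr01; split => //.
apply/eqP; rewrite -subr_eq0 -normr_le0; apply/ler_addgt0Pr => e e0; rewrite add0r.
pose K := e / (6 * (1 + t)).
have K0 : 0 < K by rewrite divr_gt0// mulr_gt0// ltr_wpDr.
have [_ _ /le_trans] := H K K0; apply.
have -> : e = 6 * ((1 + t) * K) by rewrite /K; field; rewrite gt_eqF// ltr_wpDr.
by rewrite ler_wpM2l// ler_wpM2r ?(ltW K0)// lerDr.
Qed.

Lemma levy_var_ge0 : 0 <= - (2 * dd 2%N).
Proof.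
have [i2 E1 E2] := levy_series_moments ler01.
have i1 := integrable_rv_sqr (mY ler01) i2.
have : 0 <= \int[P]_w ((Y 1 w - dd 1%N) ^+ 2) by apply: Rintegral_ge0 => w _; exact: sqr_ge0.
have -> : \int[P]_w ((Y 1 w - dd 1%N) ^+ 2) =
    \int[P]_w (Y 1 w ^+ 2 + ((- (2 * dd 1%N)) * Y 1 w + dd 1%N ^+ 2)).
  by apply: eq_Rintegral => w _; ring.
have ic := integrable_rv_cst P (dd 1%N ^+ 2).
have iz := integrable_rvZ (- (2 * dd 1%N)) i1.
rewrite RintegralD//; last exact: integrable_rvD.
rewrite RintegralD// RintegralZl// Rintegral_rv_cst E1 E2 !mul1r.
lra.
Qed.

Lemma levy_centered_sqr (s q : R) : 0 <= s ->
  (\int[P]_w ((Y s w - q) ^+ 2)%:E =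
   ((s * dd 1%N - q) ^+ 2 + (- (2 * dd 2%N)) * s)%:E)%E.
Proof.
move=> s0; have [i2 E1 E2] := levy_series_moments s0.
have i1 := integrable_rv_sqr (mY s0) i2.
have ic := integrable_rv_cst P (q ^+ 2).
have iz := integrable_rvZ (- (2 * q)) i1.
have id := integrable_rvD i2 (integrable_rvD iz ic).
have -> : (fun w => ((Y s w - q) ^+ 2)%:E) = (fun w => (Y s w ^+ 2 + (- (2 * q) * Y s w + q ^+ 2))%:E).
  by apply/funext => w; congr EFin; ring.
rewrite -EFin_Rintegral_rv//; congr EFin.
rewrite RintegralD//; last exact: integrable_rvD.
rewrite RintegralD// RintegralZl// Rintegral_rv_cst E1 E2.
ring.
Qed.

Lemma ge0_eq_law_integral (X Z : T -> R) (f : R -> R) :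
  measurable_fun setT X -> measurable_fun setT Z ->
  (forall A : set R, measurable A -> P (X @^-1` A) = P (Z @^-1` A)) ->
  measurable_fun setT f -> (forall y, 0 <= f y) ->
  (\int[P]_w (f (X w))%:E = \int[P]_w (f (Z w))%:E)%E.
Proof.
move=> mX mZ XZ mf f0.
pose X' : {RV P >-> R} := mfun_Sub (mem_set mX).
pose Z' : {RV P >-> R} := mfun_Sub (mem_set mZ).
have mf' : measurable_fun setT (EFin \o f) by exact/measurable_EFinP.
have f0' y : (0 <= (EFin \o f) y)%E by rewrite lee_fin.
transitivity (\int[distribution P X']_y (EFin \o f) y)%E.
  by rewrite ge0_integral_distribution.
transitivity (\int[distribution P Z']_y (EFin \o f) y)%E; last first.
  by rewrite ge0_integral_distribution.
by apply: eq_measure_integral => A mA _; exact: XZ.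
Qed.

Lemma bounded_integrable_rv (X : T -> R) (f : R -> R) :
  measurable_fun setT X -> measurable_fun setT f -> (forall y, `|f y| <= 1) ->
  integrable_rv P (fun w => f (X w)).
Proof.
move=> mX mf f1; apply: le_integrable_rv (integrable_rv_cst P 1) _ => //.
exact: measurableT_comp.
Qed.

Lemma eq_law_Rintegral (X Z : T -> R) (f : R -> R) :
  measurable_fun setT X -> measurable_fun setT Z ->
  (forall A : set R, measurable A -> P (X @^-1` A) = P (Z @^-1` A)) ->
  measurable_fun setT f -> (forall y, `|f y| <= 1) ->
  \int[P]_w f (X w) = \int[P]_w f (Z w).
Proof.
move=> mX mZ XZ mf f1.
have f0 y : 0 <= 1 + f y by have := f1 y; rewrite ler_norml => /andP[]; lra.
have mf' : measurable_fun setT (fun y => 1 + f y) by exact: measurable_funD.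
have E := ge0_eq_law_integral mX mZ XZ mf' f0.
have ic := integrable_rv_cst P 1.
have iX := bounded_integrable_rv mX mf f1.
have iZ := bounded_integrable_rv mZ mf f1.
have : \int[P]_w (1 + f (X w)) = \int[P]_w (1 + f (Z w)) by rewrite /Rintegral E.
by rewrite !RintegralD//; exact: addrI.
Qed.

Lemma levy_increment_law (s h : R) (f : R -> R) : 0 <= s -> 0 <= h ->
  measurable_fun setT f -> (forall y, `|f y| <= 1) ->
  \int[P]_w f (Y (s + h) w - Y s w) = \int[P]_w f (Y h w).
Proof.
move=> s0 h0; have sh0 := addr_ge0 s0 h0.
apply: eq_law_Rintegral; [by apply: measurable_funB; exact: mY|exact: mY|].
exact: (levy_stationary_increments Y_levy).
Qed.

Lemma levy_increment_sqr (s r : R) : 0 <= s -> 0 <= r -> dd 1%N = 0 ->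
  (\int[P]_w ((Y s w - Y r w) ^+ 2)%:E = (- (2 * dd 2%N) * `|s - r|)%:E)%E.
Proof.
move=> s0 r0 d0.
have H (x y : R) : 0 <= x -> x <= y ->
   (\int[P]_w ((Y y w - Y x w) ^+ 2)%:E = (- (2 * dd 2%N) * (y - x))%:E)%E.
  move=> x0 xy; have h0 : 0 <= y - x by rewrite subr_ge0.
  have y0 := le_trans x0 xy.
  rewrite (@ge0_eq_law_integral (fun w => Y y w - Y x w) (Y (y - x)) (fun z => z ^+ 2)).
  - have := levy_centered_sqr 0 h0; rewrite d0 mulr0 subrr expr2 mulr0 add0r => <-.
    by apply: eq_integral => w _; rewrite subr0.
  - by apply: measurable_funB; exact: mY.
  - exact: mY.
  - have := levy_stationary_increments Y_levy x0 h0.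
    by rewrite addrC subrK.
  - exact: measurable_funX.
  - by move=> z; exact: sqr_ge0.
have [sr|rs] := leP s r.
  rewrite distrC ger0_norm ?subr_ge0// -H//.
  by apply: eq_integral => w _; congr EFin; ring.
by rewrite gtr0_norm ?subr_gt0// -H// ltW.
Qed.

(** The difference is at most v |Y_s - Y_r|, and Young's inequality |z| <= eps/2 + z^2 / (2 eps)
    bounds its mean through that of the squared increment, which is linear in |s - r|. The summand 1
    keeps the integrand nonnegative, as the transfer to a random time requires. *)
Lemma levy_lipschitz (g : R -> R) (v s r eps : R) : dd 1%N = 0 ->
  continuous g -> (forall y, `|g y| <= 1) -> (forall x y, `|g x - g y| <= `|x - y|) ->
  0 <= v -> 0 <= s -> 0 <= r -> 0 < eps ->
  (\int[P]_w (1 + g (v * Y s w))%:E <=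
   (1 + \int[P]_w g (v * Y r w)
    + v * (eps / 2 + - (2 * dd 2%N) * `|s - r| / (2 * eps)))%:E)%E.
Proof.
move=> d0 cg g1 gl v0 s0 r0 e0.
have mg : measurable_fun setT g by exact: continuous_measurable_fun.
have mgY t : 0 <= t -> measurable_fun setT (fun w => g (v * Y t w)).
  by move=> t0; apply: measurableT_comp => //; apply: measurable_funM => //; exact: mY.
have g0 t : 0 <= 1 + g t by have := g1 t; rewrite ler_norml => /andP[]; lra.
have ic c := integrable_rv_cst P c.
have ir : integrable_rv P (fun w => g (v * Y r w)).
  by apply: le_integrable_rv (ic 1) _ => //; exact: mgY.
have is_ : integrable_rv P (fun w => g (v * Y s w)).
  by apply: le_integrable_rv (ic 1) _ => //; exact: mgY.
have := levy_increment_sqr s0 r0 d0 => E2.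
have iD : integrable_rv P (fun w => (Y s w - Y r w) ^+ 2).
  apply: (@ge0_integrable_rv _ _ _ _ _ (- (2 * dd 2%N) * `|s - r|)).
  - by apply: measurable_funX; apply: measurable_funB; exact: mY.
  - by move=> w; exact: sqr_ge0.
  - by rewrite E2.
have i2 := integrable_rvZ (v / (2 * eps)) iD.
have -> : 1 + \int[P]_w g (v * Y r w) + v * (eps / 2 + - (2 * dd 2%N) * `|s - r| / (2 * eps)) =
  \int[P]_w (1 + (g (v * Y r w) + (v * (eps / 2) + (v / (2 * eps)) * (Y s w - Y r w) ^+ 2))).
  have E3 : \int[P]_w ((Y s w - Y r w) ^+ 2) = - (2 * dd 2%N) * `|s - r| by rewrite /Rintegral E2.
  have i3 := integrable_rvD (ic (v * (eps / 2))) i2.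
  rewrite (RintegralD measurableT (ic 1) (integrable_rvD ir i3)).
  rewrite (RintegralD measurableT ir i3) (RintegralD measurableT (ic (v * (eps / 2))) i2).
  rewrite (RintegralZl _ measurableT iD) !Rintegral_rv_cst E3.
  by field; rewrite gt_eqF.
rewrite EFin_Rintegral_rv; last by do 3 apply: integrable_rvD => //.
apply: ge0_le_integral => //.
- by move=> w _; rewrite lee_fin.
- by apply/measurable_EFinP; apply: measurable_funD => //; exact: mgY.
- by apply/measurable_EFinP; apply: (@integrable_rv_measurable _ _ _ P); do 3 apply: integrable_rvD => //.
move=> w _; rewrite lee_fin lerD2l.
have h1 : g (v * Y s w) - g (v * Y r w) <= v * `|Y s w - Y r w|.
  apply: le_trans (ler_norm _) _; apply: le_trans (gl _ _) _.
  by rewrite -mulrBr normrM (ger0_norm v0).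
have h2 : `|Y s w - Y r w| <= eps / 2 + (Y s w - Y r w) ^+ 2 / (2 * eps).
  rewrite -(real_normK (num_real (Y s w - Y r w))); set z := `|_|.
  rewrite -subr_ge0.
  have -> : eps / 2 + z ^+ 2 / (2 * eps) - z = (eps - z) ^+ 2 / (2 * eps).
    by field; rewrite gt_eqF.
  by rewrite divr_ge0 ?sqr_ge0// mulr_ge0// ltW.
have := ler_wpM2l v0 h2.
have -> : v * (eps / 2 + (Y s w - Y r w) ^+ 2 / (2 * eps)) = v * (eps / 2) + v / (2 * eps) * (Y s w - Y r w) ^+ 2.
  by field; rewrite gt_eqF.
lra.
Qed.

Definition char_cos (s v : R) : R := \int[P]_w cos (v * Y s w).
Definition char_sin (s v : R) : R := \int[P]_w sin (v * Y s w).

Let mcosM (v : R) : measurable_fun setT (fun y : R => cos (v * y)).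
Proof. by apply: continuous_measurable_fun => y; apply: is_derive_continuous. Qed.

Let msinM (v : R) : measurable_fun setT (fun y : R => sin (v * y)).
Proof. by apply: continuous_measurable_fun => y; apply: is_derive_continuous. Qed.

Let le1_Rintegral (X : T -> R) : measurable_fun setT X -> (forall w, `|X w| <= 1) ->
  `|\int[P]_w X w| <= 1.
Proof.
move=> mX X1; have ic := integrable_rv_cst P 1.
have iX : integrable_rv P X by apply: le_integrable_rv ic _.
apply: le_trans (le_normr_Rintegral _ _) _ => //.
rewrite -[leRHS](Rintegral_rv_cst P 1); apply: le_Rintegral => //.
exact: (integrable_norm iX).
Qed.

Lemma char_cos_le1 s v : 0 <= s -> `|char_cos s v| <= 1.
Proof.
move=> s0; apply: le1_Rintegral; first exact: (measurableT_comp (mcosM v) (mY s0)).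
by move=> w; exact: cos_max.
Qed.

Lemma char_sin_le1 s v : 0 <= s -> `|char_sin s v| <= 1.
Proof.
move=> s0; apply: le1_Rintegral; first exact: (measurableT_comp (msinM v) (mY s0)).
by move=> w; exact: sin_max.
Qed.

Lemma levy_indep2 (s h : R) (A B : set R) : 0 < s -> 0 < h -> measurable A -> measurable B ->
  P ((fun w => Y s w - Y 0 w) @^-1` A `&` (fun w => Y (s + h) w - Y s w) @^-1` B) =
  (P ((fun w => (Y s w - Y 0 w)%R) @^-1` A) * P ((fun w => (Y (s + h) w - Y s w)%R) @^-1` B))%E.
Proof.
move=> s0 h0 mA mB.
pose t (i : nat) : R := if i is 0%N then 0 else if i is 1%N then s else s + h.
have tI i : (i < 2)%N -> t i < t i.+1.
  by case: i => [|[|//]] _; rewrite /t ?ltrDl.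
have := levy_indep_increments Y_levy (lexx 0 : 0 <= t 0%N) tI.
move=> /(_ (fun i : 'I_2 => if val i is 0%N then A else B)) H.
rewrite big_ord_recr big_ord1/= in H; rewrite -H; last by case=> -[|i] hi.
congr (P _); apply/seteqP; split => w.
  by move=> [wA wB] [[|[|//]] hi] _.
by move=> wAB; split; [exact: (wAB ord0 I)|exact: (wAB ord_max I)].
Qed.

(** Real and imaginary parts of the multiplicativity of the characteristic function. Since Y_0
    vanishes only almost surely, the proof works with Y_s - Y_0, whose law is that of Y_s by
    stationarity. *)
Lemma char_add (s h v : R) : 0 < s -> 0 < h ->
  char_cos (s + h) v = char_cos s v * char_cos h v - char_sin s v * char_sin h v /\
  char_sin (s + h) v = char_sin s v * char_cos h v + char_cos s v * char_sin h v.
Proof.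
move=> s0 h0; have s0' := ltW s0; have h0' := ltW h0; have sh0 := addr_ge0 s0' h0'.
pose X w := Y s w - Y 0 w; pose Z w := Y (s + h) w - Y s w.
have mX : measurable_fun setT X by apply: measurable_funB; exact: mY.
have mZ : measurable_fun setT Z by apply: measurable_funB; exact: mY.
pose c (y : R) := cos (v * y); pose sn (y : R) := sin (v * y).
have c1 y : `|c y| <= 1 by exact: cos_max.
have s1 y : `|sn y| <= 1 by exact: sin_max.
have mc : measurable_fun setT c by exact: mcosM.
have ms : measurable_fun setT sn by exact: msinM.
have XE (f : R -> R) : measurable_fun setT f -> (forall y, `|f y| <= 1) ->
    \int[P]_w f (X w) = \int[P]_w f (Y s w).
  by move=> mf f1; rewrite -(levy_increment_law (lexx 0) s0' mf f1) add0r.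
have ZE (f : R -> R) : measurable_fun setT f -> (forall y, `|f y| <= 1) ->
    \int[P]_w f (Z w) = \int[P]_w f (Y h w).
  by move=> mf f1; rewrite -(levy_increment_law s0' h0' mf f1).
have XZE (f : R -> R) : measurable_fun setT f -> (forall y, `|f y| <= 1) ->
    \int[P]_w f (Y (s + h) w) = \int[P]_w f (X w + Z w).
  move=> mf f1; rewrite -(levy_increment_law (lexx 0) sh0 mf f1) add0r.
  by apply: eq_Rintegral => w _; congr f; rewrite /X /Z; ring.
have ind (f g : R -> R) : measurable_fun setT f -> measurable_fun setT g ->
    (forall y, `|f y| <= 1) -> (forall y, `|g y| <= 1) ->
    integrable_rv P (fun w => f (X w) * g (Z w)) /\
    \int[P]_w (f (X w) * g (Z w)) = \int[P]_w f (Y s w) * \int[P]_w g (Y h w).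
  move=> mf mg f1 g1; split.
    apply: le_integrable_rv (integrable_rv_cst P 1) _.
      by apply: measurable_funM; apply: measurableT_comp.
    by move=> w; rewrite normrM -[leRHS]mulr1 ler_pM.
  rewrite (@Rintegral_indepM _ _ _ P X Z mX mZ) ?XE ?ZE//.
  by move=> A B mA mB; exact: levy_indep2.
have [icc Ecc] := ind c c mc mc c1 c1; have [iss Ess] := ind sn sn ms ms s1 s1.
have [isc Esc] := ind sn c ms mc s1 c1; have [ics Ecs] := ind c sn mc ms c1 s1.
split.
  rewrite /char_cos (XZE c mc c1) -Ecc -Ess -RintegralB//.
  by apply: eq_Rintegral => w _; rewrite /c /sn mulrDr cosD.
rewrite /char_sin (XZE sn ms s1) -Esc -Ecs -RintegralD//.
by apply: eq_Rintegral => w _; rewrite /c /sn mulrDr sinD.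
Qed.

(** The telescoping bound |z^n - b^n| <= n |z - b| for points z, b of the unit disc, in real and
    imaginary parts. *)
Lemma char_nat_bound (v b : R) (n : nat) : 0 <= b <= 1 ->
  `|char_cos n.+1%:R v - b ^+ n.+1| <= n.+1%:R * (`|char_cos 1 v - b| + `|char_sin 1 v|) /\
  `|char_sin n.+1%:R v| <= n.+1%:R * `|char_sin 1 v|.
Proof.
move=> /andP[b0 b1]; elim: n => [|n [IHc IHs]].
  by rewrite mul1r expr1 lerDl normr_ge0 mul1r lexx.
have n0 : 0 < n.+1%:R :> R by [].
have := char_add v n0 ltr01; rewrite natr1 => -[-> ->].
have C1 := char_cos_le1 v (ltW n0); have S1 := char_sin_le1 v (ltW n0).
have c1 := char_cos_le1 v ler01; have s1 := char_sin_le1 v ler01.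
move: (char_cos n.+1%:R v) (char_sin n.+1%:R v) (char_cos 1 v) (char_sin 1 v) IHc IHs C1 S1 c1 s1.
move=> C S c s IHc IHs C1 S1 c1 s1; split.
  have -> : C * c - S * s - b ^+ n.+2 = C * (c - b) + ((C - b ^+ n.+1) * b + - (S * s)).
    by rewrite [b ^+ n.+2]exprSr; ring.
  apply: le_trans (ler_normD _ _) _.
  apply: le_trans (lerD (lexx _) (ler_normD _ _)) _.
  rewrite normrN !normrM -natr1 mulrDl mul1r (ger0_norm b0).
  have h1 : `|C| * `|c - b| <= `|c - b| by rewrite ler_piMl.
  have h2 : `|S| * `|s| <= `|s| by rewrite ler_piMl.
  have h3 : `|C - b ^+ n.+1| * b <= `|C - b ^+ n.+1| by rewrite ler_piMr.
  lra.
apply: le_trans (ler_normD _ _) _; rewrite !normrM -[n.+2%:R]natr1 mulrDl mul1r.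
have h1 : `|S| * `|c| <= `|S| by rewrite ler_piMr.
have h2 : `|C| * `|s| <= `|s| by rewrite ler_piMl.
lra.
Qed.

(** Second-order Taylor expansion under the integral: the cubic bounds give pointwise convergence,
    the quadratic ones domination by the square of Y_1. In the sine part the linear term v Y_1 may
    be subtracted first, as Y_1 has mean d_1 = 0. *)
Lemma cvg_char_small (v : nat -> R) : dd 1%N = 0 -> (forall k, 0 < v k) ->
  v k @[k --> \oo] --> 0 ->
  (1 - char_cos 1 (v k)) / v k ^+ 2 @[k --> \oo] --> - dd 2%N /\
  char_sin 1 (v k) / v k ^+ 2 @[k --> \oo] --> 0.
Proof.
move=> d0 v0 vc.
have [i2 E1 E2] := levy_series_moments ler01.
rewrite d0 mulr0 in E1; rewrite d0 mulr0 expr2 mulr0 sub0r mul1r in E2.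
have mY1 := mY ler01.
have i1 := integrable_rv_sqr mY1 i2.
have ic1 := integrable_rv_cst P 1.
have icos k := bounded_integrable_rv mY1 (mcosM (v k)) (fun y => cos_max (v k * y)).
have isin k := bounded_integrable_rv mY1 (msinM (v k)) (fun y => sin_max (v k * y)).
have v2 k : 0 < v k ^+ 2 by rewrite exprn_gt0.
have vx (x : R) : x * v k @[k --> \oo] --> 0.
  by rewrite -[X in _ --> X](mulr0 x); apply: cvgMr.
split.
- have [_] : P.-integrable setT (EFin \o (fun w => 2^-1 * Y 1 w ^+ 2)) /\
     \int[P]_w ((v k ^+ 2)^-1 * (1 - cos (v k * Y 1 w))) @[k --> \oo] --> \int[P]_w (2^-1 * Y 1 w ^+ 2).
    apply: (@Rintegral_dominated_cvg _ _ _ P setT measurableT (fun k w => (v k ^+ 2)^-1 * (1 - cos (v k * Y 1 w))) (fun w => 2^-1 * Y 1 w ^+ 2) (fun w => 2^-1 * Y 1 w ^+ 2)).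
    + move=> k; apply: measurable_funM => //; apply: measurable_funB => //.
      exact: (measurableT_comp (mcosM (v k)) mY1).
    + move=> w _; apply/subr_cvg0/norm_cvg0P.
      apply: (@squeeze_cvgr _ _ _ _ (fun=> 0) (fun k => `|Y 1 w| ^+ 3 * v k)); last 2 first.
      * exact: cvg_cst.
      * exact: vx.
      near=> k; rewrite normr_ge0/=.
      have -> : (v k ^+ 2)^-1 * (1 - cos (v k * Y 1 w)) - 2^-1 * Y 1 w ^+ 2 =
         ((1 - cos (v k * Y 1 w)) - (v k * Y 1 w) ^+ 2 / 2) / v k ^+ 2.
        by field; rewrite gt_eqF.
      rewrite normrM [`|_^-1|]gtr0_norm ?invr_gt0// ler_pdivrMr//.
      apply: le_trans (ler_norm_one_sub_cosB _) _.
      rewrite normrM (gtr0_norm (v0 k)).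
      by rewrite le_eqVlt; apply/orP; left; apply/eqP; ring.
    + exact: integrable_rvZ.
    + move=> k w _; rewrite ger0_norm; last first.
        by rewrite mulr_ge0 ?invr_ge0 ?(ltW (v2 k))// subr_ge0 cos_le1.
      rewrite mulrC ler_pdivrMr//; apply: le_trans (one_sub_cos_le _) _.
      by rewrite le_eqVlt; apply/orP; left; apply/eqP; ring.
  rewrite RintegralZl// E2.
  rewrite (_ : 2^-1 * - (2 * dd 2%N) = - dd 2%N); last by field.
  have Ek k : \int[P]_w ((v k ^+ 2)^-1 * (1 - cos (v k * Y 1 w))) = (1 - char_cos 1 (v k)) / v k ^+ 2.
    rewrite (RintegralZl _ measurableT (integrable_rvB ic1 (icos k))).
    by rewrite (RintegralB measurableT ic1 (icos k)) Rintegral_rv_cst mulrC.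
  by under eq_fun do rewrite Ek.
- have [_] : P.-integrable setT (EFin \o (fun w : T => 0)) /\
     \int[P]_w ((v k ^+ 2)^-1 * (sin (v k * Y 1 w) - v k * Y 1 w)) @[k --> \oo] --> \int[P]_w (0 : R).
    apply: (@Rintegral_dominated_cvg _ _ _ P setT measurableT (fun k w => (v k ^+ 2)^-1 * (sin (v k * Y 1 w) - v k * Y 1 w)) (fun w => 0) (fun w => Y 1 w ^+ 2)) => //.
    + move=> k; apply: measurable_funM => //; apply: measurable_funB; last exact: measurable_funM.
      exact: (measurableT_comp (msinM (v k)) mY1).
    + move=> w _; apply/norm_cvg0P.
      apply: (@squeeze_cvgr _ _ _ _ (fun=> 0) (fun k => `|Y 1 w| ^+ 3 * v k)); last 2 first.
      * exact: cvg_cst.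
      * exact: vx.
      near=> k; rewrite normr_ge0/=.
      rewrite normrM [`|_^-1|]gtr0_norm ?invr_gt0// mulrC ler_pdivrMr//.
      apply: le_trans (ler_norm_sinB3 _) _.
      rewrite normrM (gtr0_norm (v0 k)).
      by rewrite le_eqVlt; apply/orP; left; apply/eqP; ring.
    + move=> k w _; rewrite normrM [`|_^-1|]gtr0_norm ?invr_gt0// mulrC ler_pdivrMr//.
      apply: le_trans (ler_norm_sinB _) _.
      by rewrite le_eqVlt; apply/orP; left; apply/eqP; ring.
  rewrite Rintegral_rv_cst.
  have Ek k : \int[P]_w ((v k ^+ 2)^-1 * (sin (v k * Y 1 w) - v k * Y 1 w)) = char_sin 1 (v k) / v k ^+ 2.
    have iv := integrable_rvZ (v k) i1.
    rewrite (RintegralZl _ measurableT (integrable_rvB (isin k) iv)).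
    rewrite (RintegralB measurableT (isin k) iv) (RintegralZl _ measurableT i1) E1.
    by rewrite mulr0 subr0 mulrC.
  by under eq_fun do rewrite Ek.
Unshelve. all: by end_near. Qed.

(** The comparison value b = e^(d_2 v^2) is at most 1 and agrees with the characteristic function at
    time 1 up to o(v^2). After n steps the error is n v^2 o(1) = o(1), while b^n tends to e^(d_2
    L). *)
Lemma levy_clt (v : nat -> R) (n : nat -> nat) (L : R) : dd 1%N = 0 ->
  (forall k, 0 < v k) -> v k @[k --> \oo] --> 0 ->
  (n k).+1%:R * v k ^+ 2 @[k --> \oo] --> L ->
  char_cos (n k).+1%:R (v k) @[k --> \oo] --> expR (dd 2%N * L) /\
  char_sin (n k).+1%:R (v k) @[k --> \oo] --> 0.
Proof.
move=> d0 v0 vc nL; have [cc cs] := cvg_char_small d0 v0 vc.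
have d2 : 0 <= - dd 2%N by have := levy_var_ge0; lra.
have v2 k : 0 < v k ^+ 2 by rewrite exprn_gt0.
have v2c : v k ^+ 2 @[k --> \oo] --> 0.
  have -> : (fun k => v k ^+ 2) = (fun k => v k * v k) by apply/funext => k; rewrite expr2.
  by rewrite -[X in _ --> X](mulr0 0); apply: cvgM.
pose b k := expR (dd 2%N * v k ^+ 2).
have b01 k : 0 <= b k <= 1.
  by rewrite expR_ge0 -[leRHS]expR0 ler_expR mulr_le0_ge0 ?(ltW (v2 k))// -oppr_ge0.
have bc : (1 - b k) / v k ^+ 2 @[k --> \oo] --> - dd 2%N.
  have -> : (fun k => (1 - b k) / v k ^+ 2) = (fun k => exp_quot (v k ^+ 2) (- dd 2%N)).
    by apply/funext => k; rewrite /exp_quot /b mulrN opprK [_ * dd 2%N]mulrC.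
  exact: cvg_exp_quot.
have csN : `|char_sin 1 (v k)| / v k ^+ 2 @[k --> \oo] --> 0.
  have -> : (fun k => `|char_sin 1 (v k)| / v k ^+ 2) = (fun k => `|char_sin 1 (v k) / v k ^+ 2|).
    by apply/funext => k; rewrite normrM [`|_^-1|]gtr0_norm ?invr_gt0.
  by rewrite -[X in _ --> X](@normr0 R R); apply: cvg_norm.
have cbN : `|char_cos 1 (v k) - b k| / v k ^+ 2 @[k --> \oo] --> 0.
  have -> : (fun k => `|char_cos 1 (v k) - b k| / v k ^+ 2) =
     (fun k => `|(1 - b k) / v k ^+ 2 - (1 - char_cos 1 (v k)) / v k ^+ 2|).
    apply/funext => k; rewrite -mulrBl normrM [`|_^-1|]gtr0_norm ?invr_gt0//.
    by congr (`|_| / _); ring.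
  rewrite -[X in _ --> X](@normr0 R R); apply: cvg_norm.
  by rewrite -(subrr (- dd 2%N)); apply: cvgB.
have bn k : b k ^+ (n k).+1 = expR (dd 2%N * ((n k).+1%:R * v k ^+ 2)).
  by rewrite /b -expRM_natl; congr expR; ring.
split.
- have cb : expR (dd 2%N * ((n k).+1%:R * v k ^+ 2)) @[k --> \oo] --> expR (dd 2%N * L).
    by apply: continuous_cvg; [exact: continuous_expR|apply: cvgMr].
  rewrite -[X in _ --> X]addr0.
  have -> : (fun k => char_cos (n k).+1%:R (v k)) = (fun k => expR (dd 2%N * ((n k).+1%:R * v k ^+ 2)) + (char_cos (n k).+1%:R (v k) - b k ^+ (n k).+1)).
    by apply/funext => k; rewrite -bn; ring.
  apply: cvgD => //; apply/norm_cvg0P.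
  apply: (@squeeze_cvgr _ _ _ _ (fun=> 0) (fun k => ((n k).+1%:R * v k ^+ 2) * (`|char_cos 1 (v k) - b k| / v k ^+ 2 + `|char_sin 1 (v k)| / v k ^+ 2))).
  + near=> k; rewrite normr_ge0/=; have [+ _] := char_nat_bound (v k) (n k) (b01 k).
    move=> /le_trans; apply; rewrite le_eqVlt; apply/orP; left; apply/eqP.
    by field; rewrite gt_eqF.
  + exact: cvg_cst.
  + rewrite -[X in _ --> X](mulr0 L); apply: cvgM => //.
    by rewrite -[X in _ --> X](addr0 0); apply: cvgD.
- apply/norm_cvg0P.
  apply: (@squeeze_cvgr _ _ _ _ (fun=> 0) (fun k => ((n k).+1%:R * v k ^+ 2) * (`|char_sin 1 (v k)| / v k ^+ 2))).
  + near=> k; rewrite normr_ge0/=; have [_ +] := char_nat_bound (v k) (n k) (b01 k).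
    move=> /le_trans; apply; rewrite le_eqVlt; apply/orP; left; apply/eqP.
    by field; rewrite gt_eqF.
  + exact: cvg_cst.
  + by rewrite -[X in _ --> X](mulr0 L); apply: cvgM.
Unshelve. all: by end_near. Qed.

End levy_process.

(** * Fractional moments *)

Section fractional_fubini.
Context {d} {T : measurableType d} {R : realType} (P : probability T R).
Notation mu := (@lebesgue_measure R).
Variables (p : R) (Z : T -> R).
Hypotheses (p0 : 0 < p) (p1 : p < 1).
Hypotheses (mZ : measurable_fun setT Z) (iZ : integrable_rv P Z).

(** Both 1 - cos and sin are bounded by 2 and by |x|, so the double integrand is at most 2 (1 + |Z|)
    min(1, u) u^(-1-p), integrable for the product measure. *)
Lemma fractional_fubini (h : R -> R) : continuous h ->
  (forall x, `|h x| <= 2) -> (forall x, `|h x| <= `|x|) ->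
  \int[P]_w (\int[mu]_(u in `]0%R, +oo[) (h (u * Z w) * u `^ (- 1 - p))) =
  \int[mu]_(u in `]0%R, +oo[) ((\int[P]_w h (u * Z w)) * u `^ (- 1 - p)).
Proof.
move=> ch h2 hx.
have mh : measurable_fun setT h by exact: continuous_measurable_fun.
pose D : set R := `]0%R, +oo[%classic.
pose F (z : T * R) : R := \1_D z.2 * (h (z.2 * Z z.1) * z.2 `^ (- 1 - p)).
have mD : measurable D by exact: measurable_itv.
have mID : measurable_fun setT (\1_D : R -> R) by exact: measurable_indic.
have mF : measurable_fun setT F.
  apply: measurable_funM; first by apply: (measurableT_comp mID).
  apply: measurable_funM.
    apply: measurableT_comp => //; apply: measurable_funM => //.
    exact: measurableT_comp.
  by apply: (measurableT_comp (measurable_powR _)).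
pose W (u : R) : R := Num.min 1 u * u `^ (- 1 - p).
have iW : mu.-integrable D (EFin \o W) by exact: integrable_min_powR.
have W0 u : D u -> 0 <= W u.
  by rewrite /D/= in_itv/= andbT => u0; rewrite mulr_ge0 ?powR_ge0// le_min ler01 ltW.
have hW z u : D u -> `|h (u * z) * u `^ (- 1 - p)| <= 2 * (1 + `|z|) * W u.
  rewrite /D/= in_itv/= andbT => u0.
  rewrite normrM (ger0_norm (powR_ge0 _ _)) /W mulrA ler_wpM2r ?powR_ge0//.
  have a1 := h2 (u * z); have a2 := hx (u * z).
  rewrite normrM (gtr0_norm u0) in a2.
  have z0 := normr_ge0 z.
  by case: (leP 1 u) => u1; nra.
have iWz c : mu.-integrable D (fun u => (c * W u)%:E).
  by apply: (@integrableZl _ _ R mu D (measurable_itv _) c _ iW).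
have mhu z : measurable_fun setT (fun u : R => h (u * z) * u `^ (- 1 - p)).
  apply: measurable_funM; last exact: measurable_powR.
  by apply: measurableT_comp => //; exact: measurable_funM.
have iu z : mu.-integrable D (EFin \o (fun u => h (u * z) * u `^ (- 1 - p))).
  apply: le_integrable (iWz (2 * (1 + `|z|))) => //.
    by apply/measurable_EFinP; exact: measurable_funTS (mhu z).
  move=> u Du /=; rewrite lee_fin; apply: le_trans (hW z u Du) _; exact: ler_norm.
have iP u : integrable_rv P (fun w => h (u * Z w)).
  apply: le_integrable_rv (integrable_rv_cst P 2) _ => //.
  by apply: measurableT_comp => //; exact: measurable_funM.
have F1 w : (\int[mu]_u (F (w, u))%:E =
    (\int[mu]_(u in D) (h (u * Z w) * u `^ (- 1 - p)))%:E)%E.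
  rewrite /Rintegral fineK; last by apply: (integrable_fin_num _ (iu (Z w))).
  rewrite [RHS]integral_mkcond; apply: eq_integral => u _.
  by rewrite patchE /F indicE/=; case: ifPn => uD; rewrite ?mul1r ?mul0r.
have F2 u : (\int[P]_w (F (w, u))%:E =
    ((fun u => ((\int[P]_w h (u * Z w)) * u `^ (- 1 - p))%:E) \_ D) u)%E.
  rewrite patchE; case: ifPn => uD; last first.
    by rewrite integral0_eq// => w _; rewrite /F indicE/= (negPf uD) mul0r.
  have -> : (\int[P]_w (F (w, u))%:E = \int[P]_w (u `^ (- 1 - p) * h (u * Z w))%:E)%E.
    by apply: eq_integral => w _; rewrite /F indicE/= uD mul1r mulrC.
  rewrite -(EFin_Rintegral_rv (integrable_rvZ _ (iP u))); congr EFin.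
  by rewrite (RintegralZl _ measurableT (iP u)) mulrC.
have [d0 dE] : exists d0, (\int[mu]_(u in D) (W u)%:E = d0%:E)%E.
  exists (\int[mu]_(u in D) W u); rewrite /Rintegral fineK//.
  by apply: (integrable_fin_num _ iW).
have Fabs : (\int[P]_w \int[mu]_u `|(F (w, u))%:E| < +oo)%E.
  have iB : integrable_rv P (fun w => d0 * (2 * (1 + `|Z w|))).
    apply: integrable_rvZ; apply: integrable_rvZ; apply: integrable_rvD.
      exact: integrable_rv_cst.
    exact: (integrable_norm iZ).
  apply: le_lt_trans (ltry (\int[P]_w (d0 * (2 * (1 + `|Z w|))))).
  rewrite EFin_Rintegral_rv//.
  have mabs : measurable_fun setT (abse \o (EFin \o F)).
    by apply: measurableT_comp => //; exact/measurable_EFinP.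
  apply: ge0_le_integral => //.
  - by move=> w _; apply: integral_ge0.
  - exact: (@measurable_fun_fubini_tonelli_F _ _ _ _ _ mu (abse \o (EFin \o F)) mabs (fun=> abse_ge0 _)).
  - exact: (measurable_int _ iB).
  - move=> w _; rewrite mulrC EFinM -dE -ge0_integralZl//; last exact: (measurable_int _ iW).
    rewrite [leRHS]integral_mkcond; apply: ge0_le_integral => //.
    + apply: (measurableT_comp (f := abse \o (EFin \o F)) (g := fun u => (w, u))) => //; exact: pair1_measurable.
    + apply/(measurable_restrictT _ mD); apply: measurable_funeM.
      exact: (measurable_int _ iW).
    + move=> u _; rewrite patchE /F indicE/=; case: ifPn => uD; last first.
        by rewrite mul0r normr0.
      by rewrite mul1r lee_fin; apply: hW; rewrite inE in uD.
have iF : (P \x mu)%E.-integrable setT (EFin \o F).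
  by apply/integrable12ltyP => //; exact/measurable_EFinP.
have FF := Fubini iF; rewrite /= in FF.
rewrite {1}/Rintegral.
under eq_integral do rewrite -F1.
rewrite FF; under eq_integral do rewrite F2.
by rewrite -integral_mkcond.
Qed.

Lemma fractional_cos : integrable_rv P (fun w => `|Z w| `^ p) ->
  cos (p * (pi / 2)) * (Gamma (1 - p) / p) * \int[P]_w (`|Z w| `^ p) =
  \int[mu]_(u in `]0%R, +oo[) ((1 - \int[P]_w cos (u * Z w)) * u `^ (- 1 - p)).
Proof.
move=> iZp; rewrite -RintegralZl//.
have := @fractional_fubini (fun x => 1 - cos x).
under eq_Rintegral do rewrite fourier_abs_powR//.
move=> -> //.
- apply: eq_Rintegral => u _; congr (_ * _).
  rewrite RintegralB ?Rintegral_rv_cst//; first exact: integrable_rv_cst.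
  apply: le_integrable_rv (integrable_rv_cst P 1) _ => [|w]; last exact: cos_max.
  apply: (measurableT_comp (f := @cos R)); last exact: measurable_funM.
  by apply: continuous_measurable_fun; exact: continuous_cos.
- by move=> x; apply: is_derive_continuous.
- move=> x; rewrite ger0_norm ?subr_ge0 ?cos_le1//.
  by have := cos_geN1 x; lra.
- by move=> x; rewrite ger0_norm ?subr_ge0 ?cos_le1// one_sub_cos_le_norm.
Qed.

Lemma fractional_sin : integrable_rv P (fun w => Num.sg (Z w) * `|Z w| `^ p) ->
  sin (p * (pi / 2)) * (Gamma (1 - p) / p) * \int[P]_w (Num.sg (Z w) * `|Z w| `^ p) =
  \int[mu]_(u in `]0%R, +oo[) ((\int[P]_w sin (u * Z w)) * u `^ (- 1 - p)).
Proof.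
move=> iZp; rewrite -RintegralZl//.
have := @fractional_fubini sin.
under eq_Rintegral do rewrite fourier_sgr_powR//.
move=> -> //.
- exact: continuous_sin.
- by move=> x; apply: le_trans (sin_max x) _; rewrite ler1n.
- exact: ler_norm_sin.
Qed.

End fractional_fubini.

Section real_powers.
Context {R : realType}.
Variable p : R.
Hypotheses (p0 : 0 < p) (p1 : p < 1).

Lemma powR_le_one_sqr (a : R) : 0 <= a -> a `^ p <= 1 + a ^+ 2.
Proof.
move=> a0; have [a1|a1] := leP a 1.
  have : a `^ p <= 1 `^ p by rewrite ge0_ler_powR ?nnegrE ?(ltW p0).
  by rewrite powR1; have := sqr_ge0 a; lra.
have : a `^ p <= a `^ 1 by rewrite ler_powR ?ltW.
by rewrite powRr1//; nra.
Qed.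

(** Because 0 < p < 1, the power a^p lies between a and 1. *)
Lemma ler_norm_powRB1 (a : R) : 0 <= a -> `|a `^ p - 1| <= `|a - 1|.
Proof.
move=> a0; have [a1|a1] := leP a 1.
  have h1 : a `^ p <= 1 `^ p by rewrite ge0_ler_powR ?nnegrE ?(ltW p0).
  rewrite powR1 in h1.
  have h2 : a <= a `^ p.
    have [->|an0] := eqVneq a 0; first by rewrite powR_ge0.
    have a_gt0 : 0 < a by rewrite lt0r an0.
    by rewrite -[leLHS]powRr1//; apply: ger_powR; rewrite ?a_gt0// ltW.
  by rewrite !ler0_norm; lra.
have h1 : a `^ p <= a `^ 1 by rewrite ler_powR ?ltW.
have h2 : a `^ 0 <= a `^ p by rewrite ler_powR ?ltW.
rewrite powRr1// in h1; rewrite powRr0 in h2.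
by rewrite !ger0_norm; lra.
Qed.

Lemma ler_norm_sgr_powRB1 (x : R) : `|Num.sg x * `|x| `^ p - 1| <= 2 * `|x - 1|.
Proof.
have [x0|x0] := leP 0 x.
  have [->|xn0] := eqVneq x 0; first by rewrite sgr0 mul0r !sub0r normrN1; lra.
  have x_gt0 : 0 < x by rewrite lt0r xn0.
  rewrite gtr0_sg// mul1r (ger0_norm x0); apply: le_trans (ler_norm_powRB1 x0) _.
  by have := normr_ge0 (x - 1); lra.
have nx0 : 0 <= - x by rewrite oppr_ge0 ltW.
have := ler_norm_powRB1 nx0; have := powR_ge0 (- x) p.
rewrite ltr0_sg// mulN1r (ltr0_norm x0) (@ltr0_norm _ (x - 1)); last lra.
move=> h; rewrite (@ltr0_norm _ (- (- x) `^ p - 1)); last lra.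
rewrite ler_norml => /andP[_ hn].
have [hx|hx] := leP (- x) 1.
  have : (- x) `^ p <= 1 `^ p by rewrite ge0_ler_powR ?nnegrE ?(ltW p0).
  by rewrite powR1; lra.
by rewrite (@gtr0_norm _ (- x - 1)) in hn; lra.
Qed.

(** Mean-square closeness of a variable to a sign k thus yields closeness of its powers. The factor
    2 accounts for x and k of opposite signs. *)
Lemma ler_norm_powR_sgr (x k : R) : `|k| = 1 ->
  `| `|x| `^ p - 1| <= `|x - k| /\ `|Num.sg x * `|x| `^ p - k| <= 2 * `|x - k|.
Proof.
move=> k1; split.
  by apply: le_trans (ler_norm_powRB1 (normr_ge0 x)) _; rewrite -[in leLHS]k1 ler_dist_dist.
have [k0|k0] := ltP k 0; last first.
  by rewrite ger0_norm// in k1; rewrite k1; exact: ler_norm_sgr_powRB1.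
have -> : k = - 1 by rewrite -k1 ltr0_norm// opprK.
have := ler_norm_sgr_powRB1 (- x).
by rewrite sgrN normrN mulNr -opprD normrN -[- x - 1]opprD normrN opprK.
Qed.

End real_powers.

(** The right-hand side is built from maxima and powers, which gives the measurability of the signed
    power. *)
Lemma sgr_powR (R : realType) (p x : R) : 0 < p ->
  Num.sg x * `|x| `^ p = Num.max x 0 `^ p - Num.max (- x) 0 `^ p.
Proof.
move=> p0; have p0' : p == 0 = false by rewrite gt_eqF.
have [x0|x0] := leP 0 x.
  rewrite (@max_r _ _ (- x)) ?oppr_le0// powR0 ?p0'// subr0.
  have [->|xn0] := eqVneq x 0; first by rewrite normr0 powR0 ?p0'// mulr0.
  by rewrite gtr0_sg ?lt0r ?xn0// mul1r ger0_norm.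
by rewrite ltr0_sg// ltr0_norm// max_l ?oppr_ge0 ?ltW// powR0 ?p0'// sub0r mulN1r.
Qed.

Lemma integrable_fractional d (T : measurableType d) (R : realType)
    (P : probability T R) (p : R) (Z : T -> R) :
  0 < p -> p < 1 -> measurable_fun setT Z -> integrable_rv P (fun w => Z w ^+ 2) ->
  integrable_rv P (fun w => `|Z w| `^ p) /\
  integrable_rv P (fun w => Num.sg (Z w) * `|Z w| `^ p).
Proof.
move=> p0 p1 mZ iZ; have i1 := integrable_rvD (integrable_rv_cst P 1) iZ.
have Zp w : `| `|Z w| `^ p| <= 1 + Z w ^+ 2.
  by rewrite (ger0_norm (powR_ge0 _ _)) -(real_normK (num_real (Z w))) powR_le_one_sqr.
have mpow : measurable_fun setT (fun x : R => x `^ p) by exact: measurable_powR.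
split; apply: le_integrable_rv i1 _ => //.
- by apply: (measurableT_comp mpow); exact: measurableT_comp.
- rewrite (_ : (fun w => _) =
    (fun w => Num.max (Z w) 0 `^ p - Num.max (- Z w) 0 `^ p)); last first.
    by apply/funext => w; rewrite sgr_powR.
  apply: measurable_funB; apply: (measurableT_comp mpow); apply: measurable_maxr => //.
  exact: measurableT_comp.
- move=> w; apply: le_trans (Zp w); rewrite normrM ler_piMl// normr_sg.
  by case: eqP.
Qed.

(** * The subordinated process: measurable version and moments *)

Section subordination.
Context {d} {T : measurableType d} {R : realType} (P : probability T R).
Variables (Y S : R -> T -> R) (psi : R -> R) (dd : nat -> R) (alpha theta p : R).
Hypothesis Y_levy : is_levy P Y.
Hypothesis Y_laplace : laplace_exponent P Y psi.
Hypothesis psi_series : forall eta : R, 0 < eta ->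
  (\sum_(1 <= k < n) dd k * eta ^+ k) @[n --> \oo] --> psi eta.
Hypotheses (alpha_gt0 : 0 < alpha) (alpha_le1 : alpha <= 1) (theta_gt0 : 0 < theta).
Hypothesis S_ting : is_TInG P alpha theta S.
Hypothesis YS_indep : independent_processes P Y S.
Hypotheses (p0 : 0 < p) (p1 : p < 1).

Definition ting_mean : R := alpha * theta `^ (alpha - 1) * expR (- theta).
(** An upper bound for the variance of S_t divided by t, not the variance itself; the 6 is the
    constant of [levy_moments]. *)
Definition ting_var : R := 6 * (alpha * (theta `^ (alpha - 1) + theta `^ (alpha - 2))).
Local Notation c := ting_mean.
Local Notation K := ting_var.

Lemma ting_mean_gt0 : 0 < c.
Proof. by rewrite !mulr_gt0 ?powR_gt0 ?expR_gt0. Qed.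

Lemma ting_var_ge0 : 0 <= K.
Proof. by rewrite mulr_ge0// mulr_ge0 ?addr_ge0 ?powR_ge0// ltW. Qed.

(** The second-order coefficient is taken to be b = 0 and absorbed into the error, which is why the
    second moment is only bounded. *)
Lemma ting_moments (t : R) : 0 <= t ->
  [/\ integrable_rv P (fun w => S t w ^+ 2), \int[P]_w S t w = c * t &
      \int[P]_w (S t w ^+ 2) <= (c * t) ^+ 2 + K * t].
Proof.
move=> t0.
have [] := @levy_moments _ _ _ P S _ c 0 (alpha * (theta `^ (alpha - 1) + theta `^ (alpha - 2)))
  1 t (ting_levy S_ting) (ting_laplace S_ting) => //.
- by rewrite mulr_ge0 ?addr_ge0 ?powR_ge0// ltW.
- move=> h /andP[h0 _].
  have := lower_gamma_increment alpha_gt0 alpha_le1 theta_gt0 h0.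
  rewrite mul0r subr0 /ting_mean -!(mulrA alpha) -mulrBr normrM (gtr0_norm alpha_gt0).
  by rewrite ler_pM2l.
move=> iS ES ES2; split => //; first by rewrite ES mulrC.
move: ES2; rewrite ler_norml => /andP[_]; rewrite /ting_var; nra.
Qed.

(** A measurable version of the subordinated variable, bundled with the one quantitative fact used
    about its law: fixed-time bounds transfer, with (c t - r)^2 + K t bounding the mean of (S_t -
    r)^2. *)
Definition subordinate_rv (t : R) (Q : T -> R) : Prop :=
  [/\ measurable_fun setT Q, {ae P, forall w, subordinate Y S t w = Q w} &
    forall (f : R -> R) (a b r e : R), continuous f -> (forall y, 0 <= f y) ->
      0 <= a -> 0 <= b -> 0 <= e ->
      (forall s : R, 0 <= s ->
        (\int[P]_w (f (Y s w))%:E <= (a + b * (s - r) ^+ 2 + e * s)%:E)%E) ->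
      (\int[P]_w (f (Q w))%:E <=
        (a + b * ((c * t - r) ^+ 2 + K * t) + e * (c * t))%:E)%E].

Lemma ex_subordinate_rv (t : R) : 0 <= t -> exists Q : T -> R, subordinate_rv t Q.
Proof.
move=> t0; have [iS ES ES2] := ting_moments t0.
have mS : measurable_fun setT (S t) := levy_measurable (ting_levy S_ting) t0.
(* S_t is nonnegative only almost surely, whereas the random time has to be nonnegative
   everywhere. *)
pose sigma w := Num.max (S t w) 0.
have sS : {ae P, forall w, S t w = sigma w}.
  apply: filterS2 (ting_nondecreasing S_ting) (levy_start (ting_levy S_ting)) => w incr S0.
  by rewrite /sigma max_l// -S0 incr.
have msigma : measurable_fun setT sigma by apply: measurable_maxr.
have isigma : integrable_rv P (fun w => sigma w ^+ 2).
  apply: le_integrable_rv iS _ => [|w]; first exact: measurable_funX.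
  rewrite /sigma; case: (leP (S t w) 0) => h; last by rewrite ger0_norm ?sqr_ge0.
  by rewrite expr0n normr0 sqr_ge0.
have sigma0 w : 0 <= sigma w by rewrite le_max lexx orbT.
have [] := @subordinate_version _ _ _ P Y sigma (levy_measurable Y_levy) (levy_cadlag Y_levy)
  msigma sigma0 isigma.
  move=> s A B s0 mA mB; apply: YS_indep.
    by apply: sub_gen_smallest; exists s, A.
  have -> : sigma @^-1` B = S t @^-1` ((fun x => Num.max x 0) @^-1` B) by [].
  apply: sub_gen_smallest; exists t; exists ((fun x : R => Num.max x 0) @^-1` B); split => //.
  rewrite -[X in measurable X]setTI; apply: (@measurable_maxr _ _ _ setT id (cst 0)) => //.
move=> Q [mQ YQ SUB]; exists Q; split => //.
  apply: filterS2 sS YQ => w sw <-; by rewrite /subordinate sw.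
have Esigma : \int[P]_w sigma w = c * t.
  rewrite -ES /Rintegral; congr fine; apply: ae_eq_integral_sup.
  by apply: filterS sS => w ->.
have Esigma2 : \int[P]_w (sigma w ^+ 2) <= (c * t) ^+ 2 + K * t.
  rewrite (_ : Rintegral _ _ _ = \int[P]_w (S t w ^+ 2))//.
  rewrite /Rintegral; congr fine; apply: ae_eq_integral_sup.
  by apply: filterS sS => w ->.
move=> f a b r e cf f0 a0 b0 e0 H; apply: le_trans (SUB f a b r e cf f0 a0 b0 e0 H) _.
have i1 := integrable_rv_sqr msigma isigma.
have -> : \int[P]_w ((sigma w - r) ^+ 2) =
    \int[P]_w (sigma w ^+ 2) - 2 * r * \int[P]_w sigma w + r ^+ 2.
  transitivity (\int[P]_w (sigma w ^+ 2 - 2 * r * sigma w + r ^+ 2)).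
    by apply: eq_Rintegral => w _; ring.
  have i2 := integrable_rvZ (2 * r) i1.
  rewrite (RintegralD measurableT (integrable_rvB isigma i2) (integrable_rv_cst P _)).
  rewrite (RintegralB measurableT isigma i2) (RintegralZl _ measurableT i1).
  by rewrite Rintegral_rv_cst.
rewrite Esigma lee_fin lerD2r lerD2l ler_wpM2l//.
by move: Esigma2; lra.
Qed.

(** Transfer of f(y) = (y - d_1 r)^2, whose mean at a fixed time s is exactly d_1^2 (s - r)^2 - 2
    d_2 s. *)
Lemma subordinate_moments (t : R) (Q : T -> R) : 0 <= t -> subordinate_rv t Q ->
  integrable_rv P (fun w => Q w ^+ 2) /\
  forall r : R, \int[P]_w ((Q w - dd 1%N * r) ^+ 2) <=
    dd 1%N ^+ 2 * ((c * t - r) ^+ 2 + K * t) + - (2 * dd 2%N) * (c * t).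
Proof.
move=> t0 [mQ YQ SUB].
have bound r : (\int[P]_w ((Q w - dd 1%N * r) ^+ 2)%:E <=
    (dd 1%N ^+ 2 * ((c * t - r) ^+ 2 + K * t) + - (2 * dd 2%N) * (c * t))%:E)%E.
  have := SUB (fun y => (y - dd 1%N * r) ^+ 2) 0 (dd 1%N ^+ 2) r (- (2 * dd 2%N)).
  rewrite add0r; apply => //.
  - by move=> y; apply: is_derive_continuous.
  - by move=> y; rewrite sqr_ge0.
  - by rewrite sqr_ge0.
  - exact: (levy_var_ge0 Y_levy Y_laplace psi_series).
  - move=> s s0; rewrite (levy_centered_sqr Y_levy Y_laplace psi_series _ s0) lee_fin.
    by rewrite le_eqVlt; apply/orP; left; apply/eqP; ring.
have ibound r : integrable_rv P (fun w => (Q w - dd 1%N * r) ^+ 2).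
  apply: ge0_integrable_rv (bound r) => [|w]; last exact: sqr_ge0.
  by apply: measurable_funX; apply: measurable_funB.
split => //.
  by have := ibound 0; under eq_fun do rewrite mulr0 subr0.
by move=> r; rewrite -lee_fin (EFin_Rintegral_rv (ibound r)).
Qed.

Lemma subordinate_finite_moment (t : R) : 0 <= t ->
  finite_moment P (subordinate Y S t) p.
Proof.
move=> t0; have [Q Qt] := ex_subordinate_rv t0; have [mQ YQ _] := Qt.
have [iQ _] := subordinate_moments t0 Qt.
have [iA _] := integrable_fractional p0 p1 mQ iQ.
rewrite /finite_moment (@ae_eq_expectation _ _ _ P _ (fun w => `|Q w| `^ p)).
  by rewrite unlock -EFin_Rintegral_rv// ltry.
by apply: filterS YQ => w ->.
Qed.

Definition abs_moment (t : R) : R := \int[P]_w (`|subordinate Y S t w| `^ p).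
Definition sgn_moment (t : R) : R :=
  \int[P]_w (Num.sg (subordinate Y S t w) * `|subordinate Y S t w| `^ p).

Lemma ae_abs_moment (t : R) (Q : T -> R) :
  {ae P, forall w, subordinate Y S t w = Q w} ->
  abs_moment t = \int[P]_w (`|Q w| `^ p) /\
  sgn_moment t = \int[P]_w (Num.sg (Q w) * `|Q w| `^ p).
Proof.
move=> YQ; split; rewrite /abs_moment /sgn_moment /Rintegral; congr fine;
  by apply: ae_eq_integral_sup; apply: filterS YQ => w ->.
Qed.

(** The principal power equals |x|^p for x > 0 and e^(i pi p) |x|^p for x < 0, hence it is a fixed
    complex combination of |x|^p and sgn(x) |x|^p; at x = 0 everything vanishes since p > 0. *)
Lemma fractional_momentE (t : R) : 0 <= t ->
  fractional_moment P (subordinate Y S t) p =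
  ((1 + cos (pi * p)) / 2 * abs_moment t + (1 - cos (pi * p)) / 2 * sgn_moment t)
  +i* (sin (pi * p) / 2 * (abs_moment t - sgn_moment t)).
Proof.
move=> t0; have [Q Qt] := ex_subordinate_rv t0; have [mQ YQ _] := Qt.
have [iQ _] := subordinate_moments t0 Qt.
have [iA iB] := integrable_fractional p0 p1 mQ iQ.
have [-> ->] := ae_abs_moment YQ.
rewrite /fractional_moment /cexpectation.
have ppowE (x : R) : ppow x p =
  ((1 + cos (pi * p)) / 2 * `|x| `^ p + (1 - cos (pi * p)) / 2 * (Num.sg x * `|x| `^ p))
  +i* (sin (pi * p) / 2 * (`|x| `^ p - Num.sg x * `|x| `^ p)).
  rewrite /ppow; have [x0|x0] := leP 0 x.
    have [->|xn0] := eqVneq x 0.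
      by rewrite normr0 powR0 ?gt_eqF// !(mulr0, subr0, addr0).
    rewrite ger0_norm// gtr0_sg ?lt0r ?xn0// mul1r subrr mulr0.
    by congr (_ +i* _); field.
  rewrite ltr0_sg// mulN1r; set y := _ `^ p.
  by simpc; congr (_ +i* _); field.
congr (_ +i* _).
- rewrite (@ae_eq_expectation _ _ _ P _ (fun w => (1 + cos (pi * p)) / 2 * `|Q w| `^ p +
    (1 - cos (pi * p)) / 2 * (Num.sg (Q w) * `|Q w| `^ p))); last first.
    by apply: filterS YQ => w ->; rewrite ppowE.
  rewrite unlock -EFin_Rintegral_rv/=; last by apply: integrable_rvD; exact: integrable_rvZ.
  rewrite (RintegralD measurableT (integrable_rvZ _ iA) (integrable_rvZ _ iB)).
  by rewrite (RintegralZl _ measurableT iA) (RintegralZl _ measurableT iB).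
- rewrite (@ae_eq_expectation _ _ _ P _
    (fun w => sin (pi * p) / 2 * (`|Q w| `^ p - Num.sg (Q w) * `|Q w| `^ p))); last first.
    by apply: filterS YQ => w ->; rewrite ppowE.
  rewrite unlock -EFin_Rintegral_rv/=; last by apply: integrable_rvZ; exact: integrable_rvB.
  rewrite (RintegralZl _ measurableT (integrable_rvB iA iB)).
  by rewrite (RintegralB measurableT iA iB).
Qed.

End subordination.

Lemma cvg_complex (R : realType) (f g : R -> R) (x y : R) :
  f t @[t --> +oo] --> x -> g t @[t --> +oo] --> y ->
  ((f t +i* g t) : R[i]^o) @[t --> +oo] --> ((x +i* y) : R[i]^o).
Proof.
move=> fx gy; apply/cvgrPdist_lt => e e0.
(* A positive element of [R[i]] is real. *)
have [r r0 er] : exists2 r : R, 0 < r & e = r%:C.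
  case: e e0 => r i; rewrite ltcE/= => /andP[/eqP -> r0]; by exists r.
have r2 : 0 < r / 2 by rewrite divr_gt0.
move/cvgrPdist_lt : fx => /(_ _ r2) fe; move/cvgrPdist_lt : gy => /(_ _ r2).
apply: filterS2 fe => t; rewrite !ltr_norml => /andP[f1 f2] /andP[g1 g2].
have -> : (x +i* y : R[i]^o) - (f t +i* g t) = (x - f t) +i* (y - g t) by simpc.
rewrite er normc_def/= ltcR -[ltRHS]ger0_norm ?(ltW r0)// -sqrtr_sqr ltr_sqrt; last first.
  by rewrite exprn_gt0.
nra.
Qed.

Lemma continuous_lipschitz (R : realType) (F : R -> R) (M : R) :
  (forall u v, `|F u - F v| <= M * `|u - v|) -> continuous F.
Proof.
move=> FM u; have M0 : 0 <= M.
  have := FM 1 0; rewrite subr0 normr1 mulr1; exact: le_trans.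
apply/cvgrPdist_le => e e0; near=> v.
apply: le_trans (FM u v) _.
have : `|u - v| <= e / (M + 1).
  near: v; apply: cvgr_dist_le; [exact: cvg_id|rewrite divr_gt0//; lra].
by rewrite ler_pdivlMr; [have := normr_ge0 (u - v); nra|lra].
Unshelve. all: by end_near.
Qed.

Lemma cvg_dist0 (R : realType) (f g W : nat -> R) (l C : R) :
  g k @[k --> \oo] --> l -> (forall k, `|f k - g k| <= C * W k) ->
  W k @[k --> \oo] --> 0 -> f k @[k --> \oo] --> l.
Proof.
move=> gl fg W0.
have CW : C * W k @[k --> \oo] --> 0 by rewrite -(mulr0 C); exact: cvgMr.
have fg0 : f k - g k @[k --> \oo] --> 0.
  apply: (@squeeze_cvgr _ _ _ _ (fun k => - (C * W k)) (fun k => C * W k)) => //.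
    by apply: nearW => k; have := fg k; rewrite ler_norml.
  by rewrite -oppr0; exact: cvgN.
rewrite -[l]add0r (_ : f = (fun k => (f k - g k) + g k)); first exact: cvgD.
by apply/funext => k; rewrite subrK.
Qed.

Section characteristic_function.
Context {d} {T : measurableType d} {R : realType} (P : probability T R).
Variables (Z : T -> R) (h : R -> R).
Hypotheses (mZ : measurable_fun setT Z) (iZ : integrable_rv P Z).
Hypothesis h1 : forall x, `|h x| <= 1.
Hypothesis hlip : forall x y, `|h x - h y| <= `|x - y|.

Let ch : continuous h.
Proof. by apply: (@continuous_lipschitz _ _ 1) => u v; rewrite mul1r. Qed.

Lemma integrable_char (u : R) : integrable_rv P (fun w => h (u * Z w)).
Proof.
apply: le_integrable_rv (integrable_rv_cst P 1) _ => //.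
apply: measurableT_comp; last exact: measurable_funM.
exact: continuous_measurable_fun.
Qed.

Let mean := \int[P]_w `|Z w|.

(** Besides the measurability of the characteristic function, taking one argument 0 gives the linear
    bound near u = 0 that makes the integral against u^(-1-p) converge. *)
Lemma ler_norm_charB (u v : R) :
  `|\int[P]_w h (u * Z w) - \int[P]_w h (v * Z w)| <= mean * `|u - v|.
Proof.
rewrite -(RintegralB measurableT (integrable_char u) (integrable_char v)).
have iB := integrable_rvB (integrable_char u) (integrable_char v).
apply: le_trans (le_normr_Rintegral measurableT iB) _.
have inZ : integrable_rv P (fun w => `|Z w|) := integrable_norm iZ.
rewrite mulrC -(RintegralZl _ measurableT inZ); apply: le_Rintegral => //.
- exact: (integrable_norm iB).
- exact: integrable_rvZ.
- by move=> w _; apply: le_trans (hlip _ _) _; rewrite -mulrBl normrM.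
Qed.

Lemma measurable_char : measurable_fun setT (fun u : R => \int[P]_w h (u * Z w)).
Proof.
apply: continuous_measurable_fun; exact: (continuous_lipschitz ler_norm_charB).
Qed.

Lemma ler_norm_char (u : R) : `|\int[P]_w h (u * Z w)| <= 1.
Proof.
apply: le_trans (le_normr_Rintegral measurableT (integrable_char u)) _.
rewrite -[leRHS](Rintegral_rv_cst P 1); apply: le_Rintegral => //.
- exact: (integrable_norm (integrable_char u)).
- exact: integrable_rv_cst.
Qed.

End characteristic_function.

Lemma cvg_fractional (R : realType) (p C : R) (F : nat -> R -> R) (f : R -> R) :
  0 < p -> p < 1 -> (forall k, measurable_fun setT (F k)) ->
  (forall k u, 0 < u -> `|F k u| <= C * Num.min 1 u) ->
  (forall u, 0 < u -> F k u @[k --> \oo] --> f u) ->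
  \int[@lebesgue_measure R]_(u in `]0%R, +oo[) (F k u * u `^ (- 1 - p)) @[k --> \oo] -->
  \int[@lebesgue_measure R]_(u in `]0%R, +oo[) (f u * u `^ (- 1 - p)).
Proof.
move=> p0 p1 mF FC Ff.
have D0 (u : R) : `]0%R, +oo[%classic u -> 0 < u by rewrite /= in_itv/= andbT.
have [] // := @Rintegral_dominated_cvg _ _ R (@lebesgue_measure R) `]0%R, +oo[%classic
  (measurable_itv _) (fun k u => F k u * u `^ (- 1 - p)) (fun u => f u * u `^ (- 1 - p))
  (fun u => C * (Num.min 1 u * u `^ (- 1 - p))).
- move=> k.
  have mFp : measurable_fun setT (fun u : R => F k u * u `^ (- 1 - p)).
    by apply: measurable_funM => //; exact: measurable_powR.
  exact: (measurable_funS measurableT (@subsetT _ _) mFp).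
- by move=> u /D0 u0; apply: cvgMl; exact: Ff.
- have iW := integrable_min_powR p0 p1.
  exact: (@integrableZl _ _ R (@lebesgue_measure R) `]0%R, +oo[%classic (measurable_itv _) C _ iW).
- move=> k u /D0 u0; rewrite normrM (ger0_norm (powR_ge0 _ _)) mulrA.
  by rewrite ler_wpM2r ?powR_ge0// FC.
Qed.

(** * Asymptotics *)

Section asymptotics.
Context {d} {T : measurableType d} {R : realType} (P : probability T R).
Variables (Y S : R -> T -> R) (psi : R -> R) (dd : nat -> R) (alpha theta p : R).
Hypothesis Y_levy : is_levy P Y.
Hypothesis Y_laplace : laplace_exponent P Y psi.
Hypothesis psi_series : forall eta : R, 0 < eta ->
  (\sum_(1 <= k < n) dd k * eta ^+ k) @[n --> \oo] --> psi eta.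
Hypotheses (alpha_gt0 : 0 < alpha) (alpha_le1 : alpha <= 1) (theta_gt0 : 0 < theta).
Hypothesis S_ting : is_TInG P alpha theta S.
Hypothesis YS_indep : independent_processes P Y S.
Hypotheses (p0 : 0 < p) (p1 : p < 1).
Local Notation c := (ting_mean alpha theta).
Local Notation K := (ting_var alpha theta).
Local Notation am := (abs_moment P Y S p).
Local Notation sm := (sgn_moment P Y S p).

Let c0 : 0 < c. Proof. exact: ting_mean_gt0. Qed.
Let K0 : 0 <= K. Proof. exact: ting_var_ge0. Qed.

(** The denominator is split into a positive real scale s and a constant delta carrying the phase,
    which reduces the complex asymptotics to two real limits. *)
Lemma fractional_ratio (s : R -> R) (D : R -> R[i]) (a b : R) (delta : R[i]) :
  delta = ((1 + cos (pi * p)) / 2 * a + (1 - cos (pi * p)) / 2 * b)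
          +i* (sin (pi * p) / 2 * (a - b)) ->
  delta != 0 -> (forall t, 0 < t -> 0 < s t) ->
  (forall t, 0 < t -> D t = (s t)%:C * delta) ->
  am t / s t @[t --> +oo] --> a -> sm t / s t @[t --> +oo] --> b ->
  ((fractional_moment P (subordinate Y S t) p / D t) : R[i]^o) @[t --> +oo] --> (1 : R[i]^o).
Proof.
move=> dE d0 s0 DE ha hb.
pose F t : R[i]^o :=
  ((1 + cos (pi * p)) / 2 * (am t / s t) + (1 - cos (pi * p)) / 2 * (sm t / s t))
  +i* (sin (pi * p) / 2 * (am t / s t - sm t / s t)).
have h : F t @[t --> +oo] --> (delta : R[i]^o).
  rewrite dE; apply: cvg_complex.
    by apply: cvgD; apply: cvgMr.
  by apply: cvgMr; apply: cvgB.
have h2 : (F t * (delta^-1 : R[i]^o)) @[t --> +oo] --> (1 : R[i]^o).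
  by rewrite -(divff d0); apply: cvgMl.
apply: cvg_trans h2; apply: near_eq_cvg.
near=> t.
have t0 : 0 < t by near: t; exact: nbhs_pinfty_gt.
rewrite (fractional_momentE Y_levy Y_laplace psi_series alpha_gt0 alpha_le1 theta_gt0
  S_ting YS_indep p0 p1 (ltW t0)) DE// invfM mulrA; congr (_ * _).
have st0 := s0 t t0.
rewrite -fmorphV/=; simpc.
by congr (_ +i* _); field; rewrite gt_eqF.
Unshelve. all: by end_near.
Qed.

Lemma scaled_fractional (t k : R) (Q : T -> R) : 0 <= t -> 0 < k ->
  subordinate_rv P Y S alpha theta t Q ->
  [/\ integrable_rv P (fun w => (Q w / k) ^+ 2),
      am t / k `^ p = \int[P]_w (`|Q w / k| `^ p) &
      sm t / k `^ p = \int[P]_w (Num.sg (Q w / k) * `|Q w / k| `^ p)].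
Proof.
move=> t0 k0 Qt; have [mQ YQ _] := Qt.
have [iQ _] := subordinate_moments Y_levy Y_laplace psi_series t0 Qt.
have [iA iB] := integrable_fractional p0 p1 mQ iQ.
have [-> ->] := ae_abs_moment p YQ.
have kp : (k^-1) `^ p = (k `^ p)^-1 by rewrite -powR_inv1 ?(ltW k0)// -powRrM mulN1r powRN.
have Zp w : `|Q w / k| `^ p = (k `^ p)^-1 * `|Q w| `^ p.
  rewrite normrM (@ger0_norm _ k^-1) ?invr_ge0 ?(ltW k0)// powRM ?invr_ge0 ?(ltW k0)//.
  by rewrite kp mulrC.
split.
- rewrite (_ : (fun w => _) = (fun w => k ^- 2 * Q w ^+ 2)); first exact: integrable_rvZ.
  by apply/funext => w; rewrite exprMn exprVn mulrC.
- by rewrite mulrC -(RintegralZl _ measurableT iA); apply: eq_Rintegral => w _; rewrite Zp.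
- rewrite mulrC -(RintegralZl _ measurableT iB); apply: eq_Rintegral => w _.
  by rewrite Zp sgrM (@gtr0_sg _ k^-1) ?invr_gt0// mulr1 mulrCA.
Qed.

(** The moment bound at r = c t says that Z = Q / (k t) satisfies E (Z - kap)^2 <= M / t. The powers
    move by at most 2 |Z - kap| <= e + (Z - kap)^2 / e, so both moments are within e + M / (e t) of
    their limits, for every e > 0. *)
Lemma linear_growth : dd 1%N != 0 ->
  am t / (c * `|dd 1%N| * t) `^ p @[t --> +oo] --> (1 : R) /\
  sm t / (c * `|dd 1%N| * t) `^ p @[t --> +oo] --> Num.sg (dd 1%N).
Proof.
move=> d1; pose k := c * `|dd 1%N|; pose kap : R := Num.sg (dd 1%N).
have k0 : 0 < k by rewrite mulr_gt0// normr_gt0.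
have nk : `|kap| = 1 by rewrite normr_sg d1.
have v0 := levy_var_ge0 Y_levy Y_laplace psi_series.
pose M := (dd 1%N ^+ 2 * K + - (2 * dd 2%N) * c) / k ^+ 2.
have bnd t e : 0 < t -> 0 < e ->
    `|am t / (k * t) `^ p - 1| <= e + M / (e * t) /\
    `|sm t / (k * t) `^ p - kap| <= e + M / (e * t).
  move=> t0 e0.
  have [Q Qt] := ex_subordinate_rv Y_levy alpha_gt0 alpha_le1 theta_gt0 S_ting YS_indep (ltW t0).
  have [mQ _ _] := Qt.
  have kt0 : 0 < k * t by rewrite mulr_gt0.
  have [iZ -> ->] := scaled_fractional (ltW t0) kt0 Qt.
  have [_ /(_ (c * t))] := subordinate_moments Y_levy Y_laplace psi_series (ltW t0) Qt.
  rewrite subrr expr0n/= add0r.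
  pose Z w := Q w / (k * t).
  have mZ : measurable_fun setT Z by apply: measurable_funM.
  have ZE w : (Q w - dd 1%N * (c * t)) ^+ 2 = (k * t) ^+ 2 * (Z w - kap) ^+ 2.
    rewrite -exprMn mulrBr [_ * Z w]mulrC divfK ?gt_eqF//.
    by rewrite /k /kap; congr ((_ - _) ^+ 2); rewrite [in LHS](numEsg (dd 1%N)); ring.
  under eq_Rintegral do rewrite ZE.
  have i1 := integrable_rv_sqr mZ iZ.
  have iZk : integrable_rv P (fun w => (Z w - kap) ^+ 2).
    rewrite (_ : (fun w => _) = (fun w => Z w ^+ 2 - 2 * kap * Z w + kap ^+ 2)).
      apply: integrable_rvD; last exact: integrable_rv_cst.
      by apply: integrable_rvB => //; exact: integrable_rvZ.
    by apply/funext => w; ring.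
  rewrite (RintegralZl _ measurableT iZk) => E2.
  have E2' : \int[P]_w ((Z w - kap) ^+ 2) <= M / t.
    have kt2 : 0 < (k * t) ^+ 2 by rewrite exprn_gt0.
    rewrite -(ler_pM2l kt2); apply: le_trans E2 _.
    by rewrite le_eqVlt /M; apply/orP; left; apply/eqP; field; rewrite !gt_eqF.
  have [iA iB] := integrable_fractional p0 p1 mZ iZ.
  have iW : integrable_rv P (fun w => e + e^-1 * (Z w - kap) ^+ 2).
    by apply: integrable_rvD; [exact: integrable_rv_cst|exact: integrable_rvZ].
  have EW : \int[P]_w (e + e^-1 * (Z w - kap) ^+ 2) <= e + M / (e * t).
    rewrite (RintegralD measurableT (integrable_rv_cst P e) (integrable_rvZ _ iZk)).
    rewrite (RintegralZl _ measurableT iZk) Rintegral_rv_cst lerD2l.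
    by rewrite [e * t]mulrC invfM mulrA [leRHS]mulrC ler_pM2l ?invr_gt0.
  have dist (X : T -> R) (x : R) : integrable_rv P X ->
      (forall w, `|X w - x| <= 2 * `|Z w - kap|) -> `|\int[P]_w X w - x| <= e + M / (e * t).
    move=> iX Xx; apply: le_trans EW.
    have iXx := integrable_rvB iX (integrable_rv_cst P x).
    have -> : \int[P]_w X w - x = \int[P]_w (X w - x).
      by rewrite (RintegralB measurableT iX (integrable_rv_cst P x)) Rintegral_rv_cst.
    apply: le_trans (le_normr_Rintegral measurableT iXx) _.
    apply: le_Rintegral => //; first exact: (integrable_norm iXx).
    move=> w _; apply: le_trans (Xx w) _.
    rewrite -(real_normK (num_real (Z w - kap))); set z := `|_|.
    rewrite -subr_ge0 (_ : _ - _ = (e - z) ^+ 2 / e); first by rewrite divr_ge0 ?sqr_ge0 ?ltW.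
    by field; rewrite gt_eqF.
  split; apply: dist => // w; have [h1 h2] := ler_norm_powR_sgr p0 p1 (Z w) nk => //.
  by apply: le_trans h1 _; have := normr_ge0 (Z w - kap); lra.
have lim e : 0 < e -> \forall t \near +oo, 0 < t /\ e / 2 + M / (e / 2 * t) <= e.
  move=> e0; near=> t.
  have t0 : 0 < t by near: t; exact: nbhs_pinfty_gt.
  split => //; rewrite -lerBrDl (_ : e - e / 2 = e / 2); last by field.
  rewrite ler_pdivrMr ?mulr_gt0 ?divr_gt0// mulrA -ler_pdivrMl ?mulr_gt0 ?divr_gt0//.
split; apply/cvgrPdist_le => e e0; apply: filterS (lim e e0) => t [t0 te];
  have [h1 h2] := bnd t (e / 2) t0 (divr_gt0 e0 (ltr0n _ 2)).
  by rewrite distrC; apply: le_trans te.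
by rewrite distrC; apply: le_trans te.
Unshelve. all: by end_near.
Qed.

Section quadratic_growth.
Hypothesis d1 : dd 1%N = 0.
Local Notation V := (- (2 * dd 2%N)).

Let V0 : 0 <= V. Proof. exact: (levy_var_ge0 Y_levy Y_laplace psi_series). Qed.

(* The errors of [levy_lipschitz] and of [|s - r| <= k / 2 + (s - r)^2 / (2 k)] balance
   at [eps = q] and [k = q^2] when [t = q^4]. *)
Lemma subordinate_char_le (g : R -> R) (q u r : R) (Q : T -> R) :
  continuous g -> (forall y, `|g y| <= 1) -> (forall x y, `|g x - g y| <= `|x - y|) ->
  1 <= q -> 0 <= u -> 0 <= r -> `|c * q ^+ 4 - r| <= 1 ->
  subordinate_rv P Y S alpha theta (q ^+ 4) Q ->
  \int[P]_w g (u * (Q w / q ^+ 2)) <= \int[P]_w g (u / q ^+ 2 * Y r w)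
    + u * (1 + V * (2 + K)) / q.
Proof.
move=> cg g1 glip q1 u0 r0 cr [mQ _ SUB].
have q0 : 0 < q by lra.
have v0 : 0 <= u / q ^+ 2 by rewrite divr_ge0 ?sqr_ge0.
set v := u / q ^+ 2 in v0 *.
have igY s : 0 <= s -> integrable_rv P (fun w => g (v * Y s w)).
  move=> s0; apply: le_integrable_rv (integrable_rv_cst P 1) _ => //.
  apply: (measurableT_comp (continuous_measurable_fun cg)).
  by apply: measurable_funM => //; exact: (levy_measurable Y_levy).
have gY : `|\int[P]_w g (v * Y r w)| <= 1.
  apply: le_trans (le_normr_Rintegral measurableT (igY r r0)) _.
  rewrite -[leRHS](Rintegral_rv_cst P 1); apply: le_Rintegral => //.
  - exact: (integrable_norm (igY r r0)).
  - exact: integrable_rv_cst.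
have H (s : R) : 0 <= s -> (\int[P]_w (1 + g (v * Y s w))%:E <=
    ((1 + \int[P]_w g (v * Y r w) + v * (q / 2 + V * q / 4))
     + v * V / (4 * q ^+ 3) * (s - r) ^+ 2 + 0 * s)%:E)%E.
  move=> s0; apply: le_trans (levy_lipschitz Y_levy Y_laplace psi_series d1 cg g1 glip
    v0 s0 r0 q0) _.
  rewrite lee_fin mul0r addr0 -!addrA 2!lerD2l.
  rewrite [leRHS](_ : _ = v * (q / 2 + V * (q / 4 + (s - r) ^+ 2 / (4 * q ^+ 3)))); last first.
    by field; rewrite gt_eqF.
  rewrite ler_wpM2l// lerD2l -mulrA ler_wpM2l// -(real_normK (num_real (s - r))).
  set z := `|_|; rewrite -subr_ge0.
  rewrite (_ : _ - _ = (q ^+ 2 - z) ^+ 2 / (4 * q ^+ 3)); last by field; rewrite gt_eqF.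
  by rewrite divr_ge0 ?sqr_ge0 ?mulr_ge0 ?exprn_ge0 ?(ltW q0).
have b0 : 0 <= v * V / (4 * q ^+ 3).
  by rewrite divr_ge0// ?(mulr_ge0 v0 V0)// mulr_ge0// exprn_ge0// ltW.
have a0 : 0 <= 1 + \int[P]_w g (v * Y r w) + v * (q / 2 + V * q / 4).
  apply: addr_ge0; first by move: gY; rewrite ler_norml => /andP[+ _]; lra.
  by rewrite mulr_ge0// addr_ge0// divr_ge0 ?(mulr_ge0 V0)// ltW.
have := SUB (fun y => 1 + g (v * y)) _ _ r 0 _ _ a0 b0 (lexx 0) H.
have cf : continuous (fun y => 1 + g (v * y)).
  move=> y; apply: cvgD; first exact: cvg_cst.
  by apply: continuous_comp; [exact: mulrl_continuous|exact: cg].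
have f0 y : 0 <= 1 + g (v * y).
  by have := g1 (v * y); rewrite ler_norml => /andP[+ _]; lra.
move=> /(_ cf f0).
have igQ : integrable_rv P (fun w => g (v * Q w)).
  apply: le_integrable_rv (integrable_rv_cst P 1) _ => //.
  apply: (measurableT_comp (continuous_measurable_fun cg)).
  exact: measurable_funM.
rewrite -(EFin_Rintegral_rv (integrable_rvD (integrable_rv_cst P 1) igQ)) lee_fin.
rewrite (RintegralD measurableT (integrable_rv_cst P 1) igQ) Rintegral_rv_cst.
move=> main; rewrite mul0r addr0 -!addrA lerD2l in main.
have -> : \int[P]_w g (u * (Q w / q ^+ 2)) = \int[P]_w g (v * Q w).
  by apply: eq_Rintegral => w _; congr g; rewrite /v mulrA mulrAC.
apply: le_trans main _; rewrite lerD2l.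
have cr2 : (c * q ^+ 4 - r) ^+ 2 <= 1.
  by rewrite -(real_normK (num_real _)); have := normr_ge0 (c * q ^+ 4 - r); nra.
have q4 : 1 <= q ^+ 4 by rewrite exprn_ege1.
have h1 : v * V / (4 * q ^+ 3) * ((c * q ^+ 4 - r) ^+ 2 + K * q ^+ 4) <=
    v * V / (4 * q ^+ 3) * ((1 + K) * q ^+ 4).
  by rewrite ler_wpM2l//; nra.
apply: le_trans (lerD (lexx _) h1) _.
rewrite [leLHS](_ : _ = u * (1 / 2 + V * (2 + K) / 4) / q); last by rewrite /v; field; rewrite gt_eqF.
rewrite ler_pM2r ?invr_gt0// ler_wpM2l//.
have : 0 <= V * (2 + K) by rewrite (mulr_ge0 V0)// addr_ge0.
by move: (V * _) => x; lra.
Qed.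

Section sequence.
Variables (q : nat -> R) (Q : nat -> T -> R).
Hypotheses (q1 : forall k, 1 <= q k) (q_cvg : (q k)^-1 @[k --> \oo] --> 0).
Hypothesis Qq : forall k, subordinate_rv P Y S alpha theta (q k ^+ 4) (Q k).

Let q0 k : 0 < q k. Proof. by apply: lt_le_trans (q1 k). Qed.

(** The fixed time c q^4 is rounded up to an integer, where [levy_clt] applies; the rounding moves
    it by at most 1, as [subordinate_char_le] allows, and does not change the limit of n v^2. *)
Lemma cvg_subordinate_char (u : R) : 0 < u ->
  \int[P]_w cos (u * (Q k w / q k ^+ 2)) @[k --> \oo] --> expR (dd 2%N * (c * u ^+ 2)) /\
  \int[P]_w sin (u * (Q k w / q k ^+ 2)) @[k --> \oo] --> 0.
Proof.
move=> u0.
pose n k := Num.truncn (c * q k ^+ 4).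
have cr k : `|c * q k ^+ 4 - (n k).+1%:R| <= 1.
  have /andP[h1 h2] : (n k)%:R <= c * q k ^+ 4 < (n k).+1%:R.
    by apply: truncn_itv; rewrite mulr_ge0 ?exprn_ge0// ltW.
  by rewrite -natr1 in h2 *; rewrite ler_norml; apply/andP; split; lra.
have v0 k : 0 < u / q k ^+ 2 by rewrite divr_gt0 ?exprn_gt0.
have v_cvg : u / q k ^+ 2 @[k --> \oo] --> 0.
  rewrite (_ : (fun k => _) = (fun k => u * ((q k)^-1 * (q k)^-1))).
    by rewrite -(mulr0 u); apply: cvgMr; rewrite -(mulr0 0); exact: cvgM.
  by apply/funext => k; rewrite expr2 invfM.
have nv_cvg : (n k).+1%:R * (u / q k ^+ 2) ^+ 2 @[k --> \oo] --> c * u ^+ 2.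
  apply: (cvg_dist0 (cvg_cst (c * u ^+ 2)) (C := u ^+ 2) _ q_cvg) => k.
  have -> : (n k).+1%:R * (u / q k ^+ 2) ^+ 2 - c * u ^+ 2 =
      u ^+ 2 * ((n k).+1%:R - c * q k ^+ 4) / q k ^+ 4 by field; rewrite gt_eqF.
  rewrite normrM (normrM (u ^+ 2)) (@ger0_norm _ (u ^+ 2)) ?sqr_ge0// -mulrA ler_wpM2l ?sqr_ge0//.
  rewrite (@gtr0_norm _ (q k ^+ 4)^-1) ?invr_gt0 ?exprn_gt0// ler_pdivrMr ?exprn_gt0//.
  rewrite distrC; apply: le_trans (cr k) _.
  rewrite exprS mulKf ?gt_eqF// exprn_ege1//.
have [hc hs] := levy_clt Y_levy Y_laplace psi_series d1 v0 v_cvg nv_cvg.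
(* The one-sided estimate for g and for - g gives the two-sided one. *)
have Z2 g k : continuous g -> (forall y, `|g y| <= 1) ->
    (forall x y, `|g x - g y| <= `|x - y|) ->
    `|\int[P]_w g (u * (Q k w / q k ^+ 2)) - \int[P]_w g (u / q k ^+ 2 * Y (n k).+1%:R w)|
    <= u * (1 + V * (2 + K)) * (q k)^-1.
  move=> cg g1 glip; rewrite ler_norml.
  have h1 := subordinate_char_le cg g1 glip (q1 k) (ltW u0) (ler0n _ (n k).+1) (cr k) (Qq k).
  have cng : continuous (fun x => - g x) by move=> x; apply: cvgN; exact: cg.
  have ng1 y : `|- g y| <= 1 by rewrite normrN.
  have nglip x y : `|- g x - - g y| <= `|x - y| by rewrite -opprD normrN.
  have h2 := subordinate_char_le cng ng1 nglip (q1 k) (ltW u0) (ler0n _ (n k).+1) (cr k) (Qq k).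
  have [mQk _ _] := Qq k.
  have iN (X : T -> R) v : measurable_fun setT X ->
      \int[P]_w (- g (v * X w)) = - \int[P]_w g (v * X w).
    move=> mX; have ig := integrable_char P mX g1 glip v.
    by rewrite -mulN1r -(RintegralZl _ measurableT ig); apply: eq_Rintegral => w _; rewrite mulN1r.
  rewrite iN in h2; last exact: measurable_funM.
  rewrite iN in h2; last exact: (levy_measurable Y_levy).
  by apply/andP; split; lra.
split.
- apply: cvg_dist0 hc (fun k => Z2 (@cos R) k _ (@cos_max R) (@ler_norm_subcos R)) q_cvg.
  by move=> _; exact: continuous_cos.
- apply: cvg_dist0 hs (fun k => Z2 (@sin R) k _ (@sin_max R) (@ler_norm_subsin R)) q_cvg.
  by move=> _; exact: continuous_sin.
Qed.

(** Limits are taken inside the Fourier formulas. The limit of 1 - E cos(u Z) is 1 - e^(- b u^2),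
    whose integral is known with exponent 2; this produces b^(p/2) and Gamma(1 - p/2). Domination
    uses boundedness for u >= 1 and, for u < 1, the linear bound with E|Z| <= 1 + E Z^2 <= 1 + V c;
    the constant 3 + V c covers both. *)
Lemma cvg_subordinate_moments : dd 2%N != 0 ->
  \int[P]_w (`|Q k w / q k ^+ 2| `^ p) @[k --> \oo] -->
    (c * `|dd 2%N|) `^ (p / 2) * Gamma (1 - p / 2) / (cos (p * (pi / 2)) * Gamma (1 - p)) /\
  \int[P]_w (Num.sg (Q k w / q k ^+ 2) * `|Q k w / q k ^+ 2| `^ p) @[k --> \oo] --> 0.
Proof.
move=> d2; pose Z k w := Q k w / q k ^+ 2.
have d2_lt0 : dd 2%N < 0 by rewrite lt_neqAle d2; move: V0; lra.
have qk2 k : 0 < q k ^+ 2 by rewrite exprn_gt0.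
have mZ k : measurable_fun setT (Z k).
  by have [mQ _ _] := Qq k; apply: measurable_funM.
have iZ2 k : integrable_rv P (fun w => Z k w ^+ 2).
  by have [] := scaled_fractional (exprn_ge0 4 (ltW (q0 k))) (qk2 k) (Qq k).
have iZ k := integrable_rv_sqr (mZ k) (iZ2 k).
have EZ k : \int[P]_w `|Z k w| <= 1 + V * c.
  have [iQ /(_ 0)] := subordinate_moments Y_levy Y_laplace psi_series
    (exprn_ge0 4 (ltW (q0 k))) (Qq k).
  rewrite d1 expr0n/= !mul0r add0r => E2.
  have EZ2 : \int[P]_w (Z k w ^+ 2) <= V * c.
    rewrite -(ler_pM2r (exprn_gt0 4 (q0 k))) -mulrA mulrC; apply: le_trans E2.
    rewrite -(RintegralZl _ measurableT (iZ2 k)).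
    rewrite le_eqVlt; apply/orP; left; apply/eqP; apply: eq_Rintegral => w _.
    by rewrite subr0 /Z; field; rewrite gt_eqF.
  have i1 := integrable_rvD (integrable_rv_cst P 1) (iZ2 k).
  apply: (@le_trans _ _ (\int[P]_w (1 + Z k w ^+ 2))).
    apply: le_Rintegral => //; first exact: (integrable_norm (iZ k)).
    by move=> w _; rewrite -(real_normK (num_real (Z k w))); have := normr_ge0 (Z k w); nra.
  by rewrite (RintegralD measurableT (integrable_rv_cst P 1) (iZ2 k)) Rintegral_rv_cst lerD2l.
have Vc0 : 0 <= V * c by rewrite (mulr_ge0 V0)// ltW.
have pi0 := pi_gt0 R.
have pp0 : 0 < p * (pi / 2) by rewrite mulr_gt0// divr_gt0.
have pp1 : p * (pi / 2) < pi / 2 by rewrite gtr_pMl// divr_gt0.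
have G0 : 0 < Gamma (1 - p) := Gamma_gt0 p0 p1.
have iAB k := integrable_fractional p0 p1 (mZ k) (iZ2 k).
split.
- have cos_gt0 : 0 < cos (p * (pi / 2)) by rewrite cos_gt0_pihalf// pp1 andbT; lra.
  pose a := cos (p * (pi / 2)) * (Gamma (1 - p) / p).
  have a0 : 0 < a by rewrite mulr_gt0// divr_gt0.
  pose b := c * `|dd 2%N|.
  have b0 : 0 < b by rewrite mulr_gt0// normr_gt0.
  have -> : (fun k => \int[P]_w (`|Q k w / q k ^+ 2| `^ p)) = (fun k => a^-1 *
      \int[@lebesgue_measure R]_(u in `]0%R, +oo[)
        ((1 - \int[P]_w cos (u * Z k w)) * u `^ (- 1 - p))).
    by apply/funext => k; rewrite -(fractional_cos p0 p1 (mZ k) (iZ k) (iAB k).1) mulKf// gt_eqF.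
  have -> : b `^ (p / 2) * Gamma (1 - p / 2) / (cos (p * (pi / 2)) * Gamma (1 - p)) =
     a^-1 * (b `^ (p / 2) * Gamma (1 - p / 2) / p).
    have alg (x y z w : R) : y != 0 -> z != 0 -> w != 0 ->
      x / (y * z) = (y * (z / w))^-1 * (x / w) by move=> *; field; apply/and3P.
    by apply: alg; rewrite gt_eqF.
  apply: cvgMr; rewrite -(Rintegral_one_sub_expR b0 _ p0)//.
  apply: (cvg_fractional p0 p1 (C := 3 + V * c)).
  + move=> k; apply: measurable_funB => //.
    exact: (measurable_char (mZ k) (iZ k) (@cos_max R) (@ler_norm_subcos R)).
  + move=> k u u0.
    have h1 := ler_norm_char P (mZ k) (@cos_max R) (@ler_norm_subcos R) u.
    have h2 := ler_norm_charB (mZ k) (iZ k) (@cos_max R) (@ler_norm_subcos R) 0 u.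
    rewrite (_ : \int[P]_w cos (0 * Z k w) = 1) in h2; last first.
      by rewrite -[RHS](Rintegral_rv_cst P 1); apply: eq_Rintegral => w _; rewrite mul0r cos0.
    rewrite sub0r normrN (gtr0_norm u0) in h2.
    case: (leP 1 u) => u1.
      by apply: le_trans (ler_normB _ _) _; rewrite normr1; lra.
    apply: le_trans h2 _; rewrite ler_pM2r//; apply: le_trans (EZ k) _; lra.
  + move=> u u0; apply: cvgB; first exact: cvg_cst.
    have [+ _] := cvg_subordinate_char u0.
    rewrite (_ : dd 2%N * _ = - (b * u `^ 2))//.
    by rewrite /b ltr0_norm// powR_mulrn ?(ltW u0)//; ring.
- have sin_gt0 : 0 < sin (p * (pi / 2)) by rewrite sin_gt0_pi// pp0/=; lra.
  pose a := sin (p * (pi / 2)) * (Gamma (1 - p) / p).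
  have a0 : 0 < a by rewrite mulr_gt0// divr_gt0.
  have -> : (fun k => \int[P]_w (Num.sg (Q k w / q k ^+ 2) * `|Q k w / q k ^+ 2| `^ p)) =
      (fun k => a^-1 * \int[@lebesgue_measure R]_(u in `]0%R, +oo[)
        ((\int[P]_w sin (u * Z k w)) * u `^ (- 1 - p))).
    by apply/funext => k; rewrite -(fractional_sin p0 p1 (mZ k) (iZ k) (iAB k).2) mulKf// gt_eqF.
  have I0 : \int[@lebesgue_measure R]_(u in `]0%R, +oo[) (0 * u `^ (- 1 - p)) = 0.
    by under eq_Rintegral do rewrite mul0r; rewrite /Rintegral integral0.
  rewrite -[X in _ --> X](mulr0 a^-1); apply: cvgMr; rewrite -[X in _ --> X]I0.
  apply: (@cvg_fractional R p (3 + V * c) (fun k u => \int[P]_w sin (u * Z k w)) (fun=> 0)) => //.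
  + move=> k; exact: (measurable_char (mZ k) (iZ k) (@sin_max R) (@ler_norm_subsin R)).
  + move=> k u u0.
    have h1 := ler_norm_char P (mZ k) (@sin_max R) (@ler_norm_subsin R) u.
    have h2 := ler_norm_charB (mZ k) (iZ k) (@sin_max R) (@ler_norm_subsin R) u 0.
    rewrite (_ : \int[P]_w sin (0 * Z k w) = 0) in h2; last first.
      by rewrite -[RHS](Rintegral_rv_cst P 0); apply: eq_Rintegral => w _; rewrite mul0r sin0.
    rewrite !subr0 (gtr0_norm u0) in h2.
    case: (leP 1 u) => u1; first lra.
    apply: le_trans h2 _; rewrite ler_pM2r//; apply: le_trans (EZ k) _; lra.
  + by move=> u u0; have [_] := cvg_subordinate_char u0.
Qed.

End sequence.

(** The limit over real t is tested on sequences, so that versions [Q] can be chosen for countably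
    many times and dominated convergence applies. *)
Lemma quadratic_growth : dd 2%N != 0 ->
  am t / (c * `|dd 2%N| * t) `^ (p / 2) @[t --> +oo] -->
    Gamma (1 - p / 2) / (cos (p * (pi / 2)) * Gamma (1 - p)) /\
  sm t / (c * `|dd 2%N| * t) `^ (p / 2) @[t --> +oo] --> (0 : R).
Proof.
move=> d2; pose b := c * `|dd 2%N|.
have b0 : 0 < b by rewrite mulr_gt0// normr_gt0.
have key (tau : nat -> R) : tau k @[k --> \oo] --> +oo ->
    am (tau k) / (b * tau k) `^ (p / 2) @[k --> \oo] -->
      Gamma (1 - p / 2) / (cos (p * (pi / 2)) * Gamma (1 - p)) /\
    sm (tau k) / (b * tau k) `^ (p / 2) @[k --> \oo] --> (0 : R).
  move=> tauy.
  (* The fourth root of the time; the maximum gives q >= 1 for every k and alters only finitely many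
     terms. *)
  pose q k := Num.sqrt (Num.sqrt (Num.max 1 (tau k))).
  have max0 k : 0 <= Num.max 1 (tau k) by rewrite le_max ler01.
  have q4 k : q k ^+ 4 = Num.max 1 (tau k).
    by rewrite (exprM _ 2 2) sqr_sqrtr ?sqrtr_ge0// sqr_sqrtr.
  have q1 k : 1 <= q k.
    by rewrite -[leLHS]sqrtr1 ler_wsqrtr// -[leLHS]sqrtr1 ler_wsqrtr// le_max lexx.
  have q0 k : 0 < q k by apply: lt_le_trans (q1 k).
  have tau_ge (M : R) : \forall k \near \oo, M <= tau k.
    by move/cvgryPge : tauy; exact.
  have q_cvg : (q k)^-1 @[k --> \oo] --> 0.
    apply/cvgrPdist_le => e e0; apply: filterS (tau_ge (e^-1 ^+ 4)) => k tk.
    rewrite sub0r normrN gtr0_norm ?invr_gt0// invf_ple ?posrE//.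
    rewrite -(@ler_pXn2r _ 4) ?nnegrE ?invr_ge0 ?(ltW e0) ?(ltW (q0 k))//.
    by rewrite q4 le_max tk orbT.
  have [Q Qq] := choice (fun k => ex_subordinate_rv Y_levy alpha_gt0 alpha_le1 theta_gt0
    S_ting YS_indep (exprn_ge0 4 (ltW (q0 k)))).
  have [h1 h2] := cvg_subordinate_moments q1 q_cvg Qq d2.
  have scale k : 1 <= tau k -> (b * tau k) `^ (p / 2) = b `^ (p / 2) * (q k ^+ 2) `^ p.
    move=> tk; have -> : tau k = q k ^+ 4 by rewrite q4 max_r.
    rewrite powRM ?exprn_ge0 ?(ltW (q0 k)) ?(ltW b0)//; congr (_ * _).
    have q20 : 0 <= q k ^+ 2 by rewrite sqr_ge0.
    rewrite (exprM _ 2 2) -(powR_mulrn 2 q20) -powRrM; congr (_ `^ _); by field.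
  have bp0 : 0 < b `^ (p / 2) by rewrite powR_gt0.
  have near1 (A : R -> R) (Z : nat -> R) (l : R) :
      (forall k, A (q k ^+ 4) / (q k ^+ 2) `^ p = Z k) -> Z k @[k --> \oo] --> b `^ (p / 2) * l ->
      A (tau k) / (b * tau k) `^ (p / 2) @[k --> \oo] --> l.
    move=> AZ Zl.
    have -> : l = (b `^ (p / 2))^-1 * (b `^ (p / 2) * l) by rewrite mulKf// gt_eqF.
    have h : (b `^ (p / 2))^-1 * Z k @[k --> \oo] --> (b `^ (p / 2))^-1 * (b `^ (p / 2) * l).
      exact: cvgMr.
    apply: cvg_trans h; apply: near_eq_cvg.
    apply: filterS (tau_ge 1) => k tk.
    rewrite -AZ scale// (_ : tau k = q k ^+ 4) 1?q4 ?max_r//.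
    by rewrite invfM; ring.
  have scaled k := scaled_fractional (exprn_ge0 4 (ltW (q0 k))) (exprn_gt0 2 (q0 k)) (Qq k).
  split.
  - apply: near1 (fun k => \int[P]_w (`|Q k w / q k ^+ 2| `^ p)) _ _ _.
      by move=> k; have [_ ->] := scaled k.
    by rewrite mulrA.
  - apply: near1 (fun k => \int[P]_w (Num.sg (Q k w / q k ^+ 2) * `|Q k w / q k ^+ 2| `^ p)) _ _ _.
      by move=> k; have [_ _ ->] := scaled k.
    by rewrite mulr0.
by split; apply/cvg_pinftyP => tau /key[].
Qed.

End quadratic_growth.

End asymptotics.

(** * Possible values of m and identification of the complex constants *)

Lemma cis_neq0 (R : realType) (x : R) : (cos x +i* sin x : R[i]) != 0.
Proof.
apply/eqP => /eqP; rewrite eq_complex/= => /andP[/eqP hc /eqP hs].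
by have := cos2Dsin2 x; rewrite hc hs expr0n/= addr0 => /esym/eqP; rewrite oner_eq0.
Qed.

Lemma ppow_mul_pos (R : realType) (k x p : R) : 0 < k -> x != 0 ->
  ppow (k * x) p = ((k * `|x|) `^ p)%:C *
    (if 0 < x then 1 else cos (pi * p) +i* sin (pi * p)).
Proof.
move=> k0 x0; rewrite /ppow; have [xp|xn] := ltP 0 x.
  by rewrite pmulr_rge0// (ltW xp) mulr1 gtr0_norm.
have xlt0 : x < 0 by rewrite lt_neqAle x0.
by rewrite pmulr_rge0// leNgt xlt0/= normrM (gtr0_norm k0).
Qed.

(** If d_1 = d_2 = 0, then Y_1 has second moment 0 and vanishes almost surely, so psi = 0 on the
    positive half-line. The series remainder of order m + 1 then gives |d_m| <= B eta for all small
    eta, against d_m being non-zero. *)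
Lemma levy_first_coef_le2 d (T : measurableType d) (R : realType) (P : probability T R)
    (Y : R -> T -> R) (psi : R -> R) (dd : nat -> R) (m : nat) :
  is_levy P Y -> laplace_exponent P Y psi ->
  (forall eta : R, 0 < eta -> (\sum_(1 <= k < n) dd k * eta ^+ k) @[n --> \oo] --> psi eta) ->
  dd m != 0 -> (forall k, (1 <= k < m)%N -> dd k = 0) -> (m <= 2)%N.
Proof.
move=> LY EY psi_series dm0 d0; rewrite leqNgt; apply/negP => m3.
have [iY _ +] := levy_series_moments LY EY psi_series ler01.
rewrite (d0 1%N) ?(ltn_trans _ m3)// (d0 2%N)// !mulr0 expr0n/= subr0 => EY2.
have Y0 : {ae P, forall w, Y 1 w = 0}.
  have : (\int[P]_w `|(Y 1 w ^+ 2)%:E| = 0)%E.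
    under eq_integral do rewrite gee0_abs ?lee_fin ?sqr_ge0//.
    by rewrite -(EFin_Rintegral_rv iY) EY2.
  move/(ae_eq_integral_abs P measurableT (measurable_int _ iY)).1.
  by apply: filterS => w /(_ I)/= []/eqP; rewrite sqrf_eq0 => /eqP.
have psi0 eta : 0 < eta -> psi eta = 0.
  move=> eta0; have := EY 1 eta ler01 eta0.
  rewrite (@ae_eq_expectation _ _ _ P _ (cst 1)); last first.
    by apply: filterS Y0 => w ->; rewrite mulr0 oppr0 expR0.
  rewrite expectation_cst mul1r => -[/esym]; rewrite -expR0 => /expR_inj/eqP.
  by rewrite oppr_eq0 => /eqP.
have [B B0 HB] := power_series_remainder psi_series (isT : (1 <= m.+1)%N).
have dm_gt0 : 0 < `|dd m| by rewrite normr_gt0.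
have bnd eta : 0 < eta < 2^-1 -> `|dd m| <= B * eta.
  move=> eta2; have /andP[eta0 _] := eta2; have := HB eta eta2.
  rewrite big_nat_recr/=; last exact: leq_trans m3.
  rewrite big_nat_cond big1 ?psi0//; last first.
    by move=> k; rewrite andbT => k1m; rewrite d0// mul0r.
  rewrite sub0r add0r normrN normrM (@gtr0_norm _ (eta ^+ m)) ?exprn_gt0// exprS mulrA.
  by rewrite ler_pM2r ?exprn_gt0.
(* Chosen so that B eta < |d_m|. *)
pose eta := Num.min 4^-1 (`|dd m| / (2 * (B + 1))).
have B1 : 0 < 2 * (B + 1) by rewrite mulr_gt0//; lra.
have eta1 : eta <= 4^-1 by rewrite ge_min lexx.
have eta0 : 0 < eta by rewrite lt_min (divr_gt0 dm_gt0 B1) andbT invr_gt0.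
have eta2 : 0 < eta < 2^-1 by rewrite eta0; lra.
have := bnd eta eta2; apply/negP; rewrite -ltNge.
have : eta <= `|dd m| / (2 * (B + 1)) by rewrite ge_min lexx orbT.
by rewrite ler_pdivlMr//; nra.
Qed.

Lemma cos_half_angle (R : realType) (p : R) :
  1 + cos (pi * p) = 2 * cos (p * (pi / 2)) ^+ 2 /\
  sin (pi * p) = 2 * (sin (p * (pi / 2)) * cos (p * (pi / 2))).
Proof.
have -> : pi * p = p * (pi / 2) + p * (pi / 2) by field.
rewrite cosD sinD; have := cos2Dsin2 (p * (pi / 2)).
by split; [nra|ring].
Qed.

Theorem theorem4p7 (R : realType) (disp : measure_display)
    (T : measurableType disp) (P : probability T R)
    (Y S : R -> T -> R) (psi : R -> R) (d : nat -> R) (m : nat)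
    (xi alpha theta p : R)
    (Y_levy : is_levy P Y)
    (Y_laplace : laplace_exponent P Y psi)
    (psi_series : forall eta : R, 0 < eta ->
       (\sum_(1 <= k < n) d k * eta ^+ k) @[n --> \oo] --> psi eta)
    (m_ge1 : (1 <= m)%N)
    (dm_neq0 : d m != 0)
    (m_least : forall k, (1 <= k < m)%N -> d k = 0)
    (xi_def : xi = d m)
    (alpha_gt0 : 0 < alpha) (alpha_le1 : alpha <= 1) (theta_gt0 : 0 < theta)
    (S_ting : is_TInG P alpha theta S)
    (YS_indep : independent_processes P Y S)
    (p_gt0 : 0 < p) (p_lt1 : p < 1) :
  (p < alpha ->
     forall t : R, 0 <= t -> finite_moment P (subordinate Y S t) p) /\
  ((fractional_moment P (subordinate Y S t) p /
    (ppow (alpha * theta `^ (alpha - 1) * expR (- theta) * xi * t)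
          (p / m%:R)
     * (Gamma (1 - p / m%:R))%:C / (Gamma (1 - p))%:C) : R[i]^o)
     @[t --> +oo] --> (1 : R[i]^o)).
Proof.
split.
  move=> _ t t0.
  exact: (subordinate_finite_moment Y_levy Y_laplace psi_series alpha_gt0 alpha_le1 theta_gt0
    S_ting YS_indep p_gt0 p_lt1 t0).
have c0 : 0 < ting_mean alpha theta := ting_mean_gt0 alpha_gt0 theta_gt0.
have G0 : 0 < Gamma (1 - p) := Gamma_gt0 p_gt0 p_lt1.
have xi0 : xi != 0 by rewrite xi_def.
have k0 : 0 < ting_mean alpha theta * `|xi| by rewrite mulr_gt0// normr_gt0.
have ppowE (q t : R) : 0 < t ->
    ppow (alpha * theta `^ (alpha - 1) * expR (- theta) * xi * t) q =
    ((ting_mean alpha theta * `|xi| * t) `^ q)%:C *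
      (if 0 < xi then 1 else cos (pi * q) +i* sin (pi * q)).
  move=> t0; rewrite -/(ting_mean alpha theta) [_ * xi * t]mulrAC.
  by rewrite (ppow_mul_pos _ (mulr_gt0 c0 t0) xi0) [_ * t * _]mulrAC.
have := levy_first_coef_le2 Y_levy Y_laplace psi_series dm_neq0 m_least.
case: m m_ge1 dm_neq0 m_least xi_def => [//|[|[|//]]] _ dm0 m_least xi_def _.
- pose delta : R[i] := if 0 < xi then 1 else cos (pi * p) +i* sin (pi * p).
  have [h1 h2] := linear_growth Y_levy Y_laplace psi_series alpha_gt0 alpha_le1 theta_gt0
    S_ting YS_indep p_gt0 p_lt1 dm0.
  rewrite -xi_def in h1 h2.
  apply: (fractional_ratio Y_levy Y_laplace psi_series alpha_gt0 alpha_le1 theta_gt0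
    S_ting YS_indep p_gt0 p_lt1 (delta := delta) _ _ _ _ h1 h2).
  + rewrite /delta; have [xip|xin] := ltP 0 xi.
      by rewrite gtr0_sg// subrr mulr0; congr (_ +i* _); field.
    rewrite ltr0_sg ?lt_neqAle ?xi0//.
    by congr (_ +i* _); field.
  + by rewrite /delta; case: ifP => _; [exact: oner_neq0|exact: cis_neq0].
  + by move=> t t0; rewrite powR_gt0// mulr_gt0.
  + move=> t t0; rewrite divr1 ppowE// -mulrA divff ?mulr1//.
    by rewrite fmorph_eq0 gt_eqF.
- have d1 : d 1%N = 0 by exact: m_least.
  have p20 : 0 < p / 2 by rewrite divr_gt0.
  have p21 : p / 2 < 1 by lra.
  have G20 : 0 < Gamma (1 - p / 2) := Gamma_gt0 p20 p21.
  have xi_lt0 : xi < 0.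
    rewrite lt_neqAle xi0/= xi_def.
    by have := levy_var_ge0 Y_levy Y_laplace psi_series; lra.
  (* As xi < 0, its principal power of order p / 2 has phase e^(i pi p / 2). The signed moment has
     limit 0, so the combination to match is (1 + e^(i pi p)) / 2 times the absolute one, and the
     half-angle formulas identify the two. *)
  pose delta : R[i] := (cos (pi * (p / 2)) +i* sin (pi * (p / 2))) *
    (Gamma (1 - p / 2) / Gamma (1 - p))%:C.
  have [h1 h2] := quadratic_growth Y_levy Y_laplace psi_series alpha_gt0 alpha_le1 theta_gt0
    S_ting YS_indep p_gt0 p_lt1 d1 dm0.
  rewrite -xi_def in h1 h2.
  apply: (fractional_ratio Y_levy Y_laplace psi_series alpha_gt0 alpha_le1 theta_gt0
    S_ting YS_indep p_gt0 p_lt1 (delta := delta) _ _ _ _ h1 h2).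
  + have cos_gt0 : 0 < cos (p * (pi / 2)).
      have pi20 : 0 < pi / 2 :> R by rewrite divr_gt0// pi_gt0.
      have pp0 : 0 < p * (pi / 2) by rewrite mulr_gt0.
      rewrite cos_gt0_pihalf// gtr_pMl// p_lt1 andbT.
      by apply: lt_trans pp0; rewrite oppr_lt0.
    have cis_ratio (co si g2 g1 z : R) : co != 0 -> g1 != 0 ->
        (co +i* si) * (g2 / g1)%:C =
        (2 * co ^+ 2 / 2 * (g2 / (co * g1)) + z * 0)
        +i* (2 * (si * co) / 2 * (g2 / (co * g1) - 0)).
      by move=> *; simpc; congr (_ +i* _); field; apply/andP.
    have [-> ->] := cos_half_angle p.
    rewrite /delta (_ : pi * (p / 2) = p * (pi / 2)); last by field.
    by apply: cis_ratio; rewrite gt_eqF.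
  + by rewrite mulf_neq0 ?cis_neq0// fmorph_eq0 gt_eqF// divr_gt0.
  + by move=> t t0; rewrite powR_gt0// mulr_gt0.
  + move=> t t0; rewrite ppowE// ltNge (ltW xi_lt0)/= /delta rmorphM fmorphV/=.
    by rewrite !mulrA.
Qed.
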